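(* Suppose $M$ is a compact manifold and $\|\cdot\|$ is a strongly integrable pseudo-metric on $M \times (0,1]$ with the following properties: (a) There exists $C_1 > 1$ such that $$\frac{1}{C_1 t} \leq \left\| \left( 0, \frac{d}{dt} \right) \right\|_{(p,t)} \leq C_1 \frac{1}{t}$$ for all $(p,t) \in M \times (0,1]$. (b) There exists $C_2 > 0$ such that $$\left\| (v,0) \right\|_{(p,t)} + \left\| \left(0,\frac{d}{dt}\right) \right\|_{(p,t)} \leq C_2 \left\| \left( v, \frac{d}{dt}\right) \right\|_{(p,t)}$$ for all $(p,t) \in M \times (0,1]$ and $v \in T_pM$. (c) There exist $C_3, \lambda > 0$ such that $$\left\| (v,0) \right\|_{(p,s)} \geq C_3 \left( \frac{t}{s}\right)^{\lambda} \left\| (v,0)\right\|_{(p,t)}$$ for all $p \in M$, $0 < s \leq t \leq 1$, and $v \in T_pM$. Then the distance on $M \times (0,1]$ induced by $\|\cdot\|$ is Gromov hyperbolic.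
   Context: Tangent vectors at $(p,t) \in M\times(0,1]$ are written as pairs in $T_pM \oplus T_t(0,1]$, and $\frac{d}{dt}$ is the standard coordinate vector on $(0,1]$. A pseudo-metric on a connected $n$-manifold $N$ (here $N = M\times(0,1]$) is a family $\{\|\cdot\|_q\}_{q\in N}$ of functions $\|\cdot\|_q : T_qN \to [0,+\infty)$ (not necessarily norms) such that: (1) $\|tv\|_q = |t|\,\|v\|_q$ for all $t\in\mathbb{R}$, $v\in T_qN$; (2) for every coordinate chart $(U,\psi)$ and every $p\in U$ there exist $C>1$ and an open neighborhood $V$ of $p$ in $U$ such that $\frac1C \|d(\psi)_q v\| \le \|v\|_q \le C\|d(\psi)_q v\|$ for all $q\in V$, $v\in T_qN$ (Euclidean norm in the chart). A curve $\sigma:I\to N$ is absolutely continuous if it is locally absolutely continuous in every coordinate chart. The pseudo-metric is strongly integrable if for every absolutely continuous $\sigma:[a,b]\to N$ the almost everywhere defined function $t\mapsto \|\sigma'(t)\|_{\sigma(t)}$ is Lebesgue integrable on $[a,b]$. The induced distance is $$\mathrm{d}(p,q)=\inf\left\{\int_a^b \|\sigma'(t)\|_{\sigma(t)}\,dt : \sigma:[a,b]\to N \text{ absolutely continuous},\ \sigma(a)=p,\ \sigma(b)=q\right\}.$$ A proper geodesic metric space is Gromov hyperbolic if there is $\delta\ge 0$ such that every geodesic triangle is $\delta$-slim (each point on any side is within distance $\delta$ of the union of the other two sides). *)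

(* Defs.v *)
From HB Require Import structures.
From mathcomp Require Import all_boot all_order all_algebra.
From mathcomp Require Import all_classical all_reals all_analysis.

Set Implicit Arguments.
Unset Strict Implicit.
Unset Printing Implicit Defensive.
Import Order.TTheory GRing.Theory Num.Theory.
Import numFieldNormedType.Exports.

Local Open Scope classical_set_scope.
Local Open Scope ring_scope.

Section smooth_maps.
Context {R : realType} {E F : normedModType R}.

(* Only meaningful for open [W]: [f] is of class C^k on [W]. *)
Fixpoint class_C (k : nat) (W : set E) (f : E -> F) : Prop :=
  if k is k'.+1 then
    (forall x, W x -> differentiable f x) /\
    (forall v, class_C k' W (fun x => 'd f x v))
  else forall x, W x -> {for x, continuous f}.

(* [g] is a C^oo map near [x] that extends the restriction of [f] to [A]. *)
Definition smooth_extension (A : set E) (f : E -> F) (x : E) : set (E -> F) :=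
  [set g | exists W : set E, [/\ open_nbhs x W,
    forall k, class_C k W g & forall y, (W `&` A) y -> g y = f y]].

Definition smooth_on (A : set E) (f : E -> F) : Prop :=
  forall x, A x -> smooth_extension A f x !=set0.

(* The differential at [x] of a map that is smooth on [A], computed on an
   arbitrary smooth extension.  It does not depend on the extension when [A] is
   open in [E] or relatively open in a half-space of [E], the only cases used
   below. *)
Definition diff_on (A : set E) (f : E -> F) (x : E) : E -> F :=
  'd (get (smooth_extension A f x)) x.

End smooth_maps.

(* [chart_inv] is the inverse of [chart_map] on the image of [chart_dom]; both
   maps are irrelevant elsewhere. *)
Record chart (T E : Type) := Chart {
  chart_dom : set T ;
  chart_map :> T -> E ;
  chart_inv : E -> T }.

(* [chart_at q] is a distinguished chart around [q].  The tangent space at [q]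
   is identified with the model space [E] through the differential at [q] of
   [chart_at q]: a vector of [E], regarded as a tangent vector at [q], is the
   coordinate vector in the chart [chart_at q]. *)
Record atlas (T E : Type) := Atlas {
  charts : set (chart T E) ;
  chart_at : T -> chart T E }.

Section manifolds.
Context {R : realType} {E : normedModType R} {T : topologicalType}.
(* The local model: [setT] for manifolds without boundary, a closed half-space
   of [E] for manifolds with boundary. *)
Variable H : set E.
Implicit Types (c : chart T E) (A : atlas T E).

Definition is_chart c : Prop :=
  [/\ open (chart_dom c),
      {within chart_dom c, continuous (chart_map c)},
      exists2 W : set E, open W & c @` chart_dom c = W `&` H,
      forall p, chart_dom c p -> chart_inv c (c p) = p &
      {within c @` chart_dom c, continuous (chart_inv c)}].

Definition overlap c c' : set E := c @` (chart_dom c `&` chart_dom c').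

Definition transition c c' : E -> E := c' \o chart_inv c.

Definition compatible c c' : Prop :=
  smooth_on (overlap c c') (transition c c') /\
  smooth_on (overlap c' c) (transition c' c).

Definition smooth_atlas A : Prop :=
  [/\ forall c, charts A c -> is_chart c,
      forall c c', charts A c -> charts A c' -> compatible c c' &
      forall q, charts A (chart_at A q) /\ chart_dom (chart_at A q) q].

Definition smooth_manifold A : Prop :=
  [/\ hausdorff_space T, @second_countable T & smooth_atlas A].

(* The charts of the maximal atlas. *)
Definition coordinate_chart A c : Prop :=
  is_chart c /\ forall c', charts A c' -> compatible c c'.

(* d(c)_q : T_q -> E *)
Definition dchart A c (q : T) : E -> E :=
  diff_on (overlap (chart_at A q) c) (transition (chart_at A q) c)
    (chart_at A q q).

Definition abs_continuous (a b : R) (f : R -> E) : Prop :=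
  forall e : R, 0 < e -> exists2 d : R, 0 < d & forall s : seq (R * R),
    (forall I, I \in s -> a <= I.1 /\ I.1 <= I.2 /\ I.2 <= b) ->
    pairwise (fun I J => (I.2 <= J.1) || (J.2 <= I.1)) s ->
    \sum_(I <- s) (I.2 - I.1) < d ->
    \sum_(I <- s) `|f I.2 - f I.1| < e.

(* A curve [a, b] -> T is given by a map R -> T, of which only the restriction
   to [a, b] matters. *)
Definition abs_continuous_curve A (a b : R) (sigma : R -> T) : Prop :=
  {within `[a, b], continuous sigma} /\
  forall c, coordinate_chart A c -> forall u v : R,
    a <= u -> u <= v -> v <= b ->
    (forall t, t \in `[u, v] -> chart_dom c (sigma t)) ->
    abs_continuous u v (c \o sigma).

(* sigma'(t), as an element of T_{sigma(t)} = E *)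
Definition velocity A (sigma : R -> T) (t : R) : E :=
  derive1 (chart_at A (sigma t) \o sigma) t.

Record pseudo_metric (eucl : E -> R) A (nrm : T -> E -> R) : Prop := {
  pseudo_metric_ge0 : forall q v, 0 <= nrm q v ;
  pseudo_metricZ : forall q (k : R) v, nrm q (k *: v) = `|k| * nrm q v ;
  pseudo_metric_chart : forall c, coordinate_chart A c ->
    forall p, chart_dom c p ->
    exists2 C : R, 1 < C & exists V : set T,
      [/\ open_nbhs p V, V `<=` chart_dom c &
          forall q v, V q ->
            C^-1 * eucl (dchart A c q v) <= nrm q v /\
            nrm q v <= C * eucl (dchart A c q v)] }.

Definition speed A (nrm : T -> E -> R) (sigma : R -> T) (t : R) : R :=
  nrm (sigma t) (velocity A sigma t).

Definition strongly_integrable A (nrm : T -> E -> R) : Prop :=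
  forall (a b : R) (sigma : R -> T), a <= b -> abs_continuous_curve A a b sigma ->
    completed_lebesgue_measure.-integrable `[a, b]
      (fun t => (speed A nrm sigma t)%:E).

Definition induced_distance A (nrm : T -> E -> R) (p q : T) : R :=
  inf [set l | exists a b sigma,
    [/\ a <= b, abs_continuous_curve A a b sigma, sigma a = p, sigma b = q &
        l = \int[completed_lebesgue_measure]_(t in `[a, b])
              speed A nrm sigma t]].

End manifolds.

Section cylinder.
Context {R : realType} {m : nat} {M : topologicalType}.

Definition unit_itv : Type := `]0 : R, 1]%classic.

HB.instance Definition _ := Topological.on unit_itv.

Fact unit_itv1_subproof : (1 : R) \in `]0 : R, 1]%classic.
Proof. by apply/mem_set; rewrite /= in_itv /= ltr01 lexx. Qed.

Definition unit_itv1 : unit_itv := exist _ 1 unit_itv1_subproof.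

Definition cylinder : Type := (M * unit_itv)%type.

HB.instance Definition _ := Topological.on cylinder.

Definition half_space : set ('rV[R]_m * R) := [set x | x.2 <= 1].

Definition cylinder_chart (c : chart M 'rV[R]_m) :
    chart cylinder ('rV[R]_m * R) := {|
  chart_dom := [set q | chart_dom c q.1] ;
  chart_map := fun q => (c q.1, \val q.2) ;
  chart_inv := fun x => (chart_inv c x.1, insubd unit_itv1 x.2) |}.

(* With this choice of [chart_at], T_(p,t) (M x (0,1]) is the direct sum
   T_p M (+) R d/dt, and (v, s) stands for v + s d/dt. *)
Definition cylinder_atlas (A : atlas M 'rV[R]_m) :
    atlas cylinder ('rV[R]_m * R) := {|
  charts := cylinder_chart @` charts A ;
  chart_at := fun q => cylinder_chart (chart_at A q.1) |}.

Definition euclidean_norm (x : 'rV[R]_m * R) : R :=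
  Num.sqrt (\sum_(i < m) x.1 ord0 i ^+ 2 + x.2 ^+ 2).

End cylinder.
Arguments unit_itv R : clear implicits.
Arguments cylinder R M : clear implicits.
Arguments half_space {R m}.

Record is_distance {R : realType} {X : choiceType} (d : X -> X -> R) : Prop := {
  distxx : forall x, d x x = 0 ;
  dist_positivity : forall x y, d x y = 0 -> x = y ;
  dist_sym : forall x y, d x y = d y x ;
  dist_triangle : forall y x z, d x z <= d x y + d y z }.

Definition metric_space {R : realType} {X : choiceType} (d : X -> X -> R)
  (dP : is_distance d) : Type := X.

Section metric_space.
Context {R : realType} {X : choiceType} (d : X -> X -> R) (dP : is_distance d).

HB.instance Definition _ := Choice.on (metric_space dP).
HB.instance Definition _ := @isMetric.Build R (metric_space dP) d
  (distxx dP) (dist_positivity dP) (dist_sym dP) (dist_triangle dP).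

End metric_space.

Section gromov_hyperbolic.
Context {R : realType} (X : metricType R).

Definition proper_space : Prop :=
  forall (x : X) (r : R), compact [set y : X | mdist x y <= r].

Definition geodesic_segment (x y : X) (S : set X) : Prop :=
  exists (L : R) (gamma : R -> X),
    [/\ 0 <= L, gamma 0 = x, gamma L = y,
        {in `[0, L] &, forall s t, mdist (gamma s) (gamma t) = `|s - t|} &
        S = gamma @` `[0, L]].

Definition geodesic_space : Prop :=
  forall x y : X, exists S, geodesic_segment x y S.

Definition near_set (delta : R) (S S' : set X) : Prop :=
  forall p, S p -> exists2 q, S' q & mdist p q <= delta.

Definition slim (delta : R) (S1 S2 S3 : set X) : Prop :=
  [/\ near_set delta S1 (S2 `|` S3), near_set delta S2 (S3 `|` S1) &
      near_set delta S3 (S1 `|` S2)].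

Definition gromov_hyperbolic : Prop :=
  [/\ proper_space, geodesic_space &
      exists2 delta : R, 0 <= delta & forall (x y z : X) (S1 S2 S3 : set X),
        geodesic_segment x y S1 -> geodesic_segment y z S2 ->
        geodesic_segment z x S3 -> slim delta S1 S2 S3].

End gromov_hyperbolic.

(* Main.v *)
Require Import Defs.
From HB Require Import structures.
From mathcomp Require Import all_boot all_order all_algebra.
From mathcomp Require Import all_classical all_reals all_analysis.
From mathcomp Require Import measurable_realfun ring lra.
Import Order.TTheory GRing.Theory Num.Theory.
Import numFieldNormedType.Exports.
Local Open Scope classical_set_scope.
Local Open Scope ring_scope.
Set Implicit Arguments.
Unset Strict Implicit.
Unset Printing Implicit Defensive.

(** Let h(p, t) = ln t be the height, and for tau <= 0 let P_tau move (p, t)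
vertically to (p, exp tau).  Hypotheses (a) and (b) make h Lipschitz and vertical
curves of logarithmic length; (b) bounds the horizontal component of a tangent
vector by its norm, and then (c) says that P_tau contracts lengths by
exp (- lambda * (tau - h)) on what lies below the height tau.  Compactness of M
bounds the diameter of the top slice M x {1}.  So the cylinder is a space in
which going up contracts exponentially and whose top is bounded, as the
complement of a horoball in the upper half-space model of the hyperbolic space,
up to a compact quotient; Gromov hyperbolicity follows from this alone.

The metric part is about an abstract metric space with a height and vertical
maps ([vertical_contraction]).  A geodesic cannot stay long below a given height:
climbing a bounded amount, travelling there and coming down would be shorter
([low_excursion]).  So if the height along a geodesic has a record at the point
w, the vertical projections of the earlier points to the height of w move by a
convergent geometric series, and w is close to the point above the origin
([record_contraction]).  Hence a geodesic from x to y looks like an arch: it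
follows the vertical line of x up to some height T, above which the vertical
lines of x and y are close, and then follows the vertical line of y down
([geodesic_profile]).  A triangle is then made of three vertical lines,
merging pairwise at the tops of the arches, and is slim for the same reason as a
tripod ([vertical_contraction_slim]).

The analytic part provides the metric space.  Absolutely continuous functions
are almost everywhere differentiable and are the integrals of their derivatives
([abs_continuous_ae_derivable], through total variation and the Radon-Nikodym
theorem), so that the increment of a function along a curve is bounded by the
integral of a bound on its derivative ([abs_continuous_le_integral]).  Applied
to the height this gives [height_le_length]; applied to the coordinates of a
chart it gives, by a first exit argument, that the induced distance separates
points and induces a topology at least as fine as that of the manifold
([dist_nbhs]).  Conversely short segments in a chart are short curves
([joined_horizontal]), whence continuity of the distance and, M being connected
and compact, finiteness and properness.  A proper space whose distance is
an infimum of lengths is geodesic ([proper_length_geodesic]). *)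

(** * Absolute continuity *)

Section absolute_continuity.
Context {R : realType} {E : normedModType R}.
Implicit Types (a b u v : R) (f g : R -> E).

Lemma abs_continuousS a b u v f : a <= u -> v <= b ->
  abs_continuous a b f -> abs_continuous u v f.
Proof.
move=> au vb acf e e0; have [d d0 df] := acf e e0; exists d => // s suv.
apply: df => I /suv[uI [I12 Iv]].
by rewrite (le_trans au)// (le_trans Iv).
Qed.

(** Lipschitz images and coordinates of absolutely continuous maps are obtained by
this comparison of increments. *)
Lemma abs_continuous_dominated (E1 E2 : normedModType R) (K : R) u v
    (f : R -> E1) (g : R -> E2) : 0 < K ->
  (forall x y, u <= x -> x <= y -> y <= v ->
    `|g y - g x| <= K * `|f y - f x|) ->
  abs_continuous u v f -> abs_continuous u v g.
Proof.
move=> K0 gf acf e e0; have [|d d0 df] := acf (e / K); first by rewrite divr_gt0.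
exists d => // s suv ss sd.
have {}df := df s suv ss sd.
apply: (@le_lt_trans _ _ (K * \sum_(I <- s) `|f I.2 - f I.1|)).
  rewrite mulr_sumr big_seq [leRHS]big_seq; apply: ler_sum => I /suv[? [? ?]].
  exact: gf.
by rewrite mulrC -ltr_pdivlMr.
Qed.

Lemma abs_continuous_lipschitz (K : R) u v f : 0 < K ->
  (forall x y, u <= x -> x <= y -> y <= v -> `|f y - f x| <= K * (y - x)) ->
  abs_continuous u v f.
Proof.
move=> K0 lipf; apply: (@abs_continuous_dominated R E K u v idfun) => //.
  by move=> x y ux xy yv; rewrite ger0_norm ?subr_ge0// lipf.
move=> e e0; exists e => // s suv ss sd.
rewrite (le_lt_trans _ sd)// big_seq [leRHS]big_seq; apply: ler_sum.
by move=> I /suv[_ [? _]]; rewrite ger0_norm// subr_ge0.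
Qed.

Lemma abs_continuous_monotone_comp a b u v f (phi : R -> R) :
  {homo phi : x y / x <= y} ->
  (forall x y, x <= y -> phi y - phi x <= y - x) ->
  a <= phi u -> phi v <= b ->
  abs_continuous a b f -> abs_continuous u v (f \o phi).
Proof.
move=> phi_nd phi_lip aphi phib acf e e0; have [d d0 df] := acf e e0.
exists d => // s suv ss sd.
pose F (I : R * R) := (phi I.1, phi I.2).
have := df (map F s); rewrite !big_map; apply.
- move=> _ /mapP[I /suv[uI [I12 Iv]] ->] /=; split; last split.
  + by rewrite (le_trans aphi)// phi_nd.
  + exact: phi_nd.
  + by rewrite (le_trans _ phib)// phi_nd.
- rewrite pairwise_map; apply: sub_pairwise ss => I J /= /orP[/phi_nd->//|].
  by move=> /phi_nd->; rewrite orbT.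
- rewrite (le_lt_trans _ sd)// big_seq [leRHS]big_seq; apply: ler_sum.
  by move=> I /suv[_ [? _]]; exact: phi_lip.
Qed.

Lemma abs_continuous_reflect (c : R) u v f :
  abs_continuous (c - v) (c - u) f -> abs_continuous u v (fun x => f (c - x)).
Proof.
move=> acf e e0; have [d d0 df] := acf e e0.
exists d => // s suv ss sd.
pose F (I : R * R) := (c - I.2, c - I.1).
have := df (map F s); rewrite !big_map /=.
rewrite [X in _ -> X < _](eq_bigr (fun j => `|f (c - j.1) - f (c - j.2)|)).
  2: by move=> j _; rewrite distrC.
apply.
- move=> _ /mapP[I /suv[uI [I12 Iv]] ->] /=.
  by rewrite !lerD2l !lerN2.
- rewrite pairwise_map; apply: sub_pairwise ss => I J /=.
  by rewrite !lerD2l !lerN2 orbC.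
- rewrite (eq_bigr (fun j => j.2 - j.1))// => j _.
  by ring.
Qed.

(** Intervals that straddle b are cut there; the cut is made by the maps min(., b)
and max(., b), which shorten intervals and keep them nonoverlapping. *)
Lemma abs_continuous_cat a b c f : a <= b -> b <= c ->
  abs_continuous a b f -> abs_continuous b c f -> abs_continuous a c f.
Proof.
move=> ab bc acl acr e e0.
have e20 : 0 < e / 2 by rewrite divr_gt0.
have [d1 d10 df1] := acl _ e20; have [d2 d20 df2] := acr _ e20.
exists (Num.min d1 d2); first by rewrite lt_min d10.
move=> s sac ss; rewrite lt_min => /andP[sd1 sd2].
pose L (x : R) := Num.min x b; pose U (x : R) := Num.max x b.
have Lnd : {homo L : x y / x <= y} by move=> x y xy; exact: le_min2.
have Und : {homo U : x y / x <= y} by move=> x y xy; exact: le_max2.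
have LU x : L x + U x = x + b by exact: addr_min_max.
have lenL I : I \in s -> L I.2 - L I.1 <= I.2 - I.1.
  move=> /sac[_ [I12 _]]; have := LU I.1; have := LU I.2; have := Und _ _ I12.
  lra.
have lenU I : I \in s -> U I.2 - U I.1 <= I.2 - I.1.
  move=> /sac[_ [I12 _]]; have := LU I.1; have := LU I.2; have := Lnd _ _ I12.
  lra.
pose FL (I : R * R) := (L I.1, L I.2); pose FU (I : R * R) := (U I.1, U I.2).
have HL : \sum_(I <- s) `|f (L I.2) - f (L I.1)| < e / 2.
  have := df1 (map FL s); rewrite !big_map /=; apply.
  - move=> _ /mapP[I /sac[aI [I12 Ic]] ->] /=; rewrite /FL/=.
    split; first by rewrite /L le_min aI ab.
    by split; [exact: Lnd|rewrite /L ge_min lexx orbT].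
  - rewrite pairwise_map; apply: sub_pairwise ss => I J /= /orP[/Lnd->//|].
    by move=> /Lnd->; rewrite orbT.
  - rewrite (le_lt_trans _ sd1)// big_seq [leRHS]big_seq; exact: ler_sum.
have HU : \sum_(I <- s) `|f (U I.2) - f (U I.1)| < e / 2.
  have := df2 (map FU s); rewrite !big_map /=; apply.
  - move=> _ /mapP[I /sac[aI [I12 Ic]] ->] /=; rewrite /FU/=.
    split; first by rewrite /U le_max lexx orbT.
    by split; [exact: Und|rewrite /U ge_max Ic bc].
  - rewrite pairwise_map; apply: sub_pairwise ss => I J /= /orP[/Und->//|].
    by move=> /Und->; rewrite orbT.
  - rewrite (le_lt_trans _ sd2)// big_seq [leRHS]big_seq; exact: ler_sum.
rewrite [ltRHS]splitr; apply: le_lt_trans (ltrD HL HU).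
rewrite -big_split /= big_seq [leRHS]big_seq; apply: ler_sum => I /sac[_ [I12 _]].
have fLU x : f x = f (L x) + f (U x) - f b.
  by rewrite /L /U /=; case: (leP x b) => _; [rewrite addrK|rewrite addrAC subrr add0r].
rewrite (fLU I.2) (fLU I.1) opprB addrA subrK opprD addrACA.
exact: ler_normD.
Qed.
End absolute_continuity.

(** Real induction on a segment: every gauge has a fine partition.  It replaces
compactness arguments with subdivisions for properties that can be concatenated. *)
Lemma cousin {R : realType} (Q : R -> R -> Prop) (a b : R) : a <= b ->
  (forall x y z, a <= x -> x <= y -> y <= z -> z <= b ->
    Q x y -> Q y z -> Q x z) ->
  (forall x, a <= x -> x <= b -> exists2 r : R, 0 < r & forall u v,
    a <= u -> u <= x -> x <= v -> v <= b -> x - r < u -> v < x + r -> Q u v) ->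
  Q a b.
Proof.
move=> ab Qcat Qloc.
pose S := [set x | a <= x <= b /\ Q a x].
have Sa : S a.
  split; first by rewrite lexx.
  have [r r0] := Qloc a (lexx a) ab; apply => //; lra.
have Sb : ubound S b by move=> x [/andP[]].
have supS : has_sup S by split; [exists a|exists b].
set s := sup S.
have as_ : a <= s by apply: ub_le_sup => //; exists b.
have sb : s <= b by apply: ge_sup => //; exists a.
have [r r0 Qr] := Qloc s as_ sb.
have [x Sx sx] := sup_adherent r0 supS.
have xs : x <= s by apply: ub_le_sup => //; exists b.
case: Sx => /andP[ax xb] Qax.
have Qas : Q a s.
  by apply: (Qcat _ x) => //; apply: Qr => //; lra.
have [sb'|sb'] := eqVneq s b; first by rewrite -sb'.
have {}sb' : s < b by rewrite lt_neqAle sb'.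
pose v := Num.min b (s + r / 2).
have sv : s < v by rewrite /v lt_min sb'/= ltrDl divr_gt0.
have vb : v <= b by rewrite /v ge_min lexx.
have vr : v <= s + r / 2 by rewrite /v ge_min lexx orbT.
have Qsv : Q s v by apply: Qr => //; lra.
have : S v.
  split; first by rewrite vb andbT; lra.
  by apply: (Qcat _ s) => //; lra.
by move=> /(ub_le_sup (ex_intro _ b Sb)); rewrite -/s leNgt sv.
Qed.

(** * Variation of absolutely continuous functions *)

Section variation_of_absolutely_continuous.
Context {R : realType}.
Implicit Types (a b u v : R) (f : R -> R) (s : seq (R * R)).

Local Notation nonoverlapping :=
  (pairwise (fun I J : R * R => (I.2 <= J.1) || (J.2 <= I.1))).

Lemma itv_partition_family f u v l : itv_partition u v l ->
  exists s, [/\ forall I, I \in s -> u <= I.1 /\ I.1 <= I.2 /\ I.2 <= v,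
    nonoverlapping s, \sum_(I <- s) (I.2 - I.1) = v - u &
    \sum_(I <- s) `|f I.2 - f I.1| = variation u v f l].
Proof.
move=> uvl; rewrite variation_zip//; elim: l u uvl => [|x l IH] u uvl.
  have -> := itv_partition_nil uvl.
  by exists [::]; split => //=; rewrite !big_nil// subrr.
have xvl := itv_partition_cons uvl; have xv := itv_partition_le xvl.
have ux : u < x by case: uvl => /= /andP[].
have [s [sxv ss len_s var_s]] := IH _ xvl.
exists ((u, x) :: s); split.
- move=> I; rewrite inE => /predU1P[->/=|/sxv[? [? ?]]].
    by rewrite lexx (ltW ux).
  by split => //; rewrite (le_trans (ltW ux)).
- by rewrite /= ss andbT; apply/allP => I /sxv[-> _].
- by rewrite big_cons len_s/=; ring.
- by rewrite big_cons /= big_cons var_s.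
Qed.

(** Each interval of the family is refined into a partition that almost realizes its
total variation; the refined family has the same total length, so that the
modulus of absolute continuity of f applies to its variation as well. *)
Lemma total_variation_family f s : (forall I, I \in s -> I.1 <= I.2) ->
  nonoverlapping s ->
  (forall I, I \in s -> total_variation I.1 I.2 f \is a fin_num) ->
  forall eta : R, 0 < eta -> exists s', [/\
    forall J, J \in s' -> J.1 <= J.2 /\
      exists2 I, I \in s & I.1 <= J.1 /\ J.2 <= I.2,
    nonoverlapping s',
    \sum_(J <- s') (J.2 - J.1) = \sum_(I <- s) (I.2 - I.1) &
    \sum_(I <- s) fine (total_variation I.1 I.2 f) <=
      \sum_(J <- s') `|f J.2 - f J.1| + eta].
Proof.
elim: s => [_ _ _ eta eta0|I s IH sle ss sfin eta eta0].
  by exists [::]; rewrite !big_nil add0r (ltW eta0); split.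
have eta20 : 0 < eta / 2 by rewrite divr_gt0.
have I12 : I.1 <= I.2 by apply: sle; rewrite inE eqxx.
have Ifin := sfin I (mem_head _ _).
have /= /andP[Is {}ss] := ss.
have [||s' [s'in s's len_s' var_s']] := IH _ ss _ _ eta20.
- by move=> J Js; apply: sle; rewrite inE Js orbT.
- by move=> J Js; apply: sfin; rewrite inE Js orbT.
have [t [tI tt len_t var_t]] : exists t,
    [/\ forall J, J \in t -> I.1 <= J.1 /\ J.1 <= J.2 /\ J.2 <= I.2,
    nonoverlapping t, \sum_(J <- t) (J.2 - J.1) = I.2 - I.1 &
    fine (total_variation I.1 I.2 f) <= \sum_(J <- t) `|f J.2 - f J.1| + eta / 2].
  have [_ [_ [l Il <-] <-] h] := ub_ereal_sup_adherent eta20 Ifin.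
  have [t [tI tt len_t var_t]] := itv_partition_family f Il.
  exists t; split => //; rewrite var_t -lerBlDr -lee_fin EFinB fineK//.
  exact: ltW.
exists (t ++ s'); split.
- move=> J; rewrite mem_cat => /orP[/tI[? [? ?]]|/s'in[? [K Ks ?]]].
    by split => //; exists I => //; rewrite mem_head.
  by split => //; exists K => //; rewrite inE Ks orbT.
- rewrite pairwise_cat tt s's !andbT; apply/allrelP => J K.
  move=> /tI[IJ [J12 JI]] /s'in[K12 [L Ls [LK KL]]].
  move/allP : Is => /(_ _ Ls) /orP[h|h].
    by rewrite (le_trans JI)// (le_trans h).
  by rewrite (le_trans KL) ?orbT// (le_trans h).
- by rewrite big_cat/= len_t len_s' big_cons.
- by rewrite big_cat/= big_cons; move: var_t var_s'; lra.
Qed.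

(** On an interval shorter than the modulus of absolute continuity for 1 all the
partition sums are less than 1. *)
Lemma abs_continuous_total_variation_lty a b f : a <= b ->
  abs_continuous a b f -> (total_variation a b f < +oo)%E.
Proof.
move=> ab acf; apply: (cousin ab (Q := fun u v => (total_variation u v f < +oo)%E)).
  move=> x y z ax xy yz zb xyoo yzoo.
  by rewrite (total_variationD _ xy yz) lte_add_pinfty.
have [d d0 df] := acf 1 ltr01.
move=> x ax xb; exists (d / 2); first by rewrite divr_gt0.
move=> u v au ux xv vb xu vx.
apply: (@le_lt_trans _ _ 1%:E); last exact: ltry.
apply: ge_ereal_sup => _ [_ [l uvl <-] <-]; rewrite lee_fin.
have [t [tuv tt len_t var_t]] := itv_partition_family f uvl.
rewrite -var_t ltW//; apply: df => //.
  by move=> I /tuv[? [? ?]]; split; [lra|split => //; lra].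
by rewrite len_t; lra.
Qed.

(** The witness is the total variation of f from the point a, and the point is that
it inherits absolute continuity. *)
Lemma abs_continuous_variation a b f : a <= b -> abs_continuous a b f ->
  exists2 V : R -> R, abs_continuous a b V &
    forall x y, a <= x -> x <= y -> y <= b -> `|f y - f x| <= V y - V x.
Proof.
move=> ab acf; exists (fun x => fine (total_variation a x f)).
  have TVfin x y : a <= x -> x <= y -> y <= b ->
      total_variation x y f \is a fin_num.
    move=> ax xy yb; rewrite ge0_fin_numE ?total_variation_ge0//.
    exact/abs_continuous_total_variation_lty/(abs_continuousS ax yb).
  have VB x y : a <= x -> x <= y -> y <= b ->
     fine (total_variation a y f) - fine (total_variation a x f) =
     fine (total_variation x y f).
    move=> ax xy yb; rewrite (total_variationD _ ax xy) fineD ?TVfin//.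
      by rewrite addrAC subrr add0r.
    by rewrite (le_trans xy).
  move=> e e0; have e20 : 0 < e / 2 by rewrite divr_gt0.
  have [d d0 df] := acf _ e20; exists d => // s sab ss len_s.
  have [||s' [s'in s's len_s' var_s']] := @total_variation_family f s _ ss _ _ e20.
  - by move=> I /sab[_ []].
  - by move=> I /sab[? [? ?]]; exact: TVfin.
  rewrite big_seq (eq_bigr (fun I => fine (total_variation I.1 I.2 f))); last first.
    move=> I /sab[? [? ?]]; rewrite VB// ger0_norm//.
    by rewrite fine_ge0// total_variation_ge0.
  rewrite -big_seq (le_lt_trans var_s')// [ltRHS]splitr ltrD2r; apply: df => //.
    move=> J /s'in[J12 [I /sab[aI [_ Ib]] [IJ JI]]].
    by rewrite (le_trans aI)// (le_trans JI).
  by rewrite len_s'.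
move=> x y ax xy yb.
have axb : x <= b by rewrite (le_trans xy).
have ay : a <= y by rewrite (le_trans ax).
have TVfin u v : a <= u -> u <= v -> v <= b ->
    total_variation u v f \is a fin_num.
  move=> au uv vb; rewrite ge0_fin_numE ?total_variation_ge0//.
  exact/abs_continuous_total_variation_lty/(abs_continuousS au vb).
rewrite (total_variationD _ ax xy) fineD ?TVfin// addrAC subrr add0r.
by rewrite -lee_fin fineK ?TVfin// total_variation_ge.
Qed.

End variation_of_absolutely_continuous.

Section absolutely_continuous_clamp.
Context {R : realType}.
Implicit Types (a b x : R) (g : R -> R).

(** Retraction of the line onto [a, b], used to extend functions from [a, b]. *)
Definition clamp a b x := Num.max a (Num.min x b).

Lemma clamp_ge a b x : a <= clamp a b x.
Proof. by rewrite /clamp le_max lexx. Qed.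

Lemma clamp_le a b x : a <= b -> clamp a b x <= b.
Proof. by move=> ab; rewrite /clamp ge_max ab/= ge_min lexx orbT. Qed.

Lemma clamp_id a b x : a <= x -> x <= b -> clamp a b x = x.
Proof. by move=> ax xb; rewrite /clamp min_l// max_r. Qed.

Lemma clamp_nd a b : {homo clamp a b : x y / x <= y}.
Proof. by move=> x y xy; apply: le_max2 => //; exact: le_min2. Qed.

Lemma clamp_lip a b x y : x <= y -> clamp a b y - clamp a b x <= y - x.
Proof.
rewrite /clamp => xy.
case: (leP x b) => xb; case: (leP y b) => yb.
- by case: (leP a x) => ?; case: (leP a y) => ?; lra.
- by case: (leP a x) => ?; case: (leP a b) => ?; lra.
- by case: (leP a b) => ?; case: (leP a y) => ?; lra.
- by case: (leP a b) => ?; lra.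
Qed.

End absolutely_continuous_clamp.

(** * Slim triangles under a vertical contraction *)

Section real_lemmas.
Context {R : realType}.

(** The extreme value theorem, for a function known to be Lipschitz on [a, b] only. *)
Lemma lipschitz_max (C a b : R) (k : R -> R) : 0 < C -> a <= b ->
  (forall s t, a <= s -> s <= t -> t <= b -> `|k s - k t| <= C * (t - s)) ->
  exists s, [/\ a <= s, s <= b & forall t, a <= t -> t <= b -> k t <= k s].
Proof.
move=> C0 ab klip.
have [|s /andP[as_ sb] smax] := @EVT_max R (k \o clamp a b) a b ab.
  apply: continuous_subspaceT => x; apply/cvgrPdist_lt => e e0.
  have eC : 0 < e / C by rewrite divr_gt0.
  near=> y; have xy : `|x - y| < e / C by near: y; exact: cvgr_dist_lt.
  have [|/ltW] := leP x y => lexy.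
    rewrite /= (le_lt_trans (klip _ _ _ _ _)) ?clamp_ge ?clamp_le ?clamp_nd//.
    rewrite -ltr_pdivlMl// mulrC (le_lt_trans (clamp_lip _ _ lexy))//.
    by rewrite (le_lt_trans _ xy)// distrC ler_norm.
  rewrite /= distrC (le_lt_trans (klip _ _ _ _ _)) ?clamp_ge ?clamp_le ?clamp_nd//.
  rewrite -ltr_pdivlMl// mulrC (le_lt_trans (clamp_lip _ _ lexy))//.
  by rewrite (le_lt_trans _ xy)// ler_norm.
exists s; split => // t at_ tb; have := smax t.
by rewrite /= !clamp_id//; apply; rewrite in_itv/= at_ tb.
Unshelve. all: by end_near. Qed.

(** The time s is the infimum of the times at which k is at least l. *)
Lemma first_hitting (C a b l : R) (k : R -> R) : 0 < C -> a <= b ->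
  (forall s t, a <= s -> s <= t -> t <= b -> `|k s - k t| <= C * (t - s)) ->
  k a <= l -> l <= k b ->
  exists s, [/\ a <= s, s <= b, k s = l & forall t, a <= t -> t <= s -> k t <= l].
Proof.
move=> C0 ab klip kal lkb.
pose S := [set s | [/\ a <= s, s <= b & l <= k s]].
have Sb : S b by [].
have lbS : lbound S a by move=> s [].
have infS : has_inf S by split; [exists b|exists a].
set s := inf S.
have as_ : a <= s by apply: lb_le_inf; [exists b|].
have sb : s <= b by apply: ge_inf => //; exists a.
have lt_s t : a <= t -> t < s -> k t < l.
  move=> at_ ts; rewrite ltNge; apply/negP => lkt.
  have : S t by split => //; rewrite (le_trans (ltW ts)).
  by move/(ge_inf (ex_intro _ a lbS)); rewrite leNgt ts.
have lks : l <= k s.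
  rewrite leNgt; apply/negP => ksl.
  have e0 : 0 < (l - k s) / C by rewrite divr_gt0// subr_gt0.
  have [x Sx xs] := inf_adherent e0 infS.
  have sx : s <= x by apply: ge_inf => //; exists a.
  case: Sx => ax xb lkx.
  have := klip s x as_ sx xb.
  rewrite distrC => /(le_trans (ler_norm _)).
  have : C * (x - s) < l - k s.
    by rewrite -ltr_pdivlMl// mulrC ltrBlDl.
  lra.
have ksl : k s <= l.
  rewrite leNgt; apply/negP => lks'.
  have ltas : a < s.
    by rewrite lt_neqAle as_ andbT; apply/eqP => E; move: kal; rewrite E leNgt lks'.
  pose t := Num.max a (s - (k s - l) / C).
  have at_ : a <= t by rewrite le_max lexx.
  have e0 : 0 < (k s - l) / C by rewrite divr_gt0// subr_gt0.
  have ts : t < s by rewrite gt_max ltas/= ltrBlDr ltrDl.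
  have := lt_s _ at_ ts.
  have := klip t s at_ (ltW ts) sb.
  rewrite distrC => /(le_trans (ler_norm _)).
  have : C * (s - t) <= k s - l.
    rewrite -ler_pdivlMl// mulrC.
    have : s - (k s - l) / C <= t by rewrite le_max lexx orbT.
    lra.
  lra.
have kE : k s = l by apply/eqP; rewrite eq_le ksl lks.
exists s; split => // t at_; rewrite le_eqVlt => /predU1P[->//|ts].
exact/ltW/lt_s.
Qed.

End real_lemmas.

Section vertical_contraction.
Context {R : realType} {X : metricType R}.
Implicit Types (x y z : X) (f g : R -> X).

(** The model is the cylinder with the height hgt (p, t) = ln t and with P tau (p, t)
the point of the same vertical line at the height tau.  Only points at a distance
at most 1 are required to be brought closer, which is enough along a path. *)
Record vertical_contraction (hgt : X -> R) (P : R -> X -> X) (C lam : R) : Prop := {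
  vc_C_gt0 : 0 < C ;
  vc_lam_gt0 : 0 < lam ;
  vc_hgt_le0 : forall x, hgt x <= 0 ;
  vc_hgt_lip : forall x y, `|hgt x - hgt y| <= C * mdist x y ;
  vc_hgtP : forall x t, t <= 0 -> hgt (P t x) = t ;
  vc_PP : forall x s t, s <= 0 -> t <= 0 -> P t (P s x) = P t x ;
  vc_P_hgt : forall x, P (hgt x) x = x ;
  vc_P_lip : forall x s t, s <= t -> t <= 0 -> mdist (P s x) (P t x) <= C * (t - s) ;
  vc_contract : forall x y t, mdist x y <= 1 -> hgt x <= t -> t <= 0 ->
    mdist (P t x) (P t y) <= C * expR (- (lam * (t - hgt x))) ;
  vc_top : forall x y, mdist (P 0 x) (P 0 y) <= C }.

Definition unit_speed (L : R) g := forall s t, 0 <= s -> s <= t -> t <= L ->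
  mdist (g s) (g t) = t - s.

Lemma unit_speed_rev L g : unit_speed L g -> unit_speed L (fun s => g (L - s)).
Proof. by move=> ug s t s0 st tL; rewrite metric_sym ug; lra. Qed.

(** A path with step size 1 is followed; the + 1 accounts for the last, shorter step. *)
Lemma mdist_steps f s1 s2 (eps : R) : 0 <= eps -> s1 <= s2 ->
  (forall s s', s1 <= s -> s <= s' -> s' <= s2 -> s' - s <= 1 ->
    mdist (f s) (f s') <= eps) ->
  mdist (f s1) (f s2) <= eps * (s2 - s1 + 1).
Proof.
move=> eps0 s12 fs.
have [n] : exists n : nat, s2 - s1 <= n%:R.
  exists (Num.bound `|s2 - s1|); apply: (le_trans (ler_norm _)).
  exact/ltW/archi_boundP/normr_ge0.
elim: n s1 s12 fs => [|n IH] s1 s12 fs sn.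
  have -> : s1 = s2 by lra.
  by rewrite mdistxx subrr add0r mulr1.
have [le1|gt1] := leP (s2 - s1) 1.
  by rewrite (le_trans (fs _ _ _ _ _ _))//; nra.
have h1 : mdist (f s1) (f (s1 + 1)) <= eps by apply: fs; lra.
have h2 : mdist (f (s1 + 1)) (f s2) <= eps * (s2 - (s1 + 1) + 1).
  apply: IH; [lra| |by rewrite -natr1 in sn; lra].
  by move=> s s' ? ? ? ?; apply: fs => //; lra.
by rewrite (le_trans (metric_triangle _ (f (s1 + 1)) _))//; nra.
Qed.

(** The steps of length 1, counted back from s2, contribute the terms of a geometric
series of ratio exp (- c). *)
Lemma mdist_geometric_steps f s1 s2 (A c : R) : 0 <= A -> 0 < c -> s1 <= s2 ->
  (forall s s', s1 <= s -> s <= s' -> s' <= s2 -> s' - s <= 1 ->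
    mdist (f s) (f s') <= A * expR (- (c * (s2 - s)))) ->
  mdist (f s1) (f s2) <= A / (1 - expR (- c)).
Proof.
move=> A0 c0 s12 fs; set q := expR (- c).
have q1 : q < 1 by rewrite -expR0 ltr_expR oppr_lt0.
have q0 : 0 < q by rewrite expR_gt0.
have oq : 0 < 1 - q by rewrite subr_gt0.
suff : mdist (f s1) (f s2) <= A / (1 - q) * (1 - q * expR (- (c * (s2 - s1)))).
  move=> /le_trans; apply; rewrite -[leRHS]mulr1 ler_wpM2l//.
    by rewrite divr_ge0// ltW.
  by rewrite gerBl mulr_ge0// ?expR_ge0// ltW.
have [n] : exists n : nat, s2 - s1 <= n%:R.
  exists (Num.bound `|s2 - s1|); apply: (le_trans (ler_norm _)).
  exact/ltW/archi_boundP/normr_ge0.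
elim: n s1 s12 fs => [|n IH] s1 s12 fs sn.
  have -> : s1 = s2 by lra.
  rewrite mdistxx subrr mulr0 oppr0 expR0 mulr1 mulr_ge0//; last exact: ltW.
  by rewrite divr_ge0// ltW.
set e := expR (- (c * (s2 - s1))).
have e0 : 0 < e by rewrite expR_gt0.
have e1 : e <= 1 by rewrite -expR0 ler_expR oppr_le0 mulr_ge0 ?subr_ge0// ltW.
have [le1|gt1] := leP (s2 - s1) 1.
  apply: (le_trans (fs _ _ _ _ _ _)) => //; rewrite -/e mulrAC ler_pdivlMr//.
  by rewrite -!mulrA ler_wpM2l//; nra.
have h1 : mdist (f s1) (f (s1 + 1)) <= A * e by apply: fs; lra.
have h2 : mdist (f (s1 + 1)) (f s2) <=
    A / (1 - q) * (1 - q * expR (- (c * (s2 - (s1 + 1))))).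
  apply: IH; [lra| |by rewrite -natr1 in sn; lra].
  by move=> s s' ? ? ? ?; apply: fs => //; lra.
have eq_e : q * expR (- (c * (s2 - (s1 + 1)))) = e.
  by rewrite /q -expRD /e; congr expR; ring.
rewrite eq_e in h2.
apply: (le_trans (metric_triangle _ (f (s1 + 1)) _)).
apply: le_trans (lerD h1 h2) _.
rewrite (_ : A * e + _ = A / (1 - q) * (1 - q * e))//.
by field; rewrite gt_eqF.
Qed.

End vertical_contraction.

Section slim_triangles.
Context {R : realType} {X : metricType R}.
Context (hgt : X -> R) (P : R -> X -> X) (C lam : R).
Context (V : vertical_contraction hgt P C lam) (geoX : geodesic_space X).
Implicit Types (x y z : X) (g : R -> X).

Let C0 := vc_C_gt0 V.
Let lam0 := vc_lam_gt0 V.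

Let hgt_speed L g : unit_speed L g -> forall s t, 0 <= s -> s <= t -> t <= L ->
  `|hgt (g s) - hgt (g t)| <= C * (t - s).
Proof. by move=> ug s t s0 st tL; rewrite -ug//; exact: (vc_hgt_lip V). Qed.

(** A geodesic below the height h competes with the path that climbs to h + r0,
crosses there and comes down.  The crossing is at least twice as short, so the
length of the excursion is bounded by the cost of climbing and descending. *)
Lemma low_excursion : exists2 B : R, 0 <= B & forall L g s1 s2 (h : R),
  unit_speed L g -> 0 <= s1 -> s1 <= s2 -> s2 <= L -> h <= 0 ->
  (forall s, s1 <= s -> s <= s2 -> hgt (g s) <= h) ->
  s2 - s1 <= 2 * C * (2 * h - hgt (g s1) - hgt (g s2)) + B.
Proof.
(* after a climb of r0 the contraction factor C * exp (- lam * r0) is at most 1/2,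
   because C * exp (- 2 C) <= C / (1 + 2 C) *)
pose r0 := 2 * C / lam.
have r00 : 0 <= r0 by rewrite divr_ge0 ?mulr_ge0// ltW.
have Cr0 : C * expR (- (lam * r0)) <= 1 / 2.
  rewrite expRN ler_pdivrMr ?expR_gt0//.
  have -> : lam * r0 = 2 * C by rewrite /r0; field; rewrite gt_eqF.
  by have := expR_ge1Dx (2 * C); lra.
exists (4 * C * r0 + 1 + C); first by have := C0; nra.
move=> L g s1 s2 h ug s10 s12 s2L h0 gh.
have k1 := gh _ (lexx _) s12; have k2 := gh _ s12 (lexx _).
have up s t : s1 <= s -> s <= s2 -> hgt (g s) <= t -> t <= 0 ->
    mdist (g s) (P t (g s)) <= C * (t - hgt (g s)).
  by move=> ? ? ? ?; rewrite -{1}(vc_P_hgt V (g s)); exact: vc_P_lip V _ _ _ _ _.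
have cross t : mdist (g s1) (g s2) <= mdist (g s1) (P t (g s1)) +
    mdist (P t (g s1)) (P t (g s2)) + mdist (g s2) (P t (g s2)).
  rewrite (metric_sym (g s2)) (le_trans (metric_triangle _ (P t (g s2)) _))// lerD2r.
  exact: metric_triangle.
rewrite -(ug s1 s2)//.
have [hr|hr] := leP (h + r0) 0.
  have : mdist (P (h + r0) (g s1)) (P (h + r0) (g s2)) <= 1 / 2 * (s2 - s1 + 1).
    apply: (@mdist_steps _ _ (fun s => P (h + r0) (g s))) => //.
    move=> s s' s1s ss' s's2 s's.
    have ks := gh s s1s (le_trans ss' s's2).
    have hs : hgt (g s) <= h + r0 by lra.
    apply: (le_trans (vc_contract V _ hs hr)).
      by rewrite ug//; lra.
    apply: le_trans Cr0; rewrite ler_wpM2l//; first exact: ltW.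
    by rewrite ler_expR lerN2 ler_wpM2l//; [exact: ltW|lra].
  have := cross (h + r0).
  have := up s1 (h + r0) (lexx _) s12 (ler_wpDr r00 k1) hr.
  have := up s2 (h + r0) s12 (lexx _) (ler_wpDr r00 k2) hr.
  have := ug s1 s2 s10 s12 s2L; have := C0; lra.
(* the height h + r0 is above the top: cross at the height 0 instead *)
have Chr : 0 < C * (h + r0) by rewrite mulr_gt0.
have Ck1 : C * hgt (g s1) <= 0 by apply: mulr_ge0_le0; [exact: ltW|exact: (vc_hgt_le0 V)].
have Ck2 : C * hgt (g s2) <= 0 by apply: mulr_ge0_le0; [exact: ltW|exact: (vc_hgt_le0 V)].
have := cross 0; have := vc_top V (g s1) (g s2).
have := up s1 0 (lexx _) s12 (vc_hgt_le0 V _) (lexx _).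
have := up s2 0 s12 (lexx _) (vc_hgt_le0 V _) (lexx _).
lra.
Qed.

(** By [low_excursion] the height of the geodesic at the time s is below the record by
at least a multiple of s2 - s, so that projecting to the record height contracts
the step at the time s by an exponential in s2 - s. *)
Lemma record_contraction : exists2 B : R, 0 <= B & forall L g s1 s2,
  unit_speed L g -> 0 <= s1 -> s1 <= s2 -> s2 <= L ->
  (forall s, s1 <= s -> s <= s2 -> hgt (g s) <= hgt (g s2)) ->
  mdist (P (hgt (g s2)) (g s1)) (g s2) <= B.
Proof.
have [B B0 exB] := low_excursion.
pose c := lam / (2 * C); pose A := C * expR (c * B).
have c0 : 0 < c by rewrite divr_gt0// mulr_gt0.
have A0 : 0 <= A by rewrite mulr_ge0 ?expR_ge0// ltW.
exists (A / (1 - expR (- c))).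
  by rewrite divr_ge0// subr_ge0 -expR0 ler_expR oppr_le0 ltW.
move=> L g s1 s2 ug s10 s12 s2L rec.
rewrite -{2}(vc_P_hgt V (g s2)).
apply: (@mdist_geometric_steps _ _ (fun s => P (hgt (g s2)) (g s))) => //.
move=> s s' s1s ss' s's2 s's.
have ss2 : s <= s2 by rewrite (le_trans ss').
have s0 : 0 <= s by rewrite (le_trans s10).
apply: (le_trans (vc_contract V _ (rec s s1s ss2) (vc_hgt_le0 V _))).
  by rewrite ug//; lra.
rewrite /A -mulrA ler_wpM2l//; first exact: ltW.
rewrite -expRD ler_expR.
have := exB L g s s2 (hgt (g s2)) ug s0 ss2 s2L (vc_hgt_le0 V _).
move=> /(_ (fun t st ts2 => rec t (le_trans s1s st) ts2)) H.
have {}H : s2 - s <= 2 * C * (hgt (g s2) - hgt (g s)) + B by lra.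
have : c * (s2 - s) <= c * (2 * C * (hgt (g s2) - hgt (g s)) + B).
  by rewrite ler_pM2l.
have -> : c * (2 * C * (hgt (g s2) - hgt (g s)) + B) =
    lam * (hgt (g s2) - hgt (g s)) + c * B.
  by rewrite /c; field; rewrite gt_eqF.
lra.
Qed.

(** A geodesic between x and y is projected, or, when t is close to the heights of x
and y, these points are moved vertically. *)
Lemma upward_close K : 0 <= K -> exists2 B : R, 0 <= B & forall x y t,
  mdist x y <= K -> hgt x <= t -> hgt y <= t -> t <= 0 ->
  mdist (P t x) (P t y) <= B.
Proof.
move=> K0; exists (C * (K + 1) + 3 * C * C * K + K).
  by rewrite !addr_ge0 ?mulr_ge0 ?addr_ge0// ltW.
move=> x y t xyK xt yt t0.
have CK0 : 0 <= C * C * K by rewrite !mulr_ge0// ltW.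
have yx : hgt y <= hgt x + C * K.
  have := vc_hgt_lip V y x; rewrite metric_sym => /(le_trans (ler_norm _)).
  have : C * mdist x y <= C * K by rewrite ler_pM2l.
  lra.
have [le_t|lt_t] := leP (hgt x + C * K) t; last first.
  have up z : hgt z <= t -> mdist (P t z) z <= C * (t - hgt z).
    by move=> zt; rewrite metric_sym -{1}(vc_P_hgt V z); exact: vc_P_lip V _ _ _ _ _.
  have h1 := up x xt; have h2 := up y yt.
  have h2' : mdist y (P t y) <= C * (t - hgt y) by rewrite metric_sym.
  have h3 : C * (t - hgt x) <= C * (C * K) by rewrite ler_pM2l//; lra.
  have xy' : hgt x <= hgt y + C * K.
    have := vc_hgt_lip V x y => /(le_trans (ler_norm _)).
    have : C * mdist x y <= C * K by rewrite ler_pM2l.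
    lra.
  have h4 : C * (t - hgt y) <= C * (2 * (C * K)) by rewrite ler_pM2l//; lra.
  have := metric_triangle (P t x) x (P t y).
  have := metric_triangle x y (P t y).
  have : 0 <= C * (K + 1) by rewrite mulr_ge0 ?addr_ge0// ltW.
  lra.
have [_ [L [g [L0 g0 gL iso _]]]] := geoX x y.
have ug : unit_speed L g.
  move=> s u s0 su uL; rewrite iso ?in_itv/= ?s0 ?uL ?andbT//; last 2 first.
  - by rewrite (le_trans su).
  - by rewrite (le_trans s0).
  by rewrite distrC ger0_norm// subr_ge0.
have LK : L <= K by rewrite -[L]subr0 -(ug 0 L)// g0 gL.
have : mdist (P t (g 0)) (P t (g L)) <= C * (L - 0 + 1).
  apply: (@mdist_steps _ _ (fun s => P t (g s))) => //; first exact: ltW.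
  move=> s s' s0 ss' s'L s's.
  have ks : hgt (g s) <= t.
    have sL := le_trans ss' s'L.
    have := hgt_speed ug (lexx 0) s0 sL; rewrite distrC => /(le_trans (ler_norm _)).
    have : C * (s - 0) <= C * K by rewrite ler_pM2l//; lra.
    rewrite g0; lra.
  apply: (le_trans (vc_contract V _ ks t0)); first by rewrite ug//; lra.
  rewrite -[leRHS]mulr1 ler_wpM2l//; first exact: ltW.
  by rewrite -expR0 ler_expR oppr_le0 mulr_ge0 ?subr_ge0// ltW.
have : C * (L - 0 + 1) <= C * (K + 1) by rewrite ler_pM2l//; lra.
rewrite g0 gL; lra.
Qed.

(** The arch of a geodesic S from x to y: T is its maximal height. *)
Record profile (x y : X) (S : set X) (T B : R) : Prop := {
  profile_le0 : T <= 0 ;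
  profile_l : hgt x <= T ;
  profile_r : hgt y <= T ;
  profile_up_l : forall h, hgt x <= h -> h <= T -> exists2 w, S w & mdist w (P h x) <= B ;
  profile_up_r : forall h, hgt y <= h -> h <= T -> exists2 w, S w & mdist w (P h y) <= B ;
  profile_near : forall w, S w -> exists2 h, h <= T &
    hgt x <= h /\ mdist w (P h x) <= B \/ hgt y <= h /\ mdist w (P h y) <= B ;
  profile_top : forall h, T <= h -> h <= 0 -> mdist (P h x) (P h y) <= B ;
  profile_below : forall h, hgt x <= h -> hgt y <= h -> h <= T ->
    T - h <= C * (2 * B + mdist (P h x) (P h y)) }.

Lemma profile_sym x y S T B : profile x y S T B -> profile y x S T B.
Proof.
case=> T0 xT yT upx upy nr top below; split => //.
- by move=> w /nr[h hT [?|?]]; exists h => //; [right|left].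
- by move=> h ? ?; rewrite metric_sym; exact: top.
- by move=> h ? ? ?; rewrite metric_sym; exact: below.
Qed.

(** Each point of the geodesic is compared with the points where the running maximum
of the height is attained; [low_excursion] bounds the time spent away from the
running maximum, and [record_contraction] applies at its times of increase. *)
Lemma geodesic_profile : exists2 B : R, 0 <= B & forall x y S,
  geodesic_segment x y S -> exists T, profile x y S T B.
Proof.
have [B1 B10 exB1] := low_excursion.
have [B2 B20 exB2] := record_contraction.
have [|B3 B30 exB3] := @upward_close (2 * B2); first by rewrite mulr_ge0.
(* half of the profile; the other half follows by reversing the geodesic *)
have half L g m : unit_speed L g -> 0 <= m -> m <= L ->
    (forall s, 0 <= s -> s <= L -> hgt (g s) <= hgt (g m)) ->
    (forall h, hgt (g 0) <= h -> h <= hgt (g m) -> exists s, [/\ 0 <= s, s <= m,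
       hgt (g s) = h & mdist (g s) (P h (g 0)) <= B2]) /\
    (forall s, 0 <= s -> s <= m -> exists h, [/\ hgt (g 0) <= h, h <= hgt (g m) &
       mdist (g s) (P h (g 0)) <= B1 + B2]).
  move=> ug m0 mL gm.
  have klip a b : 0 <= a -> b <= L -> forall s t, a <= s -> s <= t -> t <= b ->
      `|hgt (g s) - hgt (g t)| <= C * (t - s).
    by move=> ? ? s t ? ? ?; apply: (hgt_speed ug) => //; lra.
  have hit a b h : 0 <= a -> a <= b -> b <= L -> hgt (g a) <= h -> h <= hgt (g b) ->
      exists s, [/\ a <= s, s <= b, hgt (g s) = h &
        forall t, a <= t -> t <= s -> hgt (g t) <= h].
    by move=> a0 ab bL; exact: (first_hitting C0 ab (klip _ _ a0 bL)).
  split=> [h gh hm|s s0 sm].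
    have [s [s0 sm gs rec]] := hit 0 m h (lexx _) m0 mL gh hm.
    exists s; split => //; rewrite metric_sym -gs; apply: exB2 ug _ _ _ _ => //; first lra.
    by rewrite gs.
  have sL : s <= L by lra.
  (* r is where the running maximum at the time s is attained, s1 and s2 are the
     first times at which this height is reached from 0 and from s *)
  have [r [r0 rs rmax]] := lipschitz_max C0 s0 (klip _ _ (lexx 0) sL).
  have g0r := rmax 0 (lexx _) s0.
  have rL : r <= L by lra.
  have [s1 [s10 s1r gs1 rec1]] := hit 0 r _ (lexx 0) r0 rL g0r (lexx _).
  have [s2 [ss2 s2m gs2 rec2]] := hit s m _ s0 sm mL (rmax s s0 (lexx _)) (gm r r0 rL).
  exists (hgt (g r)); split; [exact: g0r|exact: gm|].
  have s1s : s1 <= s := le_trans s1r rs.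
  have E : s2 - s1 <= B1.
    have := exB1 L g s1 s2 (hgt (g r)) ug s10 (le_trans s1s ss2) (le_trans s2m mL)
      (vc_hgt_le0 V _).
    have low t : s1 <= t -> t <= s2 -> hgt (g t) <= hgt (g r).
      move=> s1t ts2; have [ts|st] := leP t s; first by apply: rmax; lra.
      by apply: rec2 => //; exact: ltW.
    by move=> /(_ low); rewrite gs1 gs2; lra.
  have D1 : mdist (P (hgt (g r)) (g 0)) (g s1) <= B2.
    by rewrite -gs1; apply: exB2 ug _ _ _ _ => //; [lra|rewrite gs1].
  have D2 : mdist (g s) (g s1) <= B1 by rewrite metric_sym ug//; lra.
  apply: (le_trans (metric_triangle _ (g s1) _)); apply: lerD => //.
  by rewrite metric_sym.
exists (B1 + B2 + B3); first by rewrite !addr_ge0.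
move=> x y S [L [g [L0 g0 gL iso SE]]].
have ug : unit_speed L g.
  move=> s u s0 su uL; rewrite iso ?in_itv/= ?s0 ?uL ?andbT//; last 2 first.
  - by rewrite (le_trans su).
  - by rewrite (le_trans s0).
  by rewrite distrC ger0_norm// subr_ge0.
have [m [m0 mL gm]] := lipschitz_max C0 L0 (hgt_speed ug).
have [up_l near_l] := half L g m ug m0 mL gm.
have m'0 : 0 <= L - m by lra.
have m'L : L - m <= L by lra.
have [|up_r near_r] := half L _ (L - m) (unit_speed_rev ug) m'0 m'L.
  by move=> s s0 sL /=; rewrite subKr; apply: gm; lra.
rewrite subr0 gL subKr in up_r near_r; rewrite g0 in up_l near_l.
have inS s : 0 <= s -> s <= L -> S (g s).
  by move=> s0 sL; rewrite SE; exists s => //; rewrite /= in_itv/= s0.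
exists (hgt (g m)); split.
- exact: vc_hgt_le0 V _.
- by rewrite -g0; apply: gm.
- by rewrite -gL; apply: gm.
- move=> h xh hm; have [s [s0 sm _ sh]] := up_l h xh hm.
  by exists (g s); [apply: inS; lra|lra].
- move=> h yh hm; have [s [s0 sm _ sh]] := up_r h yh hm.
  by exists (g (L - s)); [apply: inS; lra|lra].
- move=> w; rewrite SE => -[s]; rewrite /= in_itv/= => /andP[s0 sL] <-{w}.
  have [sm|ms] := leP s m.
    by have [h [xh hm sh]] := near_l s s0 sm; exists h => //; left; split => //; lra.
  have [||h [yh hm sh]] := near_r (L - s); [lra|lra|].
  by rewrite subKr in sh; exists h => //; right; split => //; lra.
- move=> h mh h0.
  have Dl : mdist (P (hgt (g m)) x) (g m) <= B2.
    by rewrite -g0; apply: exB2 ug _ _ _ _ => // s s0 sm; apply: gm; lra.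
  have Dr : mdist (P (hgt (g m)) y) (g m) <= B2.
    have := exB2 L _ 0 (L - m) (unit_speed_rev ug) (lexx _) m'0 m'L.
    by rewrite subKr subr0 gL; apply => s s0 sm; apply: gm; lra.
  have D : mdist (P (hgt (g m)) x) (P (hgt (g m)) y) <= 2 * B2.
    have := metric_triangle (P (hgt (g m)) x) (g m) (P (hgt (g m)) y).
    by rewrite (metric_sym (g m)); lra.
  have m0' := vc_hgt_le0 V (g m).
  have := exB3 _ _ h D; rewrite !(vc_hgtP V)// !(vc_PP V)//.
  by move=> /(_ mh mh h0); lra.
- move=> h xh yh hm.
  have [s [s0 sm gs sh]] := up_l h xh hm.
  have [t [t0 tm _ th]] := up_r h yh hm.
  have st : s <= L - t by lra.
  have tL : L - t <= L by lra.
  have D : (L - t) - s <= 2 * B2 + mdist (P h x) (P h y).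
    rewrite -(ug s (L - t))//.
    have := metric_triangle (g s) (P h x) (g (L - t)).
    have := metric_triangle (P h x) (P h y) (g (L - t)).
    by rewrite (metric_sym (P h y)); lra.
  have := hgt_speed ug s0 sm mL; rewrite gs distrC => /(le_trans (ler_norm _)) D'.
  apply: (le_trans D'); rewrite ler_wpM2l//; [exact: ltW|lra].
Qed.

(** A point of the first arch lies near the vertical line of x or of y, say x, at some
height h.  It is near the third arch if h is below the top of it.  Otherwise the
vertical lines of x and z have merged at h, so the point is near the second arch
if h is below the top of that one.  If h is above both tops, then the lines of
x and y have already merged at T' < h through that of z, which by
[profile_below] forces h to be close to T'. *)
Lemma profile_slim_side B x y z S1 S2 S3 T1 T2 T3 : 0 <= B ->
  profile x y S1 T1 B -> profile y z S2 T2 B -> profile z x S3 T3 B ->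
  near_set (3 * B + 4 * C * B * C) S1 (S2 `|` S3).
Proof.
move=> B0.
have CB0 : 0 <= 4 * C * B * C by rewrite !mulr_ge0// ltW.
(* points of S1 that lie on the side of x *)
have half x' y' S1' S2' S3' T1' T2' T3' w h :
    profile x' y' S1' T1' B -> profile y' z S2' T2' B -> profile z x' S3' T3' B ->
    h <= T1' -> hgt x' <= h -> mdist w (P h x') <= B ->
    exists2 w', (S2' `|` S3') w' & mdist w w' <= 3 * B + 4 * C * B * C.
  move=> p1 p2 p3 hT1 xh wh.
  have h0 : h <= 0 := le_trans hT1 (profile_le0 p1).
  have tri u v : mdist w v <= mdist w u + mdist v u.
    by rewrite (metric_sym v); exact: metric_triangle.
  have [hT3|T3h] := leP h T3'.
    have [w' S3w' w'h] := profile_up_r p3 xh hT3; exists w'; first by right.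
    by have := tri (P h x') w'; lra.
  have top3 := profile_top p3.
  have [hT2|T2h] := leP h T2'.
    have zh : hgt z <= h by rewrite (le_trans (profile_l p3))// ltW.
    have [w' S2w' w'h] := profile_up_r p2 zh hT2; exists w'; first by left.
    have := tri (P h x') w'; have := metric_triangle w' (P h z) (P h x').
    have := top3 h (ltW T3h) h0; lra.
  (* h is above both tops *)
  pose T' := Num.max T2' T3'.
  have T2T' : T2' <= T' by rewrite le_max lexx.
  have T3T' : T3' <= T' by rewrite le_max lexx orbT.
  have T'h : T' < h by rewrite gt_max T2h.
  have T'0 : T' <= 0 by rewrite (le_trans (ltW T'h)).
  have t3 := top3 T' T3T' T'0; have t2 := profile_top p2 T2T' T'0.
  have xT' : hgt x' <= T' by rewrite (le_trans (profile_r p3)).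
  have yT' : hgt y' <= T' by rewrite (le_trans (profile_l p2)).
  have T1T' : T1' - T' <= C * (2 * B + 2 * B).
    apply: (le_trans (profile_below p1 xT' yT' _)); first by rewrite (le_trans (ltW T'h)).
    rewrite ler_wpM2l//; first exact: ltW.
    rewrite lerD2l (le_trans (metric_triangle _ (P T' z) _))//.
    by rewrite (metric_sym (P T' x')) (metric_sym (P T' z) (P T' y')); lra.
  have hT' : mdist w (P T' x') <= B + 4 * C * B * C.
    rewrite (le_trans (metric_triangle _ (P h x') _))// lerD// metric_sym.
    apply: (le_trans (vc_P_lip V _ (ltW T'h) h0)).
    by rewrite mulrC; apply: ler_wpM2r; [exact: ltW|lra].
  have [T23|T32] := leP T2' T3'.
    have T'E : T' = T3' by rewrite /T' max_r.
    have [w' S3w' w'h] := profile_up_r p3 xT' (eq_ind_r (fun t => t <= T3') (lexx _) T'E).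
    by exists w'; [right|have := tri (P T' x') w'; lra].
  have T'E : T' = T2' by rewrite /T' max_l// ltW.
  have zT' : hgt z <= T' by rewrite (le_trans (profile_l p3)).
  have [w' S2w' w'h] := profile_up_r p2 zT' (eq_ind_r (fun t => t <= T2') (lexx _) T'E).
  exists w'; first by left.
  by have := tri (P T' x') w'; have := metric_triangle w' (P T' z) (P T' x'); lra.
move=> p1 p2 p3 w S1w; have [h hT [[xh wh]|[yh wh]]] := profile_near p1 S1w.
  exact: (half x y S1 S2 S3 T1 T2 T3 w h).
have [w' Sw' ww'] := half y x S1 S3 S2 T1 T3 T2 w h (profile_sym p1) (profile_sym p3)
  (profile_sym p2) hT yh wh.
by exists w' => //; case: Sw'; [right|left].
Qed.

Lemma vertical_contraction_slim : exists2 delta : R, 0 <= delta &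
  forall x y z S1 S2 S3, geodesic_segment x y S1 -> geodesic_segment y z S2 ->
    geodesic_segment z x S3 -> slim delta S1 S2 S3.
Proof.
have [B B0 exB] := geodesic_profile.
exists (3 * B + 4 * C * B * C).
  by rewrite addr_ge0 ?mulr_ge0// ltW.
move=> x y z S1 S2 S3 /exB[T1 p1] /exB[T2 p2] /exB[T3 p3].
split.
- exact: profile_slim_side p1 p2 p3.
- exact: profile_slim_side p2 p3 p1.
- exact: profile_slim_side p3 p1 p2.
Qed.

End slim_triangles.

(** * Geodesics in proper length spaces *)

Section proper_length_space.
Context {R : realType} {X : metricType R}.
Implicit Types (x y z : X).

(** Cluster points of a directed family of nonempty subsets of a compact set. *)
Lemma compact_limit (I : Type) (D : set I) (A : I -> set X) (K : set X) :
  compact K -> D !=set0 ->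
  (forall i j, D i -> D j -> exists2 k, D k & A k `<=` A i `&` A j) ->
  (forall i, D i -> A i !=set0) -> (forall i, D i -> A i `<=` K) ->
  exists z, forall i, D i -> forall e : R, 0 < e -> exists2 w, A i w & mdist z w < e.
Proof.
move=> cK D0 dirA A0 AK.
have FF : Filter (filter_from D A) by exact: filter_from_filter.
have PF : ProperFilter (filter_from D A) by exact: filter_from_proper.
have FK : filter_from D A K by have [i Di] := D0; exists i => //; exact: AK.
have [z [_ cz]] := cK _ PF FK.
exists z => i Di e e0.
have [|w [Aw zw]] := cz (A i) (ball z e) _ (nbhsx_ballx z e e0); first by exists i.
by exists w => //; rewrite ballEmdist in zw.
Qed.

Context (properX : proper_space X)
  (lengthX : forall x y (r e : R), 0 <= r -> r <= mdist x y -> 0 < e ->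
    exists z, mdist x z = r /\ mdist z y <= mdist x y - r + e).

(** The approximate intermediate points lie in a closed ball, which is compact. *)
Lemma proper_length_between x y r : 0 <= r -> r <= mdist x y ->
  exists z, mdist x z = r /\ mdist z y = mdist x y - r.
Proof.
move=> r0 rd.
pose A (e : R) := [set z | mdist x z = r /\ mdist z y <= mdist x y - r + e].
have [||||z zA] := @compact_limit R [set e | 0 < e] A [set z | mdist x z <= r]
  (@properX x r).
- by exists 1 => /=.
- move=> e e' /= e0 e'0; exists (Num.min e e'); first by rewrite /= lt_min e0.
  move=> z [xz zy]; split; split => //; apply: (le_trans zy); rewrite lerD2l.
    by rewrite ge_min lexx.
  by rewrite ge_min lexx orbT.
- by move=> e /= e0; exact: lengthX.
- by move=> e /= e0 z [xz _] /=; rewrite xz.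
have xz : mdist x z = r.
  apply/eqP; rewrite -subr_eq0 -normr_le0; apply/ler_addgt0Pr => e e0.
  have [w [xw _] zw] := zA 1 ltr01 e e0.
  have := metric_triangle x z w; have := metric_triangle x w z.
  by rewrite (metric_sym w z) add0r ler_norml => ? ?; apply/andP; split; lra.
have zy : mdist z y <= mdist x y - r.
  apply/ler_addgt0Pr => e e0.
  have e20 : 0 < e / 2 by rewrite divr_gt0.
  have [w [_ wy] zw] := zA _ e20 _ e20.
  by have := metric_triangle z w y; lra.
by exists z; split => //; have := metric_triangle x z y; lra.
Qed.

(** Hopf-Rinow without midpoints: by Zorn's lemma there is a maximal set of pairs
(time, point) containing the end points on which the distance of the points is
that of the times.  Compactness adds a point at any missing time. *)
Lemma proper_length_geodesic : geodesic_space X.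
Proof.
move=> x y; set L := mdist x y.
have L0 : 0 <= L by exact: mdist_ge0.
pose base : set (R * X) := [set (0, x); (L, y)].
pose adm (G : set (R * X)) := forall p q, (G `|` base) p -> (G `|` base) q ->
  0 <= p.1 <= L /\ mdist p.2 q.2 = `|p.1 - q.1|.
have adm_base p q : base p -> base q -> 0 <= p.1 <= L /\ mdist p.2 q.2 = `|p.1 - q.1|.
  move=> [->|->] [->|->] /=; rewrite ?lexx ?L0 ?subrr ?mdistxx ?normr0//.
  - by rewrite sub0r normrN ger0_norm.
  - by rewrite metric_sym subr0 ger0_norm.
have [F Fadm Ftot|G [Gadm Gmax]] := @Zorn_bigcup _ adm.
  move=> p q [[G1 FG1 G1p]|bp] [[G2 FG2 G2q]|bq].
  - have [G12|G21] := Ftot _ _ FG1 FG2.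
      by apply: (Fadm G2 FG2); left => //; exact: G12.
    by apply: (Fadm G1 FG1); left => //; exact: G21.
  - by apply: (Fadm G1 FG1); [left|right].
  - by apply: (Fadm G2 FG2); [right|left].
  - exact: adm_base.
pose H := G `|` base.
have H0 : H (0, x) by right; left.
have HL : H (L, y) by right; right.
have Hle p : H p -> 0 <= p.1 <= L by move=> Hp; exact: (Gadm p p Hp Hp).1.
have Hd p q : H p -> H q -> mdist p.2 q.2 = `|p.1 - q.1|.
  by move=> Hp Hq; exact: (Gadm p q Hp Hq).2.
(* a time s that is missing splits H into earlier pairs p and later pairs q; the
   sets A (p, q) of candidates decrease as p and q get closer to s *)
have total s : 0 <= s -> s <= L -> exists z, H (s, z).
  move=> s0 sL; apply: contrapT => /forallNP nH.
  have neq p : H p -> p.1 != s.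
    by move=> Hp; apply/eqP => ps; apply: (nH p.2); rewrite -ps -surjective_pairing.
  have lt0s : 0 < s by rewrite lt_neqAle s0 andbT; exact: (neq _ H0).
  have ltsL : s < L by rewrite lt_neqAle sL andbT eq_sym; exact: (neq _ HL).
  pose D : set ((R * X) * (R * X)) :=
    [set pq | [/\ H pq.1, H pq.2, pq.1.1 < s & s < pq.2.1]].
  pose A (pq : (R * X) * (R * X)) : set X :=
    [set z | mdist pq.1.2 z = s - pq.1.1 /\ mdist z pq.2.2 = pq.2.1 - s].
  have D0L : D ((0, x), (L, y)) by [].
  have Amon p q p' q' : D (p, q) -> H p' -> H q' -> p'.1 <= p.1 -> q.1 <= q'.1 ->
      A (p, q) `<=` A (p', q').
    move=> [/= Hp Hq ps sq] Hp' Hq' pp' qq' z [/= pz zq].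
    have := Hd _ _ Hp' Hp; rewrite distrC ger0_norm ?subr_ge0// => d1.
    have := Hd _ _ Hq Hq'; rewrite distrC ger0_norm ?subr_ge0// => d2.
    have := Hd _ _ Hp' Hq.
    rewrite distrC ger0_norm ?subr_ge0; last by apply/ltW/(le_lt_trans pp')/(lt_trans ps).
    have := Hd _ _ Hp Hq'.
    rewrite distrC ger0_norm ?subr_ge0; last by apply/ltW/(lt_le_trans _ qq')/(lt_trans ps).
    move=> d3 d4.
    have := metric_triangle p'.2 p.2 z; have := metric_triangle p'.2 z q.2.
    have := metric_triangle z q.2 q'.2; have := metric_triangle p.2 z q'.2.
    by move=> *; split => /=; lra.
  have [||||z zA] := @compact_limit _ D A [set z | mdist x z <= L] (@properX x L).
  - by exists ((0, x), (L, y)).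
  - move=> [p q] [p' q'] Dpq Dpq'.
    case: (Dpq) => /= Hp Hq ps sq; case: (Dpq') => /= Hp' Hq' ps' sq'.
    pose p2 := if p.1 <= p'.1 then p' else p.
    pose q2 := if q.1 <= q'.1 then q else q'.
    have D2 : D (p2, q2).
      by split => /=; rewrite /p2 /q2; case: ifP.
    exists (p2, q2) => //; rewrite subsetI; split.
      apply: Amon => //.
        by rewrite /p2; case: ifP.
      by rewrite /q2; case: (leP q.1 q'.1) => // /ltW.
    apply: Amon => //.
      by rewrite /p2; case: (leP p.1 p'.1) => // /ltW.
    by rewrite /q2; case: ifP.
  - move=> [p q] [/= Hp Hq ps sq].
    have dpq := Hd _ _ Hp Hq.
    rewrite distrC ger0_norm ?subr_ge0 in dpq; last exact/ltW/(lt_trans ps).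
    have [||z [pz zq]] := @proper_length_between p.2 q.2 (s - p.1).
    + by rewrite subr_ge0 ltW.
    + by rewrite dpq lerD2r ltW.
    by exists z; split => //=; rewrite zq dpq; ring.
  - move=> [p q] [/= Hp Hq ps sq] z [/= pz zq].
    have := Hd _ _ H0 Hp; have /andP[p0 _] := Hle _ Hp.
    rewrite /= sub0r normrN ger0_norm// => xp.
    by have := metric_triangle x p.2 z; lra.
  have {}zA pq : D pq -> A pq z.
    move=> Dpq; split.
      apply/eqP; rewrite -subr_eq0 -normr_le0; apply/ler_addgt0Pr => e e0.
      have [w [pw _] zw] := zA _ Dpq e e0.
      have := metric_triangle pq.1.2 z w; have := metric_triangle pq.1.2 w z.
      by rewrite (metric_sym w z) add0r ler_norml => ? ?; apply/andP; split; lra.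
    apply/eqP; rewrite -subr_eq0 -normr_le0; apply/ler_addgt0Pr => e e0.
    have [w [_ wq] zw] := zA _ Dpq e e0.
    have := metric_triangle z w pq.2.2; have := metric_triangle w z pq.2.2.
    by rewrite (metric_sym w z) add0r ler_norml => ? ?; apply/andP; split; lra.
  have zH p : H p -> mdist p.2 z = `|p.1 - s|.
    move=> Hp; have := neq p Hp; rewrite neq_lt => /orP[ps|sp].
      have [|/= -> _] := zA (p, (L, y)); first by split.
      by rewrite distrC ger0_norm// subr_ge0 ltW.
    have [|/= _] := zA ((0, x), p); first by split.
    by rewrite metric_sym => ->; rewrite ger0_norm// subr_ge0 ltW.
  have sz : 0 <= (s, z).1 <= L by rewrite /= s0.
  have notG : ~ G (s, z) by move=> Gsz; apply: (nH z); left.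
  apply: (Gmax (G `|` [set (s, z)])).
    split; first by move=> p Gp; left.
    by move=> /(_ (s, z)); apply: contra_not notG; apply; right.
  move=> p q.
  have cases u : ((G `|` [set (s, z)]) `|` base) u -> H u \/ u = (s, z).
    by move=> [[Gu|->]|bu]; [left; left|right|left; right].
  move=> /cases[Hp|->] /cases[Hq|->].
  - by split; [exact: Hle|exact: Hd].
  - by split; [exact: Hle|exact: zH].
  - by split => //=; rewrite metric_sym zH// distrC.
  - by split => //=; rewrite mdistxx subrr normr0.
have /choice[g gH] : forall s : R, exists z, 0 <= s <= L -> H (s, z).
  move=> s; have [/andP[s0 sL]|] := pselect (0 <= s <= L); last by exists x.
  by have [z Hz] := total s s0 sL; exists z.
have g0 : g 0 = x.
  apply: mdist_positivity; rewrite (Hd (0, g 0) (0, x)) ?subrr ?normr0//.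
  by apply: gH; rewrite lexx L0.
have gL : g L = y.
  apply: mdist_positivity; rewrite (Hd (L, g L) (L, y)) ?subrr ?normr0//.
  by apply: gH; rewrite lexx L0.
exists (g @` `[0, L]), L, g; split => //.
move=> s t; rewrite !in_itv/= => s0L t0L.
exact: (Hd (s, g s) (t, g t) (gH _ s0L) (gH _ t0L)).
Qed.

End proper_length_space.

(** * The fundamental theorem of calculus for absolutely continuous functions *)

Section lebesgue_theorem.
Context {R : realType}.
Notation mu := (@lebesgue_measure R).
Implicit Types (a b : R) (f g : R -> R).

Lemma abs_continuous_dist a b f : abs_continuous a b f ->
  forall e : R, 0 < e -> exists2 d : R, 0 < d & forall x y,
    a <= x -> x <= y -> y <= b -> y - x < d -> `|f y - f x| < e.
Proof.
move=> acf e e0; have [d d0 df] := acf e e0; exists d => // x y ax xy yb yxd.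
have := df [:: (x, y)]; rewrite !big_seq1; apply => //.
by move=> I; rewrite inE => /eqP ->.
Qed.

Lemma stieltjes_itv (G : cumulative R R) (x y : R) : x <= y ->
  lebesgue_stieltjes_measure G `]x, y]%classic = (G y - G x)%:E.
Proof.
move=> xy; rewrite /lebesgue_stieltjes_measure/= /measure_extension.
rewrite measurable_mu_extE/=; last exact: is_ocitv.
by rewrite wlength_itv_bnd.
Qed.

Lemma trivIset_nonoverlapping (p : set R -> R * R) (l : seq (set R)) : uniq l ->
  (forall X, X \in l -> (p X).1 < (p X).2 /\ X = `](p X).1, (p X).2]%classic) ->
  (forall X Y, X \in l -> Y \in l -> X `&` Y !=set0 -> X = Y) ->
  pairwise (fun I J : R * R => (I.2 <= J.1) || (J.2 <= I.1)) (map p l).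
Proof.
elim: l => //= X l IH /andP[Xl ul] pl tl; apply/andP; split; last first.
  apply: IH => //.
    by move=> Y Yl; apply: pl; rewrite inE Yl orbT.
  by move=> Y Z Yl Zl; apply: tl; rewrite inE ?Yl ?Zl orbT.
apply/allP => _ /mapP[Y Yl ->].
have [X12 XE] := pl X (mem_head _ _).
have [|Y12 YE] := pl Y; first by rewrite inE Yl orbT.
rewrite leNgt (leNgt (p Y).2) -negb_and; apply/negP => /andP[h1 h2].
have XY : X = Y.
  apply: tl; rewrite ?mem_head ?inE ?Yl ?orbT//.
  exists (Num.min (p X).2 (p Y).2); split.
    by rewrite [Z in Z _]XE/= in_itv/= lt_min X12 h2/= ge_min lexx.
  by rewrite [Z in Z _]YE/= in_itv/= lt_min Y12 h1/= ge_min lexx orbT.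
by move: Xl; rewrite XY Yl.
Qed.

(** Absolute continuity of the cumulative function G is stated on finite families of
intervals; a null set is covered by countably many intervals of small total
length, and a finite union of these is first decomposed into disjoint ones. *)
Lemma stieltjes_dominates (G : cumulative R R) :
  (forall e : R, 0 < e -> exists2 d : R, 0 < d & forall s : seq (R * R),
    (forall I, I \in s -> I.1 <= I.2) ->
    pairwise (fun I J => (I.2 <= J.1) || (J.2 <= I.1)) s ->
    \sum_(I <- s) (I.2 - I.1) < d -> \sum_(I <- s) (G I.2 - G I.1) <= e) ->
  forall A, measurable A -> mu A = 0%E -> lebesgue_stieltjes_measure G A = 0%E.
Proof.
move=> acG A mA muA0; pose nu : {measure set (measurableTypeR R) -> \bar R} :=
  lebesgue_stieltjes_measure G.
rewrite -/(nu A).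
apply/eqP; rewrite eq_le measure_ge0 andbT.
apply/lee_addgt0Pr => e e0; rewrite add0e.
have [d d0 dG] := acG e e0.
have /ereal_inf_lt[_ [F [mF AF] <-] Fd] : (mu A < d%:E)%E by rewrite muA0 lte_fin.
pose U n : set (measurableTypeR R) := \big[setU/set0]_(k < n) F k.
have mFk k : measurable (F k : set (measurableTypeR R)).
  by apply: sub_sigma_algebra; exact: mF.
have mU n : measurable (U n) by exact: bigsetU_measurable.
have nuU n : (nu (U n) <= e%:E)%E.
  have [->|/set0P U0] := eqVneq (U n) set0; first by rewrite measure0 lee_fin ltW.
  have rU : measurable (U n : set (SetRing.type (ocitv_type R))).
    by apply: bigsetU_measurable => k _; apply: sub_gen_smallest; exact: mF.
  pose D : set (set R) := SetRing.decomp (U n : set (SetRing.type (ocitv_type R))).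
  have finD : finite_set D by exact: (@SetRing.decomp_finite_set _ (ocitv_type R) (U n)).
  have D0 X : D X -> X !=set0.
    exact: (@SetRing.all_decomp_neq0 _ (ocitv_type R) (U n) U0).
  have mD X : D X -> ocitv X.
    by move=> DX; apply: (SetRing.decomp_measurable rU); exact/mem_set.
  have UE : U n = \bigcup_(X in D) X.
    exact/esym/(@SetRing.cover_decomp _ (ocitv_type R) (U n)).
  have tD : trivIset D id by exact: (@SetRing.decomp_triv _ (ocitv_type R) (U n)).
  have /choice[p pP] : forall X : set R, exists x : R * R,
      D X -> x.1 < x.2 /\ X = `]x.1, x.2]%classic.
    move=> X; have [DX|] := pselect (D X); last by exists (0, 0).
    have /ocitvP[X0|[x x12 Xx]] := mD _ DX; last by exists x.
    by have := D0 _ DX; rewrite X0 => -[].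
  have mDX X : D X -> measurable (X : set (measurableTypeR R)).
    by move=> DX; apply: sub_sigma_algebra; exact: mD.
  have meas (m : {measure set (measurableTypeR R) -> \bar R}) :
      m (U n) = (\sum_(X <- finmap.enum_fset (fset_set D)) m X)%E.
    by rewrite UE measure_fin_bigcup//= fsbig_finite.
  pose l : seq (set R) := finmap.enum_fset (fset_set D).
  have lD X : X \in l -> D X by rewrite in_fset_set// inE.
  pose s := map p l.
  have : \sum_(I <- s) (G I.2 - G I.1) <= e.
    apply: dG.
    - by move=> I /mapP[X /lD/pP[? ?] ->]; exact: ltW.
    - apply: trivIset_nonoverlapping; first exact: finmap.fset_uniq.
        by move=> X /lD; exact: pP.
      by move=> X Y /lD DX /lD DY; exact: tD.
    - rewrite -lte_fin; apply: le_lt_trans Fd.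
      have -> : (\sum_(I <- s) (I.2 - I.1))%:E = mu (U n).
        rewrite meas big_map -sumEFin big_seq [RHS]big_seq.
        apply: eq_bigr => X /lD DX; have [p12 XE] := pP _ DX.
        transitivity (mu `](p X).1, (p X).2]%classic); last by rewrite -XE.
        by rewrite lebesgue_measure_itv/= lte_fin p12 EFinB.
      apply: ereal_inf_lbound; exists F => //; split => // t.
      by rewrite /U -bigcup_mkord => -[k _ Fkt]; exists k.
  rewrite -lee_fin; apply: le_trans.
  rewrite meas big_map -sumEFin big_seq [leRHS]big_seq.
  rewrite le_eqVlt; apply/orP; left; apply/eqP.
  apply: eq_bigr => X /lD DX; have [p12 XE] := pP _ DX.
  by have := stieltjes_itv G (ltW p12); rewrite -XE => h; exact: h.
have UF : \bigcup_n U n = \bigcup_n F n.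
  apply/seteqP; split => t [n _].
    by rewrite /U -bigcup_mkord => -[k _ Fkt]; exists k.
  by move=> Fnt; exists n.+1 => //; rewrite /U -bigcup_mkord; exists n => /=.
have mUF : measurable (\bigcup_n U n) by exact: bigcupT_measurable.
have ndU : nondecreasing_seq U.
  by move=> i j ij; apply/subsetPset; exact: subset_bigsetU.
apply: (@le_trans _ _ (nu (\bigcup_n U n))).
  by apply: le_measure; rewrite ?inE// UF.
have cv := nondecreasing_cvg_mu (mu := nu) mU mUF ndU.
rewrite -(cvg_lim _ cv)//; apply: lime_le; first by apply/cvg_ex; eexists; exact: cv.
exact: nearW.
Qed.

(** A cumulative function that is constant outside [a, b] has total mass G b - G a. *)
Lemma clamp_stieltjes_finite (G : cumulative R R) (a b : R) : a <= b ->
  (forall x, G x = G (clamp a b x)) ->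
  (lebesgue_stieltjes_measure G setT < +oo)%E.
Proof.
move=> ab Gc.
pose nu : {measure set (measurableTypeR R) -> \bar R} :=
  lebesgue_stieltjes_measure G.
rewrite -/(nu setT); pose I n : set (measurableTypeR R) := `]- (n%:R), n%:R]%classic.
have mI n : measurable (I n) by exact: measurable_itv.
have UI : \bigcup_n I n = setT by exact: (bigcup_itvT false false).
have cv : nu \o I @ \oo --> nu (\bigcup_n I n).
  apply: nondecreasing_cvg_mu => //; first by rewrite UI.
  by move=> i j ij; apply/subsetPset/subset_itv; rewrite leBSide/= ?lerN2 ler_nat.
rewrite -UI -(cvg_lim _ cv)//.
apply: (@le_lt_trans _ _ (G b - G a)%:E); last exact: ltry.
apply: lime_le; first by apply/cvg_ex; eexists; exact: cv.
apply: nearW => n /=; rewrite [leLHS]stieltjes_itv; last by rewrite ge0_cp.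
rewrite lee_fin Gc (Gc (- _)) lerB//; apply: cumulative_is_nondecreasing.
  exact: clamp_le.
exact: clamp_ge.
Qed.

(** The Radon-Nikodym density of the Stieltjes measure of g with respect to the
Lebesgue measure. *)
Lemma abs_continuous_nondecreasing_density a b g : a <= b ->
  abs_continuous a b g ->
  (forall x y, a <= x -> x <= y -> y <= b -> g x <= g y) ->
  exists h : R -> R, mu.-integrable setT (EFin \o h) /\
    forall x, a <= x -> x <= b -> g x - g a = \int[mu]_(t in `]a, x]) h t.
Proof.
move=> ab acg ndg; pose G := g \o clamp a b.
have clab x : a <= clamp a b x <= b by rewrite clamp_ge clamp_le.
have ndG : {homo G : x y / x <= y}.
  move=> x y xy; apply: ndg; rewrite ?clamp_ge ?clamp_le//.
  exact: clamp_nd.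
have acG := @abs_continuous_dist _ _ g acg.
have ctsG : continuous G.
  move=> x; apply/cvgrPdist_lt => e e0; have [d d0 dG] := acG e e0.
  near=> y; have xyd : `|x - y| < d by near: y; exact: cvgr_dist_lt.
  have [xy|/ltW yx] := leP x y.
    rewrite distrC; apply: dG; rewrite ?clamp_ge ?clamp_le ?clamp_nd//.
    rewrite (le_lt_trans (clamp_lip _ _ xy))// (le_lt_trans _ xyd)//.
    by rewrite distrC ler_norm.
  apply: dG; rewrite ?clamp_ge ?clamp_le ?clamp_nd//.
  by rewrite (le_lt_trans (clamp_lip _ _ yx))// (le_lt_trans _ xyd)// ler_norm.
pose Gc : cumulative R R :=
  HB.pack G (isCumulative.Build R _ R G ndG (right_continuousW ctsG)).
pose nu0 : {measure set (measurableTypeR R) -> \bar R} :=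
  lebesgue_stieltjes_measure Gc.
have nuT : (nu0 setT < +oo)%E.
  apply: (@clamp_stieltjes_finite Gc a b) => // x.
  by rewrite /= /G/= [clamp a b (clamp a b x)]clamp_id ?clamp_ge ?clamp_le.
have finnu : fin_num_fun nu0.
  move=> A mA; rewrite ge0_fin_numE ?measure_ge0//.
  by rewrite (le_lt_trans _ nuT)// le_measure ?inE.
pose nu : {finite_measure set (measurableTypeR R) -> \bar R} :=
  HB.pack (nu0 : set _ -> \bar R) (Measure.class nu0) (Measure_isFinite.Build _ _ _ nu0 finnu).
have nuE x y : x <= y -> nu `]x, y]%classic = (G y - G x)%:E.
  by move=> xy; exact: (stieltjes_itv Gc).
have nu_mu : nu `<< mu.
  apply/null_content_dominatesP => A mA A0.
  apply: (@stieltjes_dominates Gc) => // e e0.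
  have [d d0 df] := acg e e0; exists d => // s s12 ss len_s.
  pose C (I : R * R) := (clamp a b I.1, clamp a b I.2).
  have H := df (map C s); rewrite !big_map in H.
  apply: (le_trans _ (ltW (H _ _ _))).
  - by apply: ler_sum => I _; exact: ler_norm.
  - move=> _ /mapP[I /s12 I12 ->] /=.
    by rewrite clamp_ge clamp_le// clamp_nd.
  - rewrite pairwise_map; apply: sub_pairwise ss => I J /=.
    by move=> /orP[/(clamp_nd a b)->//|/(clamp_nd a b)->]; rewrite orbT.
  - rewrite (le_lt_trans _ len_s)// big_seq [leRHS]big_seq; apply: ler_sum.
    by move=> I /s12 I12; exact: clamp_lip.
have [f [f0 ffin intf nuf]] := radon_nikodym_sigma_finite nu_mu.
exists (fine \o f); split.
  by apply: eq_integrable intf => // x _ /=; rewrite fineK.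
move=> x ax xb.
have := nuf `]a, x]%classic; rewrite nuE// => /(_ _) E.
rewrite /Rintegral/=.
have -> : g x - g a = G x - G a by rewrite /G/= !clamp_id.
have {}E : (G x - G a)%:E = (\int[mu]_(t in `]a, x]) f t)%E by apply: E.
rewrite -[LHS]/(fine (G x - G a)%:E) E; congr fine.
by apply: eq_integral => y _; rewrite /= fineK.
Unshelve. all: by end_near. Qed.

(** With V the total variation of f, the functions V and V - f are nondecreasing and
absolutely continuous, hence integrals of their densities; the integral of a
density is almost everywhere derivable by Lebesgue differentiation. *)
Lemma abs_continuous_ae_derivable a b f : a <= b -> abs_continuous a b f ->
  exists h : R -> R, [/\ mu.-integrable setT (EFin \o h),
    forall x, a <= x -> x <= b -> f x - f a = \int[mu]_(t in `]a, x]) h t &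
    {ae mu, forall x, a < x -> x < b -> is_derive x 1 f (h x)}].
Proof.
move=> ab acf; have [V acV fV] := abs_continuous_variation ab acf.
have V_nd x y : a <= x -> x <= y -> y <= b -> V x <= V y.
  by move=> ax xy yb; rewrite -subr_ge0 (le_trans _ (fV _ _ ax xy yb)).
have [h1 [ih1 Vh1]] := abs_continuous_nondecreasing_density ab acV V_nd.
have acVf : abs_continuous a b (fun x => V x - f x).
  apply: (@abs_continuous_dominated _ _ _ 2 a b V) => // x y ax xy yb.
  have := fV _ _ ax xy yb; have := V_nd _ _ ax xy yb => Vxy fxy.
  rewrite (_ : V y - f y - (V x - f x) = (V y - V x) - (f y - f x)); last by ring.
  rewrite (le_trans (ler_normB _ _))// (ger0_norm (_ : 0 <= V y - V x)) ?subr_ge0//.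
  by lra.
have Vf_nd x y : a <= x -> x <= y -> y <= b -> V x - f x <= V y - f y.
  move=> ax xy yb; have := fV _ _ ax xy yb => h.
  by have := le_trans (ler_norm _) h; lra.
have [h2 [ih2 Vh2]] := abs_continuous_nondecreasing_density ab acVf Vf_nd.
pose h x := h1 x - h2 x.
have ih : mu.-integrable setT (EFin \o h).
  rewrite (_ : EFin \o h = (EFin \o h1) \- (EFin \o h2))%E; last by apply/funext.
  exact: integrableB.
have fh x : a <= x -> x <= b -> f x - f a = \int[mu]_(t in `]a, x]) h t.
  move=> ax xb; rewrite RintegralB//.
  - by rewrite -Vh1// -Vh2//; ring.
  - exact: integrableS ih1.
  - exact: integrableS ih2.
exists h; split => //.
have lh : locally_integrable [set: R] h.
  by apply: open_integrable_locally => //; exact: openT.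
have ih' y : mu.-integrable [set` Interval (BRight a) (BRight y)] (EFin \o h).
  exact: integrableS ih.
have := @FTC1 R h (BRight a) ih' lh.
apply: filterS; first exact: (ae_filter_ringOfSetsType mu).
move=> x /= hx ax xb.
have [dF F'] : derivable (fun y => \int[mu]_(t in `]a, y]) h t) x 1 /\
    (fun y => \int[mu]_(t in `]a, y]) h t)^`()%classic x = h x by apply: hx; rewrite lte_fin.
apply: (@near_eq_is_derive _ _ _ (fun y => \int[mu]_(t in `]a, y]) h t + f a)).
  near=> y; rewrite -fh ?subrK//.
    by apply: ltW; near: y; exact: lt_nbhsr.
  by apply: ltW; near: y; exact: lt_nbhsl.
rewrite -[h x]addr0; apply: is_deriveD.
by apply: DeriveDef; [exact: dF|rewrite -derive1E; exact: F'].
Unshelve. all: by end_near. Qed.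

End lebesgue_theorem.

(** * Integration for the completed Lebesgue measure *)

Section completed_measure.
Context {R : realType}.
Notation mu := (@lebesgue_measure R).
Notation cmu := (@completed_lebesgue_measure R).
Notation cR := (caratheodory_type (wlength (@idfun R))^*%mu).
Local Open Scope ereal_scope.

Lemma completed_measurable (A : set R) : measurable A -> measurable (A : set cR).
Proof. exact: sub_caratheodory. Qed.

Lemma completed_ae (P : R -> Prop) : {ae mu, forall x, P x} -> {ae cmu, forall x, P x}.
Proof.
move=> [A [mA A0 PA]]; exists A; split => //; exact: completed_measurable.
Qed.

(** The measurable sets of the completion are the Borel sets up to null sets, which
reduces statements on the completed measure to the Lebesgue measure. *)
Lemma completed_measurableE (A : set R) : measurable (A : set cR) ->
  exists B N, [/\ measurable B, mu.-negligible N & A = B `|` N].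
Proof.
rewrite -completed_caratheodory_measurable g_sigma_completed_algebra_genE.
by move=> [B mB [N nN <-]]; exists B, N.
Qed.

Lemma completed_ge0_integral (D : set R) (f : R -> \bar R) : measurable D ->
  measurable_fun D f -> (forall x, D x -> 0 <= f x) ->
  \int[cmu]_(x in D) f x = \int[mu]_(x in D) f x.
Proof.
move=> mD mf f0.
have mid : measurable_fun setT (idfun : cR -> measurableTypeR R).
  by move=> _ A mA; rewrite setTI; exact: completed_measurable.
have := @ge0_integral_pushforward _ _ cR (measurableTypeR R) R idfun mid cmu D f mD mf.
move=> <-; last by move=> x /[!inE]; exact: f0.
exact: eq_measure_integral.
Qed.

(** The reparametrizations used to reverse and to concatenate curves. *)
Definition isometric_affine (phi : R -> R) :=
  exists c : R, (phi = fun x => c + x)%R \/ (phi = fun x => c - x)%R.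

Lemma isometric_affine_continuous phi : isometric_affine phi -> continuous phi.
Proof.
by move=> [c [->|->]] x; apply: cvgD => //; try exact: cvg_cst; exact: cvgN.
Qed.

Lemma isometric_affine_measure phi (A : set R) : isometric_affine phi ->
  measurable A -> mu (phi @^-1` A) = mu A.
Proof.
move=> iphi mA; have mphi : measurable_fun setT (phi : R -> R).
  by apply: continuous_measurable_fun; exact: isometric_affine_continuous.
pose m : {measure set (measurableTypeR R) -> \bar R} :=
  pushforward mu (phi : measurableTypeR R -> measurableTypeR R).
apply/esym/(@lebesgue_measure_unique R (m mphi)); last exact: mA.
move=> _ [[a b] _ <-] /=.
rewrite /m/= /pushforward.
case: iphi => c [->|->].
- rewrite (_ : _ @^-1` _ = `](a - c)%R, (b - c)%R]%classic); last first.
    by apply/seteqP; split => x /=; rewrite !in_itv/= ltrBlDl lerBrDl.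
  rewrite !lebesgue_measure_itv/= !lte_fin ltrD2r.
  by case: ifP => // _; rewrite -!EFinB; congr _%:E; ring.
- rewrite (_ : _ @^-1` _ = `[(c - b)%R, (c - a)%R[%classic); last first.
    apply/seteqP; split => x /=; rewrite !in_itv/= => /andP[? ?].
      by apply/andP; split; lra.
    by apply/andP; split; lra.
  rewrite !lebesgue_measure_itv/= !lte_fin ltrD2l ltrN2.
  by case: ifP => // _; rewrite -!EFinB; congr _%:E; ring.
Qed.

Lemma isometric_affine_completed phi (A : set R) : isometric_affine phi ->
  measurable (A : set cR) ->
  measurable (phi @^-1` A : set cR) /\ cmu (phi @^-1` A) = cmu A.
Proof.
move=> iphi mA; have mphi : measurable_fun setT (phi : R -> R).
  by apply: continuous_measurable_fun; exact: isometric_affine_continuous.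
have mphiB B : measurable B -> measurable (phi @^-1` B).
  by move=> mB; rewrite -[_ @^-1` _]setTI; exact: mphi.
have [B [N [mB [N' [mN' N'0 NN']] AE]]] := completed_measurableE mA.
have neg M M' : mu M' = 0 -> measurable M' -> M `<=` M' ->
    measurable (M : set cR) /\ cmu M = 0.
  move=> M'0 mM' MM'.
  have nM : cmu.-negligible M.
    by exists M'; split => //; exact: completed_measurable.
  have mM := completed_lebesgue_measure_is_complete nM.
  by split => //; apply: measure_negligible.
have [mphiN phiN0] : measurable (phi @^-1` N : set cR) /\ cmu (phi @^-1` N) = 0.
  apply: (neg _ (phi @^-1` N')); rewrite ?isometric_affine_measure//.
  - exact: mphiB.
  - by move=> x; exact: NN'.
have [mN N0] : measurable (N : set cR) /\ cmu N = 0 by exact: (neg _ N').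
have cmuU (B' M : set R) : measurable B' -> measurable (M : set cR) -> cmu M = 0 ->
    cmu (B' `|` M) = mu B'.
  move=> mB' mM M0; have cB' := completed_measurable mB'.
  apply/eqP; rewrite eq_le; apply/andP; split.
    rewrite (le_trans (measureU2 cmu _ _))//.
    by rewrite [X in _ + X <= _]M0 adde0.
  by apply: (@le_measure _ _ _ cmu); rewrite ?inE//; exact: measurableU.
rewrite AE preimage_setU; split.
  by apply: measurableU; [apply: completed_measurable; exact: mphiB|exact: mphiN].
by rewrite !cmuU ?isometric_affine_measure//; exact: mphiB.
Qed.

Lemma isometric_affine_integral phi (D : set R) (w : R -> R) : isometric_affine phi ->
  measurable (D : set cR) -> (forall x, 0 <= w x)%R ->
  @measurable_fun _ _ cR R D w ->
  (\int[cmu]_(x in phi @^-1` D) w (phi x) = \int[cmu]_(x in D) w x)%R.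
Proof.
move=> iphi mD w0 mw.
have mphi : measurable_fun setT (phi : cR -> cR).
  by move=> _ A mA; rewrite setTI; exact: (isometric_affine_completed iphi mA).1.
have mw' : @measurable_fun _ _ cR _ D (EFin \o (w : cR -> R)) by exact/measurable_EFinP.
have := @ge0_integral_pushforward _ _ cR cR R phi mphi cmu D (EFin \o (w : cR -> R)) mD mw'.
rewrite /Rintegral/= => <-; last by move=> x _; rewrite lee_fin.
congr fine; apply: eq_measure_integral => A mA _.
exact: (isometric_affine_completed iphi mA).2.
Qed.

Lemma completed_set1 (x : R) : cmu [set x] = 0.
Proof. exact: lebesgue_measure_set1. Qed.

Lemma completed_Rintegral_cat (a b c : R) (w : R -> R) : (a <= b)%R -> (b <= c)%R ->
  cmu.-integrable `[a, c] (EFin \o w) ->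
  (\int[cmu]_(x in `[a, c]) w x =
   \int[cmu]_(x in `[a, b]) w x + \int[cmu]_(x in `[b, c]) w x)%R.
Proof.
move=> ab bc iw.
have mitv (i : interval R) : measurable ([set` i] : set cR).
  by apply: completed_measurable; exact: measurable_itv.
have iab : cmu.-integrable `[a, b] (EFin \o w).
  apply: integrableS iw; [exact: mitv|exact: mitv|].
  by apply: subset_itvl; rewrite bnd_simp.
have ibc : cmu.-integrable `[b, c] (EFin \o w).
  apply: integrableS iw; [exact: mitv|exact: mitv|].
  by apply: subset_itvr; rewrite bnd_simp.
have ibc' : cmu.-integrable `]b, c] (EFin \o w).
  apply: integrableS ibc; [exact: mitv|exact: mitv|].
  by apply: subset_itvr; rewrite bnd_simp.
have E1 : `[a, c]%classic = `[a, b] `|` `]b, c] :> set R.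
  by rewrite -itv_bndbnd_setU// bnd_simp.
have E2 : `[b, c]%classic = [set b] `|` `]b, c] :> set R.
  by rewrite setU1itv// bnd_simp.
have m1 : measurable ([set b] : set cR).
  by apply: completed_measurable; exact: measurable_set1.
have mint D : cmu.-integrable D (EFin \o w) ->
    @measurable_fun _ _ cR _ D (EFin \o (w : cR -> R)).
  by move=> /integrableP[].
have bac : [set b] `<=` `[a, c] by move=> x ->; rewrite /= in_itv/= ab.
have i0 : (\int[cmu]_(x in [set b]) w x = 0)%R.
  rewrite /Rintegral.
  suff -> : \int[cmu]_(x in [set b]) (w x)%:E = 0 by [].
  apply: null_set_integral; [exact: m1| |exact: completed_set1].
  by apply: measurable_funS (mint _ iw); [exact: mitv|exact: bac].
have d1 : disj_set (`[a, b]%classic : set cR) `]b, c]%classic.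
  apply/disj_setPRL => x/=; rewrite !in_itv/= => /andP[bx _].
  by rewrite (leNgt x) bx andbF.
have d2 : disj_set ([set b] : set cR) `]b, c]%classic.
  by apply/disj_setPRL => x/=; rewrite !in_itv/= => /andP[bx _] xb; rewrite xb ltxx in bx.
rewrite E1 (Rintegral_setU (mitv _) (mitv _) _ d1) -?E1//.
congr (_ + _)%R; rewrite E2 (Rintegral_setU m1 (mitv _) _ d2) -?E2//.
by rewrite i0 add0r.
Qed.

(** The increment of f is the integral of its derivative, which is dominated by w.
The completed measure is the one for which the speed of a curve is integrable. *)
Lemma abs_continuous_le_integral (a b : R) (f w : R -> R) : (a <= b)%R ->
  abs_continuous a b f -> (forall x, 0 <= w x)%R ->
  cmu.-integrable `[a, b] (EFin \o w) ->
  {ae cmu, forall x : R, (a < x)%R -> (x < b)%R -> derivable f x 1 ->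
    (`|f^`()%classic x| <= w x)%R} ->
  (`|f b - f a| <= \int[cmu]_(t in `[a, b]) w t)%R.
Proof.
move=> ab acf w0 iw fw.
have [h [ih fh dfh]] := abs_continuous_ae_derivable ab acf.
have mitv (i : interval R) : measurable ([set` i] : set cR).
  by apply: completed_measurable; exact: measurable_itv.
have ihD : mu.-integrable `]a, b] (EFin \o h).
  by apply: integrableS ih; [exact: measurableT|exact: measurable_itv|].
have sD : `]a, b] `<=` `[a, b] by exact: subset_itv_oc_cc.
have iwD : cmu.-integrable `]a, b] (EFin \o w).
  by apply: integrableS iw; [exact: mitv|exact: mitv|].
have mint D v : cmu.-integrable D (EFin \o v) ->
    @measurable_fun _ _ cR _ D (EFin \o (v : cR -> R)).
  by move=> /integrableP[].
have mh : measurable_fun `]a, b] (fun x => (`|h x|%R)%:E).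
  by apply: measurable_int (integrable_norm ihD).
have mhc : @measurable_fun _ _ cR _ `]a, b] (fun x => (`|h x|%R)%:E).
  by move=> mD Y mY; apply: completed_measurable; apply: mh => //; exact: measurable_itv.
have I1 : \int[cmu]_(x in `]a, b]) (`|h x|%R)%:E <= \int[cmu]_(x in `]a, b]) (w x)%:E.
  apply: ae_ge0_le_integral; [exact: mitv| |exact: mhc| |exact: (mint _ _ iwD)|].
  - by move=> x _; rewrite lee_fin.
  - by move=> x _; rewrite lee_fin.
  have nb : {ae cmu, forall x : R, x != b}.
    exists [set b]; split; [|exact: completed_set1|].
      by apply: completed_measurable; exact: measurable_set1.
    by move=> x /= /negP; rewrite negbK => /eqP.
  have fae : Filter (nbhs (almost_everywhere cmu)) by exact: (ae_filter_ringOfSetsType cmu).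
  apply: filterS3 (completed_ae dfh) fw nb => x hx wx xb.
  rewrite /= in_itv/= => /andP[ax xb'].
  have {}xb : (x < b)%R by rewrite lt_neqAle xb.
  have [df <-] := hx ax xb; rewrite lee_fin -derive1E; exact: wx.
have I2 : \int[cmu]_(x in `]a, b]) (w x)%:E <= \int[cmu]_(x in `[a, b]) (w x)%:E.
  apply: ge0_subset_integral; [exact: mitv|exact: mitv|exact: (mint _ _ iw)| |exact: sD].
  by move=> x _; rewrite lee_fin.
have N : (`|\int[mu]_(t in `]a, b]) h t| <= \int[mu]_(t in `]a, b]) `|h t|)%R.
  by apply: le_normr_Rintegral; [exact: measurable_itv|exact: ihD].
rewrite fh//; apply: (le_trans N).
have fin_w : \int[cmu]_(x in `[a, b]) (w x)%:E \is a fin_num.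
  by apply: integrable_fin_num iw; exact: mitv.
have I : \int[mu]_(x in `]a, b]) (`|h x|%R)%:E <= \int[cmu]_(x in `[a, b]) (w x)%:E.
  rewrite -completed_ge0_integral; [|exact: measurable_itv|exact: mh|].
    exact: le_trans I1 I2.
  by move=> x _; rewrite lee_fin.
apply: fine_le => //.
rewrite ge0_fin_numE; last by apply: integral_ge0 => x _; rewrite lee_fin.
by apply: (le_lt_trans I); rewrite ltey_eq fin_w.
Qed.

End completed_measure.

Section completed_integral_order.
Context {R : realType}.
Notation mu := (@lebesgue_measure R).
Notation cmu := (@completed_lebesgue_measure R).
Notation cR := (caratheodory_type (wlength (@idfun R))^*%mu).
Implicit Types (a b : R) (f g : R -> R).

Let mitv (i : interval R) : measurable ([set` i] : set cR).
Proof. by apply: completed_measurable; exact: measurable_itv. Qed.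

Lemma ae_interior a b (P : R -> Prop) :
  {ae mu, forall x, a < x -> x < b -> P x} -> {ae cmu, forall x, x \in `[a, b] -> P x}.
Proof.
move=> ae_P; apply: completed_ae.
have fmu : Filter (nbhs (almost_everywhere mu)) := ae_filter_ringOfSetsType mu.
have neq (c : R) : {ae mu, forall x : R, x != c}.
  exists [set c]; split; [exact: measurable_set1|exact: lebesgue_measure_set1|].
  by move=> x /= /negP; rewrite negbK => /eqP.
apply: (@filterS3 _ _ fmu _ _ _ _ _ ae_P (neq a) (neq b)) => x Px xa xb.
rewrite in_itv/= => /andP[ax bx]; apply: Px.
  by rewrite lt_neqAle eq_sym xa.
by rewrite lt_neqAle xb.
Qed.

Lemma completed_Rintegral_le a b f g :
  (forall x, 0 <= f x) -> (forall x, 0 <= g x) ->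
  cmu.-integrable `[a, b] (EFin \o f) -> cmu.-integrable `[a, b] (EFin \o g) ->
  {ae mu, forall x, a < x -> x < b -> f x <= g x} ->
  \int[cmu]_(x in `[a, b]) f x <= \int[cmu]_(x in `[a, b]) g x.
Proof.
move=> f0 g0 fi gi fg.
have mint v : cmu.-integrable `[a, b] (EFin \o v) ->
    @measurable_fun _ _ cR _ `[a, b]%classic (EFin \o (v : cR -> R)).
  by move=> /integrableP[].
rewrite /Rintegral; apply: fine_le.
- by apply: (integrable_fin_num _ fi); exact: mitv.
- by apply: (integrable_fin_num _ gi); exact: mitv.
apply: ae_ge0_le_integral; [exact: mitv| |exact: (mint _ fi)| |exact: (mint _ gi)|].
- by move=> x _; rewrite lee_fin.
- by move=> x _; rewrite lee_fin.
- have fae : Filter (nbhs (almost_everywhere cmu)) by exact: (ae_filter_ringOfSetsType cmu).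
  apply: (@filterS _ _ fae _ _ _ (ae_interior fg)) => x fgx xab.
  by rewrite lee_fin; exact: fgx.
Qed.

Lemma completed_cst a b (k : R) : a <= b ->
  cmu.-integrable `[a, b] (EFin \o cst k) /\
  \int[cmu]_(x in `[a, b]) k = k * (b - a).
Proof.
move=> ab.
have mab : cmu `[a, b]%classic = (b - a)%:E.
  have -> : cmu `[a, b]%classic = mu `[a, b]%classic by [].
  rewrite lebesgue_measure_itv/= lte_fin lt_neqAle ab andbT.
  by case: eqVneq => [->|_] /=; rewrite ?subrr// EFinB.
split.
  apply/integrableP; split; first exact: (@measurable_cst _ _ cR _ _ k%:E).
  rewrite (_ : (fun x => _) = cst `|k|%:E)//.
  rewrite (integral_cst _ (mitv _)) [X in (_ * X)%E](_ : _ = (b - a)%:E); first by rewrite ltry.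
  exact: mab.
by rewrite /Rintegral (integral_cst _ (mitv _)) [X in (_ * X)%E](_ : _ = (b - a)%:E).
Qed.

Lemma completed_RintegralZ a b (k : R) f :
  cmu.-integrable `[a, b] (EFin \o f) ->
  cmu.-integrable `[a, b] (EFin \o (fun x => k * f x)) /\
  \int[cmu]_(x in `[a, b]) (k * f x) = k * \int[cmu]_(x in `[a, b]) f x.
Proof.
move=> fi; split; last by apply: RintegralZl; [exact: mitv|exact: fi].
by apply: (@integrableZl _ _ _ cmu _ (mitv _) k) fi.
Qed.

End completed_integral_order.

(** * Smooth maps and changes of charts *)

Section differential_calculus.
Context {R : realType}.

(** A map that vanishes near x has a zero remainder there. *)
Lemma near0_diff (V W : normedModType R) (k : V -> W) (x : V) :
  (\near x, k x = 0) -> differentiable k x /\ ('d k x : V -> W) = 0.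
Proof.
move=> k0; have kx0 : k x = 0 := nbhs_singleton k0.
have sx : (h + x) @[h --> (0 : V)] --> x.
  by rewrite -[X in _ --> X]add0r; apply: cvgD; [exact: cvg_id|exact: cvg_cst].
have c0 : continuous (\0 : {linear V -> W}) by exact: cst_continuous.
have ko : k \o shift x = cst (k x) + (\0 : {linear V -> W}) +o_ (0 : V) id.
  apply/eqaddoP => _/posnumP[e]; near=> h.
  rewrite /= !fctE /= kx0 /cst/=.
  have -> : k (h + x) = 0 by near: h; exact: sx _ k0.
  by rewrite addr0 subrr normr0 mulr_ge0.
have dk : ('d k x : V -> W) = (\0 : {linear V -> W}) by exact: diff_unique.
by split => //; apply/diff_locallyP; rewrite dk; split; [exact: c0|exact: ko].
Unshelve. all: by end_near. Qed.

Lemma near_eq_diff (V W : normedModType R) (f g : V -> W) (x : V) :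
  {near x, f =1 g} -> differentiable f x ->
  differentiable g x /\ ('d g x : V -> W) = 'd f x.
Proof.
move=> fg df.
have [dk k0] : differentiable (g - f) x /\ ('d (g - f) x : V -> W) = 0.
  apply: near0_diff; apply: filterS fg => y fgy.
  by rewrite /= -[(g - f) y]/(g y - f y) fgy subrr.
have gE : g = f + (g - f) by rewrite addrC subrK.
split; first by rewrite gE; exact: differentiableD.
pose D : V -> W := 'd f x.
have h : is_diff x (f + (g - f)) (D + (0 : V -> W)).
  by apply: is_diffD; [exact: differentiableP|exact: DiffDef].
have fgE : f + (g - f) = g by rewrite -gE.
have h0 : D + (0 : V -> W) = D by apply/funext => v; exact: addr0.
rewrite fgE h0 in h.
by rewrite (@diff_val _ _ _ _ _ _ _ h).
Qed.

Implicit Types (E F G : normedModType R).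

(** Differentials are taken at points of an open set, hence only depend on the germ. *)
Lemma class_C_eq E F k (W : set E) (f g : E -> F) : open W ->
  (forall x, W x -> f x = g x) -> class_C k W f -> class_C k W g.
Proof.
move=> oW; elim: k f g => [|k IH] f g fg /=.
  move=> cf x Wx; have := cf x Wx; rewrite /prop_for /continuous_at (fg x Wx); apply: cvg_trans.
  by apply: near_eq_cvg; apply: filterS (open_nbhs_nbhs (conj oW Wx)) => y /fg.
move=> [df cf].
have nfg x : W x -> {near x, f =1 g}.
  by move=> Wx; apply: filterS (open_nbhs_nbhs (conj oW Wx)) => y /fg.
split=> [x Wx|v]; first exact: (near_eq_diff (nfg x Wx) (df x Wx)).1.
apply: IH (cf v) => x Wx.
by have [_ ->] := near_eq_diff (nfg x Wx) (df x Wx).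
Qed.

Lemma class_C_cst E F k (W : set E) (c : F) : class_C k W (cst c).
Proof.
elim: k c => [|k IH] c /=; first by move=> x _; exact: cst_continuous.
split=> [x _|v]; first exact: differentiable_cst.
rewrite (_ : (fun x => _) = cst 0); first exact: IH.
by apply/funext => x; rewrite diff_cst.
Qed.

Lemma class_C_linear E F k (W : set E) (L : {linear E -> F}) : continuous L ->
  class_C k W L.
Proof.
move=> cL; case: k => [|k] /=; first by move=> x _; exact: cL.
split=> [x _|v]; first exact: linear_differentiable.
rewrite (_ : (fun x => _) = cst (L v)); first exact: class_C_cst.
by apply/funext => x; rewrite diff_lin.
Qed.

Lemma class_C_pair E F G k (W : set E) (f : E -> F) (g : E -> G) : open W ->
  class_C k W f -> class_C k W g -> class_C k W (fun x => (f x, g x)).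
Proof.
move=> oW; elim: k f g => [|k IH] f g /=.
  by move=> cf cg x Wx; apply: cvg_pair; [exact: cf|exact: cg].
move=> [df cf] [dg cg]; split=> [x Wx|v].
  by apply: differentiable_pair; [exact: df|exact: dg].
apply: class_C_eq (IH _ _ (cf v) (cg v)) => // x Wx.
by rewrite diff_pair//; [exact: df|exact: dg].
Qed.

Lemma class_C_comp_linear E F G k (W : set F) (f : F -> G) (L : {linear E -> F}) :
  continuous L -> open W -> class_C k W f -> class_C k (L @^-1` W) (f \o L).
Proof.
move=> cL oW; have oLW : open (L @^-1` W) by exact: open_comp.
have dL x : differentiable L x by exact: linear_differentiable.
elim: k f => [|k IH] f /=.
  by move=> cf x Wx; apply: continuous_comp; [exact: cL|exact: cf].
move=> [df cf]; split=> [x Wx|v].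
  by apply: differentiable_comp => //; exact: df.
apply: class_C_eq (IH _ (cf (L v))) => // x Wx /=.
by rewrite (diff_comp (dL x) (df _ Wx)) /= diff_lin.
Qed.

Lemma class_C_linear_comp E F G k (W : set E) (f : E -> F) (L : {linear F -> G}) :
  continuous L -> open W -> class_C k W f -> class_C k W (L \o f).
Proof.
move=> cL oW; elim: k f => [|k IH] f /=.
  by move=> cf x Wx; apply: continuous_comp; [exact: cf|exact: cL].
move=> [df cf]; split=> [x Wx|v].
  apply: differentiable_comp; first exact: df.
  exact: linear_differentiable.
apply: class_C_eq (IH _ (cf v)) => // x Wx /=.
rewrite (diff_comp (df _ Wx)) /=; last exact: linear_differentiable.
by rewrite diff_lin.
Qed.

Lemma row_coord_le m (v : 'rV[R]_m) i : `|v 0 i| <= `|v|.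
Proof. by rewrite [leRHS]/Num.Def.normr/= mx_normrE; exact: (le_bigmax _ _ (0, i)). Qed.

Lemma row_norm_le m (v : 'rV[R]_m) (c : R) : 0 <= c ->
  (forall i, `|v 0 i| <= c) -> `|v| <= c.
Proof.
move=> c0 vc; rewrite [leLHS]/Num.Def.normr/= mx_normrE.
by apply: bigmax_le => // -[i j] _ /=; rewrite ord1.
Qed.

Lemma pair_norm_le1 (U V : normedModType R) (v : U * V) : `|v.1| <= `|v|.
Proof. by rewrite prod_normE le_max lexx. Qed.

Lemma pair_norm_le2 (U V : normedModType R) (v : U * V) : `|v.2| <= `|v|.
Proof. by rewrite prod_normE le_max lexx orbT. Qed.

(** The mean value theorem on segments of a small ball, in which the partial
derivatives are bounded by continuity. *)
Lemma class_C1_lipschitz_real m (W : set ('rV[R]_m * R)) (f : 'rV[R]_m * R -> R) x0 :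
  open_nbhs x0 W -> class_C 1 W f -> exists K r : R, [/\ 0 < K, 0 < r &
    forall x y, ball x0 r x -> ball x0 r y -> `|f y - f x| <= K * `|y - x|].
Proof.
move=> [oW Wx0] [df cf].
pose e (i : 'I_m) : 'rV[R]_m * R := (delta_mx 0 i, 0).
pose e' : 'rV[R]_m * R := (0, 1).
pose B (x : 'rV[R]_m * R) := \sum_(i < m) `|'d f x (e i)| + `|'d f x e'|.
have dfB x v : `|'d f x v| <= B x * `|v|.
  have vE : v = \sum_(i < m) v.1 0 i *: e i + v.2 *: e'.
    rewrite (_ : \sum_(i < m) v.1 0 i *: e i = (v.1, 0)).
      rewrite /e' [v in LHS]surjective_pairing; congr (_, _) => /=.
        by rewrite scaler0 addr0.
      by rewrite [_ *: _]mulr1 add0r.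
    rewrite [in RHS](row_sum_delta v.1).
    rewrite (big_morph (fun a : 'rV[R]_m => (a, 0 : R)) (id1 := 0) (op1 := +%R)) => [|a b|]//.
      apply: eq_bigr => i _; congr (_, _) => //=; exact: mulr0.
    by congr (_, _); rewrite /= addr0.
  rewrite {1}vE linearD linear_sum linearZ /= (le_trans (ler_normD _ _))//.
  rewrite /B mulrDl mulr_suml lerD//.
    apply: (le_trans (ler_norm_sum _ _ _)); apply: ler_sum => i _.
    rewrite linearZ normrM mulrC ler_wpM2l// (le_trans (row_coord_le _ _))//.
    exact: pair_norm_le1.
  by rewrite normrM mulrC ler_wpM2l//; exact: pair_norm_le2.
pose K := B x0 + 1.
have K0 : 0 < K by rewrite ltr_wpDl// addr_ge0// sumr_ge0.
have cB : B x @[x --> x0] --> B x0.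
  apply: cvgD; last by apply: cvg_norm; exact: (cf e').
  by apply: cvg_big => [|i _]; [exact: add_continuous|apply: cvg_norm; exact: (cf (e i))].
have nB : \forall x \near x0, W x /\ B x < K.
  apply: filterI; first exact: open_nbhs_nbhs.
  by apply: cvgr_lt cB _ _; rewrite /K ltrDl.
have [r /= r0 rB] := (nbhs_ballP _ _).1 nB.
exists K, r; split => // x y xr yr.
pose aff (t : R) := x + t *: (y - x).
pose g (t : R) := f (aff t).
have inball t : 0 <= t -> t <= 1 -> ball x0 r (aff t).
  move=> t0 t1; move: xr yr; rewrite -!ball_normE/= /aff => xr yr.
  rewrite (_ : x0 - _ = (1 - t) *: (x0 - x) + t *: (x0 - y)); last first.
    have -> : x0 - y = (x0 - x) - (y - x) by rewrite opprB addrA subrK.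
    by rewrite [t *: (_ - (y - x))]scalerBr addrA -scalerDl subrK scale1r opprD addrA.
  apply: (le_lt_trans (ler_normD _ _)); rewrite !normrZ ger0_norm ?subr_ge0// ger0_norm//.
  have [->|tn0] := eqVneq t 0; first by rewrite subr0 mul1r mul0r addr0.
  have tp : 0 < t by rewrite lt_neqAle eq_sym tn0.
  have : t * `|x0 - y| < t * r by rewrite ltr_pM2l.
  have : (1 - t) * `|x0 - x| <= (1 - t) * r by rewrite ler_wpM2l ?subr_ge0// ltW.
  lra.
have daff (t : R) : differentiable aff t /\ ('d aff t : R -> _) = ( *:%R ^~ (y - x)).
  have h : is_diff t (cst x + ( *:%R ^~ (y - x))) (0 + ( *:%R ^~ (y - x))).
    exact: is_diffD.
  split; first exact: (@ex_diff _ _ _ _ _ _ _ h).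
  by rewrite -[aff]/(cst x + ( *:%R ^~ (y - x))) (@diff_val _ _ _ _ _ _ _ h) add0r.
have dfa (t : R) : t \in `[0, 1]%R -> differentiable f (aff t).
  rewrite in_itv/= => /andP[t0 t1]; apply: df.
  by have [] := rB _ (inball t t0 t1).
have dg (t : R) : t \in `[0, 1]%R -> is_derive t 1 g ('d f (aff t) (y - x)).
  move=> t01; have [da dE] := daff t.
  have dga : differentiable g t by apply: differentiable_comp => //; exact: dfa.
  apply: DeriveDef; first exact: diff_derivable.
  by rewrite deriveE// diff_comp//= ?dE ?scale1r//; exact: dfa.
have cg : {within `[0, 1], continuous g}.
  by apply: derivable_within_continuous => t /dg[].
have dg' (t : R) : t \in `]0, 1[%R -> is_derive t 1 g ('d f (aff t) (y - x)).
  by move=> t01; apply: dg; exact: subset_itv_oo_cc.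
have [t t01] := @MVT_segment R g (fun t => 'd f (aff t) (y - x)) 0 1 ler01 dg' cg.
rewrite /g /aff scale1r scale0r addr0 subr0 mulr1 subrKC => ->.
move: t01; rewrite in_itv/= => /andP[t0 t1].
rewrite (le_trans (dfB _ _))// ler_wpM2r// ltW//.
by have [] := rB _ (inball t t0 t1).
Qed.

Lemma class_C1_lipschitz m (W : set ('rV[R]_m * R)) (f : 'rV[R]_m * R -> 'rV[R]_m * R) x0 :
  open_nbhs x0 W -> class_C 1 W f -> exists K r : R, [/\ 0 < K, 0 < r &
    forall x y, ball x0 r x -> ball x0 r y -> `|f y - f x| <= K * `|y - x|].
Proof.
move=> W0 cf; have oW : open W := W0.1.
pose pr i (v : 'rV[R]_m * R) : R := v.1 0 i.
have lpr i : linear (pr i) by move=> a u v; rewrite /pr /= !mxE.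
pose prL i : {linear ('rV[R]_m * R)%type -> R} :=
  HB.pack (pr i) (GRing.isLinear.Build R _ _ _ _ (lpr i)).
have cpr i : continuous (prL i).
  by move=> v; apply: (@continuous_comp _ _ _ fst (fun M : 'rV[R]_m => M 0 i)); [exact: cvg_fst|exact: coord_continuous].
have csnd : continuous (snd : {linear ('rV[R]_m * R)%type -> R}) by move=> v; exact: cvg_snd.
have H i := class_C1_lipschitz_real W0 (class_C_linear_comp (cpr i) oW cf).
have [K' [r' [K'0 r'0 L']]] := class_C1_lipschitz_real W0 (class_C_linear_comp csnd oW cf).
have [K HK] := choice H; have [r Hr] := choice HK.
pose K1 := K' + \sum_i K i; pose r1 := \big[Num.min/r']_i r i.
have K0 i : 0 <= K i by have [/ltW] := Hr i.
have r10 : 0 < r1 by apply: lt_bigmin => // i _; have [] := Hr i.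
exists K1, r1; split=> //.
  by rewrite /K1 ltr_wpDr// sumr_ge0.
move=> x y xr yr; rewrite prod_normE ge_max; apply/andP; split; last first.
  apply: le_trans (L' x y _ _) _.
  - by apply: le_ball xr; exact: bigmin_le_id.
  - by apply: le_ball yr; exact: bigmin_le_id.
  - by rewrite ler_wpM2r// lerDl sumr_ge0.
apply: row_norm_le => [|i]; first by rewrite mulr_ge0// addr_ge0 ?sumr_ge0 ?ltW.
have [_ _ Li] := Hr i; have := Li x y.
rewrite /= /pr mxE mxE => L.
apply: le_trans (L _ _) _.
- by apply: le_ball xr; exact: bigmin_le_cond.
- by apply: le_ball yr; exact: bigmin_le_cond.
- apply: ler_wpM2r => //; rewrite /K1 (bigD1 i)//= addrCA lerDl addr_ge0 ?sumr_ge0//; exact: ltW.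
Qed.

End differential_calculus.

Section real_intervals.
Context {R : realType} {T : topologicalType}.
Implicit Types (a b t : R) (sigma : R -> T).

Lemma within_itv_near a b sigma t (U : set T) : {within `[a, b], continuous sigma} ->
  a <= t -> t <= b -> nbhs (sigma t) U ->
  exists2 r : R, 0 < r & forall s, a <= s -> s <= b -> t - r < s -> s < t + r -> U (sigma s).
Proof.
move=> /subspace_continuousP cs a_t tb Ut.
have tab : `[a, b]%classic t by rewrite /= in_itv/= a_t tb.
have /nbhs_ballP[r /= r0 rU] := cs t tab _ Ut.
exists r => // s sa sb s1 s2; apply: (rU s); last by rewrite /= in_itv/= sa sb.
by rewrite /ball/= ltr_norml; apply/andP; split; lra.
Qed.

Lemma within_itv_continuous a b sigma t : {within `[a, b], continuous sigma} ->
  a < t -> t < b -> {for t, continuous sigma}.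
Proof.
move=> cs a_t tb; have cs' : {within `]a, b[, continuous sigma}.
  by apply: continuous_subspaceW cs; exact: subset_itv_oo_cc.
move: cs'; rewrite continuous_open_subspace; last exact: itv_open.
by apply; rewrite inE/= in_itv/= a_t tb.
Qed.

Lemma within_itvS a b u v sigma : a <= u -> v <= b ->
  {within `[a, b], continuous sigma} -> {within `[u, v], continuous sigma}.
Proof.
move=> au vb; apply: continuous_subspaceW => x /=; rewrite !in_itv/= => /andP[ux xv].
by rewrite (le_trans au ux) (le_trans xv vb).
Qed.

End real_intervals.

Section chart_calculus.
Context {R : realType} {E : normedModType R} {T : topologicalType}.
Variables (H : set E) (A : atlas T E).
Implicit Types (c : chart T E) (q : T) (sigma : R -> T).

(** The map g expresses the chart c' in the chart c near q: it extends the transition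
map, which near a boundary point is only defined on part of a half-space, to an
open set W. *)
Definition chart_change c c' q (g : E -> E) (W : set E) := [/\ open_nbhs (c q) W,
  forall k, class_C k W g &
  forall p, chart_dom c p -> chart_dom c' p -> W (c p) -> c' p = g (c p)].

Lemma smooth_extension_chart_change c c' q g : is_chart H c ->
  smooth_extension (overlap c c') (transition c c') (c q) g ->
  exists W, chart_change c c' q g W.
Proof.
move=> [_ _ _ cK _] [W [oW gC gE]]; exists W; split=> // p cp c'p Wp.
by rewrite gE ?/transition/= ?cK//; split=> //; exists p.
Qed.

Lemma chart_changeP c c' q : is_chart H c ->
  smooth_on (overlap c c') (transition c c') -> chart_dom c q -> chart_dom c' q ->
  exists g W, chart_change c c' q g W.
Proof.
move=> cH sm cq c'q; have [|g gE] := sm (c q); first by exists q.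
by exists g; exact: (smooth_extension_chart_change cH).
Qed.

(** The extension that defines [dchart] is itself a [chart_change], so that the chain
rule applies to it, at boundary points as well. *)
Lemma dchart_chart_change c q : is_chart H (chart_at A q) ->
  smooth_on (overlap (chart_at A q) c) (transition (chart_at A q) c) ->
  chart_dom (chart_at A q) q -> chart_dom c q ->
  exists g W, chart_change (chart_at A q) c q g W /\
    dchart A c q = 'd g (chart_at A q q).
Proof.
move=> cH sm cq c'q; rewrite /dchart /diff_on.
set S := smooth_extension _ _ _.
have [W gW] := smooth_extension_chart_change cH (getPex (sm _ (ex_intro2 _ _ q (conj cq c'q) erefl)) : S (get S)).
by exists (get S), W.
Qed.

Lemma chart_continuous c q : is_chart H c -> chart_dom c q -> {for q, continuous c}.
Proof.
move=> [od cc _ _ _] cq; move: cc; rewrite continuous_open_subspace//.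
by apply; rewrite inE.
Qed.

Lemma chart_near c q : is_chart H c -> chart_dom c q -> nbhs q (chart_dom c).
Proof. by move=> [od _ _ _ _] cq; apply: open_nbhs_nbhs. Qed.

Lemma chart_change_near c c' q g W : is_chart H c -> is_chart H c' ->
  chart_dom c q -> chart_dom c' q -> chart_change c c' q g W ->
  \forall p \near q, [/\ chart_dom c p, chart_dom c' p, W (c p) & c' p = g (c p)].
Proof.
move=> cH c'H cq c'q [W0 _ gE].
have h := chart_continuous cH cq (open_nbhs_nbhs W0).
near=> p.
have cp : chart_dom c p by near: p; exact: (chart_near cH cq).
have c'p : chart_dom c' p by near: p; exact: (chart_near c'H c'q).
have Wp : W (c p) by near: p; exact: h.
by split=> //; exact: gE.
Unshelve. all: by end_near. Qed.

(** The chain rule for c' = g o c along the curve. *)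
Lemma chart_change_derive c c' sigma t g W : is_chart H c -> is_chart H c' ->
  chart_dom c (sigma t) -> chart_dom c' (sigma t) ->
  {for t, continuous sigma} -> derivable (c \o sigma) t 1 ->
  chart_change c c' (sigma t) g W ->
  is_derive t (1 : R) (c' \o sigma) ('d g (c (sigma t)) ((c \o sigma)^`()%classic t)).
Proof.
move=> cH c'H ct c't sc dc gW; have [[oW W0] gC _] := gW.
have dg : differentiable g (c (sigma t)) by exact: (gC 1%N).1.
have dcs : differentiable (c \o sigma) t by exact/derivable1_diffP.
have dgc : differentiable (g \o (c \o sigma)) t by exact: differentiable_comp.
have dG : is_derive t (1 : R) (g \o (c \o sigma)) ('d g (c (sigma t)) ((c \o sigma)^`()%classic t)).
  apply: DeriveDef; first exact: diff_derivable.
  rewrite deriveE// (diff_comp dcs dg) /=; congr ('d _ _ _).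
  by rewrite derive1E'.
apply: near_eq_is_derive dG.
have h : \forall s \near t, c' (sigma s) = g (c (sigma s)).
  have h := chart_change_near cH c'H ct c't gW.
  have h' : \forall p \near sigma t, c' p = g (c p) by apply: filterS h => p [].
  exact: (sc _ h').
by apply: filterS h => s /= ->.
Qed.

End chart_calculus.

(** * Absolutely continuous curves in a manifold *)

Section derivative_of_pairs.
Context {R : realType}.
Implicit Types (U V : normedModType R).

Lemma is_derive_pair U V (f : R -> U) (g : R -> V) (t : R) df dg :
  is_derive t (1 : R) f df -> is_derive t (1 : R) g dg ->
  is_derive t (1 : R) (fun s => (f s, g s)) (df, dg).
Proof.
move=> hf hg; have dff : differentiable f t by apply/derivable1_diffP; case: hf.
have dgg : differentiable g t by apply/derivable1_diffP; case: hg.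
have dp : differentiable (fun s => (f s, g s)) t by exact: differentiable_pair.
apply: DeriveDef; first exact: diff_derivable.
by rewrite deriveE// diff_pair//= -!deriveE// !derive_val.
Qed.

Lemma is_derive_linear U V (L : {linear U -> V}) (f : R -> U) (t : R) df :
  continuous L -> is_derive t (1 : R) f df -> is_derive t (1 : R) (L \o f) (L df).
Proof.
move=> cL hf; have dff : differentiable f t by apply/derivable1_diffP; case: hf.
have dL : differentiable L (f t) by exact: linear_differentiable.
have dLf : differentiable (L \o f) t by exact: differentiable_comp.
apply: DeriveDef; first exact: diff_derivable.
by rewrite deriveE// (diff_comp dff dL) /= diff_lin// -deriveE// derive_val.
Qed.

Lemma is_derive_fst U V (f : R -> U * V) (t : R) df :
  is_derive t (1 : R) f df -> is_derive t (1 : R) (fun s => (f s).1) df.1.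
Proof. by apply: (@is_derive_linear _ _ fst) => x; exact: cvg_fst. Qed.

Lemma is_derive_snd U V (f : R -> U * V) (t : R) df :
  is_derive t (1 : R) f df -> is_derive t (1 : R) (fun s => (f s).2) df.2.
Proof. by apply: (@is_derive_linear _ _ snd) => x; exact: cvg_snd. Qed.

Lemma is_derive_coord m (f : R -> 'rV[R]_m) (t : R) df i :
  is_derive t (1 : R) f df -> is_derive t (1 : R) (fun s => f s 0 i) (df 0 i).
Proof.
move=> [h <-]; apply: DeriveDef; first by move/derivable_mxP: h => /(_ 0 i).
by rewrite derive_mx// mxE.
Qed.

Notation mu := (@lebesgue_measure R).

Instance ae_lebesgue_filter : Filter (nbhs (almost_everywhere mu)).
Proof. exact: (ae_filter_ringOfSetsType mu). Qed.

(** Reduction to the coordinates: finitely many null sets have a null union. *)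
Lemma abs_continuous_ae_derivable_vector m (a b : R) (f : R -> 'rV[R]_m * R) : a <= b ->
  abs_continuous a b f -> {ae mu, forall x, a < x -> x < b -> derivable f x 1}.
Proof.
move=> ab acf.
have ac2 : abs_continuous a b (fun t => (f t).2).
  apply: (abs_continuous_dominated ltr01) acf => x y _ _ _.
  by rewrite mul1r; exact: (pair_norm_le2 (f y - f x)).
have ac1 (i : 'I_m) : abs_continuous a b (fun t => (f t).1 0 i).
  apply: (abs_continuous_dominated ltr01) acf => x y _ _ _.
  rewrite mul1r; apply: le_trans (pair_norm_le1 (f y - f x)).
  by apply: le_trans (row_coord_le _ i); rewrite !mxE.
have [h2 [_ _ d2]] := abs_continuous_ae_derivable ab ac2.
have d1 : {ae mu, forall x, forall i : 'I_m, a < x -> x < b -> derivable (fun t => (f t).1 0 i) x 1}.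
  apply: filter_forall => i.
  have [h [_ _]] := abs_continuous_ae_derivable ab (ac1 i).
  by apply: filterS => x hx ax xb; have [] := hx ax xb.
apply: filterS2 d1 d2 => x d1 d2 ax xb.
have e1 : derivable (fun t => (f t).1) x 1.
  by apply/derivable_mxP => i j; rewrite ord1; exact: d1.
have [e2 _] := d2 ax xb.
have [] := is_derive_pair (derivableP e1) (derivableP e2).
by under eq_fun do rewrite -surjective_pairing.
Qed.

End derivative_of_pairs.

Section curves_in_manifolds.
Context {R : realType} {m : nat} {T : topologicalType}.
Notation E := ('rV[R]_m * R)%type.
Variables (H : set E) (A : atlas T E).
Hypothesis smA : smooth_atlas H A.
Implicit Types (c : chart T E) (q : T) (sigma : R -> T).
Notation mu := (@lebesgue_measure R).

Let fmu : Filter (nbhs (almost_everywhere mu)) := ae_lebesgue_filter.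

Let chartA c : charts A c -> is_chart H c.
Proof. by have [h _ _] := smA; exact: h. Qed.

Lemma charts_coordinate c : charts A c -> coordinate_chart H A c.
Proof. by have [h1 h2 _] := smA => Ac; split=> [|c' Ac']; [exact: h1|exact: h2]. Qed.

Lemma chart_atP q : charts A (chart_at A q) /\ chart_dom (chart_at A q) q.
Proof. by have [_ _] := smA. Qed.

Lemma coordinate_smooth c c' : coordinate_chart H A c -> charts A c' ->
  smooth_on (overlap c' c) (transition c' c) /\ smooth_on (overlap c c') (transition c c').
Proof. by move=> [_ h] /h[]. Qed.

(** Changes of charts are of class C^1, hence locally Lipschitz. *)
Lemma abs_continuous_chart_change c c' a b sigma t : charts A c ->
  coordinate_chart H A c' -> {within `[a, b], continuous sigma} ->
  a <= t -> t <= b -> chart_dom c (sigma t) -> chart_dom c' (sigma t) ->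
  exists2 r : R, 0 < r & forall u v, a <= u -> v <= b ->
    t - r < u -> v < t + r -> abs_continuous u v (c \o sigma) ->
    abs_continuous u v (c' \o sigma).
Proof.
move=> Ac Ac' cs a_t tb ct c't; have cH := chartA Ac; have c'H := Ac'.1.
have [g [W gW]] := chart_changeP cH (coordinate_smooth Ac' Ac).1 ct c't.
have [W0 gC _] := gW; have [K [r0 [K0 r00 gL]]] := class_C1_lipschitz W0 (gC 1%N).
have near1 := chart_change_near cH c'H ct c't gW.
have near2 : nbhs (sigma t) [set p | ball (c (sigma t)) r0 (c p)].
  by have := chart_continuous cH ct; apply; exact: nbhsx_ballx.
have [r rp rP] := within_itv_near cs a_t tb (filterI near1 near2).
exists r => // u v au vb tu vt; apply: (abs_continuous_dominated K0) => x y ux xy yv.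
have [] := rP x; [lra|lra|lra|lra|]; move=> [_ _ _ xE] xb.
have [] := rP y; [lra|lra|lra|lra|]; move=> [_ _ _ yE] yb.
by rewrite /= xE yE; exact: gL.
Qed.

(** Absolute continuity may be tested in one chart around each point, because of
[abs_continuous_chart_change]; the pieces are glued by real induction. *)
Lemma abs_continuous_curve_local a b sigma :
  {within `[a, b], continuous sigma} ->
  (forall t, a <= t -> t <= b -> exists c, [/\ charts A c, chart_dom c (sigma t) &
     exists2 r : R, 0 < r & forall u v, a <= u -> u <= v -> v <= b ->
       t - r < u -> v < t + r -> abs_continuous u v (c \o sigma)]) ->
  abs_continuous_curve H A a b sigma.
Proof.
move=> cs loc; split=> // c Ac u v au uv vb dom_c.
apply: (cousin (Q := fun x y => abs_continuous x y (c \o sigma)) uv) => [x y z _ xy yz _|t ut tv]; first exact: abs_continuous_cat.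
have a_t : a <= t by exact: le_trans ut.
have tb : t <= b by exact: le_trans vb.
have [c0 [Ac0 c0t [r r0 rP]]] := loc t a_t tb.
have ct : chart_dom c (sigma t) by apply: dom_c; rewrite in_itv/= ut tv.
have [r' r'0 r'P] := abs_continuous_chart_change Ac0 Ac cs a_t tb c0t ct.
exists (Num.min r r'); first by rewrite lt_min r0.
move=> x y ux xt ty yv; rewrite ltrBlDr -ltrBlDl lt_min -ltrBlDl => /andP[x1 x2].
rewrite lt_min => /andP[y1 y2].
by apply: r'P; [lra|lra|lra|lra|apply: rP; lra].
Qed.

Lemma abs_continuous_curve_chart a b sigma c t : charts A c ->
  abs_continuous_curve H A a b sigma -> a <= t -> t <= b -> chart_dom c (sigma t) ->
  exists2 r : R, 0 < r & forall u v, a <= u -> u <= v -> v <= b -> t - r < u -> v < t + r ->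
    (forall s, u <= s -> s <= v -> chart_dom c (sigma s)) /\
    abs_continuous u v (c \o sigma).
Proof.
move=> Ac [cs acs] a_t tb ct.
have [r r0 rP] := within_itv_near cs a_t tb (chart_near (chartA Ac) ct).
exists r => // u v au uv vb tu vt.
have dom_c s : u <= s -> s <= v -> chart_dom c (sigma s) by move=> us sv; apply: rP; lra.
split=> //; apply: acs => //; first exact: charts_coordinate.
by move=> s; rewrite in_itv/= => /andP[]; exact: dom_c.
Qed.

(** The chart in which the velocity is computed changes with the point, but around
each time a single chart gives almost everywhere differentiability in all the
others, and real induction glues the null sets. *)
Lemma ae_derivable_chart_at a b sigma : a <= b ->
  abs_continuous_curve H A a b sigma ->
  {ae mu, forall t, a < t -> t < b -> derivable (chart_at A (sigma t) \o sigma) t 1}.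
Proof.
move=> ab acs; pose Q u v := {ae mu, forall t, u < t -> t < v ->
  derivable (chart_at A (sigma t) \o sigma) t 1}.
apply: (cousin (Q := Q) ab) => [x y z _ xy yz _ Q1 Q2|t a_t tb].
  have Q3 : {ae mu, forall t, t != y}.
    exists [set y]; split; [exact: measurable_set1|exact: lebesgue_measure_set1|].
    by move=> t /= /negP; rewrite negbK => /eqP.
  rewrite /Q in Q1 Q2 *; apply: (@filterS3 _ _ fmu _ _ _ _ _ Q1 Q2 Q3) => t {}Q1 {}Q2 ty xt tz.
  by have [/Q1|/Q2|te] := ltgtP t y; [exact|exact|rewrite te eqxx in ty].
have [Ac ct] := chart_atP (sigma t); set c := chart_at A (sigma t) in Ac ct *.
have [r r0 rP] := abs_continuous_curve_chart Ac acs a_t tb ct.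
exists r => // u v au ut tv vb tu vt.
have [dom_c acc] := rP u v au (le_trans ut tv) vb tu vt.
apply: (@filterS _ _ fmu _ _ _ (abs_continuous_ae_derivable_vector (le_trans ut tv) acc)) => s h us sv.
have ds := h us sv; have [Acs cs] := chart_atP (sigma s).
have ccs : chart_dom c (sigma s) by apply: dom_c; exact: ltW.
have [g [W gW]] := chart_changeP (chartA Ac) (coordinate_smooth (charts_coordinate Acs) Ac).1 ccs cs.
have scont : {for s, continuous sigma}.
  by apply: (within_itv_continuous acs.1); lra.
by have [] := chart_change_derive (chartA Ac) (chartA Acs) ccs cs scont ds gW.
Qed.

(** The tangent vector represented by [velocity] in the chart [chart_at] is sent by
[dchart] to the derivative of the curve in the chart c. *)
Lemma dchart_velocity c sigma t : coordinate_chart H A c -> chart_dom c (sigma t) ->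
  {for t, continuous sigma} -> derivable (chart_at A (sigma t) \o sigma) t 1 ->
  is_derive t (1 : R) (c \o sigma) (dchart A c (sigma t) (velocity A sigma t)).
Proof.
move=> Ac ct sc ds; have [Ac' c't] := chart_atP (sigma t).
have [g [W [gW ->]]] := dchart_chart_change (chartA Ac') (coordinate_smooth Ac Ac').1 c't ct.
have h := chart_change_derive (chartA Ac') Ac.1 c't ct sc ds gW.
exact: h.
Qed.

End curves_in_manifolds.

(** * Lengths of curves and the induced distance *)

Section derive1_facts.
Context {R : realType} {V : normedModType R}.
Implicit Types (f g : R -> V) (t x : R).

Lemma near_eq_derive1 f g t :
  (\forall s \near t, f s = g s) -> f^`()%classic t = g^`()%classic t.
Proof. by move=> fg; rewrite !derive1E; exact: near_eq_derive. Qed.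

(** The value of the derivative where there is none; it makes the speed commute with
reparametrizations at every time, and not only almost everywhere. *)
Lemma derive1_not_derivable f t : ~ derivable f t 1 -> f^`()%classic t = point.
Proof. by move=> ndf; rewrite derive1E; exact: dvgP. Qed.

Lemma isometric_affine_inverse phi : isometric_affine phi ->
  exists e : R, `|e| = 1 /\ exists2 psi : R -> R, cancel phi psi /\ cancel psi phi &
    (forall t, is_derive t (1 : R) phi e) /\ (forall t, is_derive t (1 : R) psi e).
Proof.
move=> [c [->|->]].
  exists 1; split; first exact: normr1.
  exists (fun x => x - c); first by split=> x; lra.
  split=> t.
    by rewrite -[1 in X in is_derive _ _ _ X]add0r; exact: is_deriveD.
  by rewrite -[1 in X in is_derive _ _ _ X]subr0; exact: is_deriveB.
exists (- 1); split; first by rewrite normrN1.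
exists (fun x => c - x); first by split=> x; lra.
by split=> t; rewrite -[- 1]add0r; exact: is_deriveB.
Qed.

Lemma is_derive_comp_real f (phi : R -> R) (e t : R) : is_derive t (1 : R) phi e ->
  derivable f (phi t) 1 -> is_derive t (1 : R) (f \o phi) (e *: f^`()%classic (phi t)).
Proof.
move=> hphi df; have dphi : differentiable phi t by apply/derivable1_diffP; case: hphi.
have ddf : differentiable f (phi t) by exact/derivable1_diffP.
apply: DeriveDef; first by apply: diff_derivable; exact: differentiable_comp.
rewrite deriveE; last exact: differentiable_comp.
rewrite diff_comp//= -(deriveE _ dphi) derive_val derive1E'//.
by rewrite -[e in LHS]mulr1 linearZ.
Qed.

Lemma derive1_isometric phi f t : isometric_affine phi ->
  exists2 e : R, `|e| = 1 & (f \o phi)^`()%classic t = e *: f^`()%classic (phi t).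
Proof.
move=> /isometric_affine_inverse[e [e1 [psi [phiK psiK] [dphi dpsi]]]].
have [df|ndf] := pselect (derivable f (phi t) 1).
  by exists e => //; rewrite derive1E (@derive_val _ _ _ _ _ _ _ (is_derive_comp_real (dphi t) df)).
(* neither function is derivable, and both derivatives have the default value *)
exists 1; rewrite ?normr1// scale1r !derive1_not_derivable// => dfp; apply: ndf.
have -> : f = (f \o phi) \o psi by apply/funext => x /=; rewrite psiK.
have dfp' : derivable (f \o phi) (psi (phi t)) 1 by rewrite phiK.
by have [] := is_derive_comp_real (dpsi (phi t)) dfp'.
Qed.

End derive1_facts.

Section lengths_of_curves.
Context {R : realType} {E : normedModType R} {T : topologicalType}.
Variables (H : set E) (eucl : E -> R) (A : atlas T E) (nrm : T -> E -> R).
Hypothesis smA : smooth_atlas H A.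
Hypothesis pm : pseudo_metric H eucl A nrm.
Hypothesis si : strongly_integrable H A nrm.
Implicit Types (c : chart T E) (p q : T) (sigma tau : R -> T) (a b : R).
Notation mu := (@lebesgue_measure R).
Notation cmu := (@completed_lebesgue_measure R).
Notation AC := (abs_continuous_curve H A).
Notation speed := (speed A nrm).
Notation dist := (induced_distance H A nrm).

Definition curve_length a b sigma :=
  \int[cmu]_(t in `[a, b]) speed sigma t.

Lemma speed_ge0 sigma t : 0 <= speed sigma t.
Proof. exact: (pseudo_metric_ge0 pm). Qed.

Lemma curve_length_ge0 a b sigma : 0 <= curve_length a b sigma.
Proof. by apply: Rintegral_ge0 => t _; exact: speed_ge0. Qed.

Lemma abs_continuous_curveS a b u v sigma : a <= u -> v <= b -> AC a b sigma -> AC u v sigma.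
Proof.
move=> au vb [cs acs]; split; first exact: within_itvS cs.
by move=> c Ac x y ux xy yv; apply: acs => //; [exact: le_trans ux|exact: le_trans vb].
Qed.

Lemma curve_length_cat a b (c : R) sigma : a <= b -> b <= c -> AC a c sigma ->
  curve_length a c sigma = curve_length a b sigma + curve_length b c sigma.
Proof.
move=> ab bc acs; apply: completed_Rintegral_cat => //.
exact: (si (le_trans ab bc) acs).
Qed.

Lemma curve_length_le a b sigma tau k : a <= b -> AC a b sigma -> AC a b tau ->
  {ae mu, forall t, a < t -> t < b -> speed tau t <= k * speed sigma t} -> 0 <= k ->
  curve_length a b tau <= k * curve_length a b sigma.
Proof.
move=> ab acs act st k0; have [i1 <-] := completed_RintegralZ k (si ab acs).
apply: completed_Rintegral_le st; [| |exact: si|exact: i1].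
  by move=> t; exact: speed_ge0.
by move=> t; rewrite mulr_ge0// speed_ge0.
Qed.

Lemma curve_length_bounded a b sigma k : a <= b -> AC a b sigma -> 0 <= k ->
  {ae mu, forall t, a < t -> t < b -> speed sigma t <= k} ->
  curve_length a b sigma <= k * (b - a).
Proof.
move=> ab acs k0 sk; have [i1 <-] := completed_cst k ab.
by apply: completed_Rintegral_le sk => //; [move=> t; exact: speed_ge0|exact: si].
Qed.

Lemma speed_near sigma tau t : (\forall s \near t, sigma s = tau s) -> speed sigma t = speed tau t.
Proof.
move=> st; have stt : sigma t = tau t := nbhs_singleton st.
rewrite /Defs.speed /velocity stt; congr (nrm _ _); apply: near_eq_derive1.
by apply: filterS st => s /= ->.
Qed.

(** The speeds of sigma and tau agree inside ]a, b[; the end points are negligible. *)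
Lemma curve_length_eq a b sigma tau : a <= b -> AC a b sigma ->
  (forall t, a <= t -> t <= b -> sigma t = tau t) ->
  AC a b tau /\ curve_length a b tau = curve_length a b sigma.
Proof.
move=> ab acs st.
have act : AC a b tau.
  have [cs acsc] := acs; split.
    apply/subspace_continuousP => x /=; rewrite in_itv/= => /andP[ax xb] U.
    rewrite -[from_subspace _ _ x]/(tau x) -(st x ax xb) => Us; have [r r0 rU] := within_itv_near cs ax xb Us.
    apply/nbhs_ballP; exists r => //= y; rewrite /ball/= ltr_norml => /andP[y1 y2].
    by rewrite in_itv/= => /andP[ay yb]; rewrite /from_subspace -st//; apply: rU => //; lra.
  move=> c Ac u v au uv vb dc.
  apply: (@abs_continuous_dominated _ _ _ 1 _ _ (c \o sigma)) => //.
    move=> x y ux xy yv; rewrite mul1r /= !st//; lra.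
  apply: acsc => // t; rewrite in_itv/= => /andP[ut tv].
  by rewrite st; [apply: dc; rewrite in_itv/= ut tv|lra|lra].
have sp t : a < t -> t < b -> speed sigma t = speed tau t.
  move=> at_ tb; apply: speed_near.
  have : nbhs t `]a, b[%classic.
    by apply: open_nbhs_nbhs; split; [exact: itv_open|rewrite /= in_itv/= at_ tb].
  by apply: filterS => s /=; rewrite in_itv/= => /andP[as_ sb]; apply: st; exact: ltW.
split; first exact: act.
have le x y : AC a b x -> AC a b y -> (forall t, a < t -> t < b -> speed x t = speed y t) ->
    curve_length a b x <= curve_length a b y.
  move=> acx acy xy; rewrite -[leRHS]mul1r.
  apply: (curve_length_le ab acy acx); last exact: ler01.
  by apply: aeW => t a_t tb; rewrite mul1r (xy _ a_t tb).
by apply/eqP; rewrite eq_le; apply/andP; split; apply: le => // t ? ?; rewrite sp.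
Qed.

Lemma speed_isometric phi sigma t : isometric_affine phi ->
  speed (sigma \o phi) t = speed sigma (phi t).
Proof.
move=> iphi; rewrite /Defs.speed /velocity.
have [e e1 h] := derive1_isometric (chart_at A (sigma (phi t)) \o sigma) t iphi.
have -> : (chart_at A ((sigma \o phi) t) \o (sigma \o phi))^`()%classic t =
  e *: (chart_at A (sigma (phi t)) \o sigma)^`()%classic (phi t) by exact: h.
by rewrite (pseudo_metricZ pm) e1 mul1r.
Qed.

Lemma abs_continuous_curve_isometric a b u v sigma phi : isometric_affine phi ->
  `[u, v]%classic = phi @^-1` `[a, b] -> AC a b sigma -> AC u v (sigma \o phi).
Proof.
move=> iphi uvE [cs acs].
have phiab x : u <= x -> x <= v -> a <= phi x /\ phi x <= b.
  move=> ux xv; have : `[u, v]%classic x by rewrite /= in_itv/= ux xv.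
  by rewrite uvE /= in_itv/= => /andP[].
split.
  apply/subspace_continuousP => x /=; rewrite in_itv/= => /andP[ux xv].
  have [ax xb] := phiab x ux xv.
  move=> U Us; have [r r0 rU] := within_itv_near cs ax xb (Us : nbhs (sigma (phi x)) U).
  have h : \forall y \near x, ball (phi x) r (phi y).
    exact: isometric_affine_continuous iphi _ _ (nbhsx_ballx (phi x) r r0).
  apply: filterS h => y py /= ; rewrite in_itv/= => /andP[uy yv].
  have [ay yb] := phiab y uy yv; move: py; rewrite /ball/= ltr_norml => /andP[y1 y2].
  by apply: rU => //; lra.
move=> c Ac x y ux xy yv dc; have [ax xb] := phiab x ux (le_trans xy yv).
have [ay yb] := phiab y (le_trans ux xy) yv.
have [k [phiE|phiE]] := iphi.
  have h : abs_continuous (phi x) (phi y) (c \o sigma).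
    apply: acs => //; first by rewrite phiE lerD2l.
    move=> t; rewrite in_itv/= phiE => /andP[xt ty].
    have := dc (t - k); rewrite /= phiE subrKC; apply; rewrite in_itv/=.
    by apply/andP; split; lra.
  apply: (abs_continuous_monotone_comp _ _ _ _ h); rewrite ?phiE//.
    by move=> s t st; rewrite lerD2l.
  by move=> s t st; lra.
have h : abs_continuous (phi y) (phi x) (c \o sigma).
  apply: acs => //; first by rewrite phiE lerB.
  move=> t; rewrite in_itv/= phiE => /andP[xt ty].
  have := dc (k - t); rewrite /= phiE opprB subrKC; apply; rewrite in_itv/=.
  by apply/andP; split; lra.
have := @abs_continuous_reflect _ _ k x y (c \o sigma); rewrite phiE in h *.
exact.
Qed.

Lemma curve_length_isometric a b u v sigma phi : isometric_affine phi -> a <= b ->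
  `[u, v]%classic = phi @^-1` `[a, b] -> AC a b sigma ->
  curve_length u v (sigma \o phi) = curve_length a b sigma.
Proof.
move=> iphi ab uvE acs; rewrite /curve_length uvE.
under eq_Rintegral do rewrite (speed_isometric _ _ iphi).
apply: isometric_affine_integral => //.
- by apply: completed_measurable; exact: measurable_itv.
- by move=> t; exact: speed_ge0.
- by have /integrableP[/measurable_EFinP] := si ab acs.
Qed.

(** The set of lengths of the curves from p to q; the induced distance is its infimum. *)
Definition joined p q l :=
  exists a b sigma, [/\ a <= b, AC a b sigma, sigma a = p, sigma b = q &
    l = curve_length a b sigma].

Lemma joined_curve a b sigma : a <= b -> AC a b sigma ->
  joined (sigma a) (sigma b) (curve_length a b sigma).
Proof. by move=> ab acs; exists a, b, sigma; split. Qed.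

Lemma distE p q : dist p q = inf (joined p q).
Proof. by []. Qed.

Lemma joined_ge0 p q l : joined p q l -> 0 <= l.
Proof. by move=> [a [b [s [_ _ _ _ ->]]]]; exact: curve_length_ge0. Qed.

Lemma joined_refl p : joined p p 0.
Proof.
have acp : AC 0 0 (cst p).
  split; first by apply: continuous_subspaceT; exact: cst_continuous.
  move=> c Ac u v _ _ _ _; apply: (@abs_continuous_lipschitz _ _ 1); first exact: ltr01.
  by move=> x y _ xy _; rewrite subrr normr0 mul1r subr_ge0.
exists 0, 0, (cst p); split; [exact: lexx|exact: acp|by []|by []|].
apply/eqP; rewrite eq_le curve_length_ge0 /= -{3}(mul0r (0 - 0 : R)).
apply: (curve_length_bounded (lexx 0) acp (lexx 0)).
by apply: aeW => t t0 /(lt_trans t0); rewrite ltxx.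
Qed.

Lemma joined_sym p q l : joined p q l -> joined q p l.
Proof.
move=> [a [b [s [ab acs sa sb ->]]]]; pose phi (x : R) := a + b - x.
have iphi : isometric_affine phi by exists (a + b); right.
have E0 : `[a, b]%classic = phi @^-1` `[a, b].
  by apply/seteqP; split=> x /=; rewrite !in_itv/= /phi => /andP[? ?]; apply/andP; split; lra.
exists a, b, (s \o phi); split.
- exact: ab.
- exact: (abs_continuous_curve_isometric iphi E0 acs).
- by rewrite /= /phi addrC addKr.
- by rewrite /= /phi addrK.
- by rewrite (curve_length_isometric iphi ab E0 acs).
Qed.

(** The second curve is shifted to start where the first one ends. *)
Lemma joined_trans p q r l1 l2 : joined p q l1 -> joined q r l2 -> joined p r (l1 + l2).
Proof.
move=> [a [b [s [ab acs sa sb ->]]]] [b' [c [t [bc act ta tb ->]]]].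
pose phi (x : R) := (b' - b) + x; pose d := c - b' + b.
have iphi : isometric_affine phi by exists (b' - b); left.
have bd : b <= d by rewrite /d; lra.
have E0 : `[b, d]%classic = phi @^-1` `[b', c].
  by apply/seteqP; split=> x /=; rewrite !in_itv/= /phi /d => /andP[? ?]; apply/andP; split; lra.
have act' := abs_continuous_curve_isometric iphi E0 act.
have lt' := curve_length_isometric iphi bc E0 act.
pose w x := if x <= b then s x else (t \o phi) x.
have tb' : t (phi b) = s b by rewrite /phi addrNK ta.
have w1 x : a <= x -> x <= b -> s x = w x by rewrite /w => _ ->.
have w2 x : b <= x -> x <= d -> (t \o phi) x = w x.
  rewrite /w => bx _; case: ifPn => [xb|_]; last by [].
  have -> : x = b by apply/eqP; rewrite eq_le xb.
  exact: tb'.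
have [acw1 lw1] := curve_length_eq ab acs w1.
have [acw2 lw2] := curve_length_eq bd act' w2.
have acw : AC a d w.
  split.
    rewrite (_ : `[a, d]%classic = `[a, b] `|` `[b, d]).
      by apply: withinU_continuous; [exact: itv_closed|exact: itv_closed|case: acw1|case: acw2].
    apply/seteqP; split=> x /=; rewrite !in_itv/=.
      by move=> /andP[ax xd]; have [xb|bx] := leP x b; [left; rewrite ax|right; rewrite ltW].
    move=> [/andP[ax xb]|/andP[bx xd]]; first by rewrite ax (le_trans xb).
    by rewrite xd (le_trans ab bx).
  move=> c0 Ac u v au uv vd dc.
  have [vb|bv] := leP v b; first exact: (acw1.2).
  have [bu|ub] := leP b u; first exact: (acw2.2).
  apply: (@abs_continuous_cat _ _ u b v); [exact: ltW|exact: ltW| |].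
    apply: (acw1.2 c0 Ac u b au (ltW ub) (lexx b)).
    move=> x; rewrite in_itv/= => /andP[ux xb]; apply: dc; rewrite in_itv/= ux.
    exact: le_trans xb (ltW bv).
  apply: (acw2.2 c0 Ac b v (lexx b) (ltW bv) vd).
  move=> x; rewrite in_itv/= => /andP[bx xv]; apply: dc; rewrite in_itv/= xv andbT.
  exact: le_trans (ltW ub) bx.
exists a, d, w; split; [exact: le_trans bd|exact: acw| | |].
- by rewrite -(w1 a (lexx a) ab).
- have phid : phi d = c by rewrite /phi /d; ring.
  by rewrite -(w2 d bd (lexx d)) /= phid.
- by rewrite (curve_length_cat ab bd acw) lw1 lw2 lt'.
Qed.

Lemma dist_ge0 p q : 0 <= dist p q.
Proof.
rewrite distE; have [->|/set0P ne] := eqVneq (joined p q) set0; first by rewrite inf0.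
by apply: lb_le_inf => // l /joined_ge0.
Qed.

Lemma dist_le p q l : joined p q l -> dist p q <= l.
Proof.
by move=> h; rewrite distE; apply: ge_inf => //; exists 0 => ? /joined_ge0.
Qed.

Lemma dist_symmetric p q : dist p q = dist q p.
Proof.
by rewrite !distE; congr inf; apply/seteqP; split=> l; exact: joined_sym.
Qed.

Lemma dist_self p : dist p p = 0.
Proof. by apply/eqP; rewrite eq_le dist_ge0 andbT; exact/dist_le/joined_refl. Qed.

Hypothesis conn : forall p q, joined p q !=set0.

Lemma dist_approx p q (e : R) : 0 < e -> exists2 l, joined p q l & l < dist p q + e.
Proof.
move=> e0; have hi : has_inf (joined p q).
  by split; [exact: conn|exists 0 => ? /joined_ge0].
by have [l jl le] := inf_adherent e0 hi; exists l.
Qed.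

Lemma dist_triangular q p r : dist p r <= dist p q + dist q r.
Proof.
apply/ler_addgt0Pr => e e0; have e20 : 0 < e / 2 by rewrite divr_gt0.
have [l1 j1 h1] := dist_approx p q e20; have [l2 j2 h2] := dist_approx q r e20.
by apply: (le_trans (dist_le (joined_trans j1 j2))); lra.
Qed.

Lemma dist_le_curve a b sigma u v : a <= u -> u <= v -> v <= b -> AC a b sigma ->
  dist (sigma u) (sigma v) <= curve_length u v sigma.
Proof.
move=> au uv vb acs; apply: dist_le; apply: joined_curve uv _.
exact: (abs_continuous_curveS au vb acs).
Qed.

(** The point z is found on an almost shortest curve from p to q by the intermediate
value theorem for the distance to p. *)
Lemma dist_intermediate p q (r e : R) : (forall p, continuous (dist p)) ->
  0 <= r -> r <= dist p q -> 0 < e ->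
  exists z, dist p z = r /\ dist z q <= dist p q - r + e.
Proof.
move=> cd r0 rd e0; have [l [a [b [s [ab acs sa sb ->]]]] lt_l] := dist_approx p q e0.
have cds : {within `[a, b], continuous (dist p \o s)}.
  apply/subspace_continuousP => x xab.
  have /subspace_continuousP/(_ x xab) h := acs.1.
  exact: (cvg_comp _ _ h (cd p (s x))).
have [|c] := @IVT _ (dist p \o s) a b r ab cds.
  by rewrite /= sa sb dist_self ge_min r0/= le_max rd orbT.
rewrite in_itv/= => /andP[ac cb] cr; exists (s c); split; first exact: cr.
have h1 := dist_le_curve (lexx a) ac cb acs.
have h2 := dist_le_curve ac cb (lexx b) acs.
rewrite sa in h1; rewrite sb in h2; rewrite (curve_length_cat ac cb acs) in lt_l.
by rewrite /= in cr; lra.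
Qed.

End lengths_of_curves.

(** * The product atlas of the cylinder *)

Section cylinder_manifold.
Context {R : realType} {m : nat} {M : topologicalType}.
Notation E := 'rV[R]_m.
Notation N := (cylinder R M).
Variable A : atlas M E.
Hypothesis smA : smooth_atlas setT A.
Implicit Types (c : chart M E) (p : M) (t : unit_itv R) (q : N).

Lemma unit_itv_gt0 t : 0 < \val t.
Proof. by have := set_valP t; rewrite /= in_itv/= => /andP[]. Qed.

Lemma unit_itv_le1 t : \val t <= 1.
Proof. by have := set_valP t; rewrite /= in_itv/= => /andP[]. Qed.

Lemma insubd_unit_itv (x : R) : 0 < x -> x <= 1 -> \val (insubd (unit_itv1 : unit_itv R) x) = x.
Proof.
move=> x0 x1; rewrite val_insubd ifT//; apply/mem_set.
by rewrite /= in_itv/= x0.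
Qed.

Lemma unit_itv_val_continuous : continuous (fun t : unit_itv R => \val t : R).
Proof. exact: initial_continuous. Qed.

(** The topology of the interval is induced by the embedding in the line. *)
Lemma cvg_unit_itv (X : Type) (F : set_system X) (FF : Filter F) (g : X -> unit_itv R) t :
  (fun x => \val (g x) : R) @ F --> (\val t : R) -> g @ F --> t.
Proof.
move=> gt U; rewrite nbhsE => -[B [[B' oB' <-] Bt] BU].
have h : nbhs (\val t : R) B' by apply: open_nbhs_nbhs.
by apply: (@filterS _ F FF _ _ _ (gt _ h)) => x B'x; exact: BU.
Qed.

Lemma cylinder_fst_continuous : continuous (fun q : N => q.1).
Proof. by move=> q; exact: cvg_fst. Qed.

Lemma cylinder_snd_continuous : continuous (fun q : N => q.2).
Proof. by move=> q; exact: cvg_snd. Qed.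

Lemma cvg_cylinder (X : Type) (F : set_system X) (FF : Filter F) (g : X -> N) q :
  (fun x => (g x).1) @ F --> q.1 -> (fun x => \val (g x).2 : R) @ F --> (\val q.2 : R) ->
  g @ F --> q.
Proof.
move=> g1 g2 U [[U1 U2] [/= hU1 hU2] U12].
apply: (@filterS2 _ F FF _ _ _ _ (g1 U1 hU1) (cvg_unit_itv FF g2 hU2)) => x h1 h2.
exact: (U12 (g x) (conj h1 h2)).
Qed.

(** If c has the image W, the product chart has the image W x ]0, +oo[ cut by the
half-space, since the second coordinate ranges over ]0, 1]. *)
Lemma cylinder_chart_is_chart c : is_chart setT c ->
  is_chart (half_space : set (E * R)) (cylinder_chart c).
Proof.
move=> cH; have [od cc [W oW imc] cK ic] := cH.
have odN : open (chart_dom (cylinder_chart c) : set N).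
  by apply: open_comp od => q _; exact: cylinder_fst_continuous.
have imN : cylinder_chart c @` chart_dom (cylinder_chart c) =
    [set x : E * R | W x.1 /\ 0 < x.2] `&` half_space.
  apply/seteqP; split=> [_ [[p t] cp <-]|[x s] [/= [Wx s0] s1]] /=.
    split; last exact: unit_itv_le1.
    split; last exact: unit_itv_gt0.
    have h : (c @` chart_dom c) (c p) by exists p.
    by rewrite imc in h; case: h.
  have : (W `&` setT) x by [].
  rewrite -imc => -[p cp <-]; exists (p, insubd (unit_itv1 : unit_itv R) s) => //=.
  by congr (_, _); apply: insubd_unit_itv.
split=> //.
- rewrite continuous_open_subspace// => q; rewrite inE => cq.
  have h1 : (fun q : N => c q.1) @ q --> c q.1.
    by apply: continuous_comp; [exact: cylinder_fst_continuous|exact: chart_continuous cH cq].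
  have h2 : (fun q : N => \val q.2 : R) @ q --> (\val q.2 : R).
    by apply: continuous_comp; [exact: cylinder_snd_continuous|exact: unit_itv_val_continuous].
  move=> U [[U1 U2] [/= hU1 hU2] U12].
  have h : \forall x \near q, U1 (c x.1) /\ U2 (\val x.2 : R).
    by apply: filterI; [exact: (h1 U1 hU1)|exact: (h2 U2 hU2)].
  change (nbhs q [set x | U (cylinder_chart c x)]).
  by apply: filterS h => x h; exact: (U12 (c x.1, \val x.2) h).
- exists [set x : E * R | W x.1 /\ 0 < x.2]; last exact: imN.
  apply: openI.
    by apply: open_comp oW => x _; exact: cvg_fst.
  by apply: (@open_comp _ _ snd [set s : R | 0 < s]) => [x _|]; [exact: cvg_snd|exact: open_gt].
- by move=> [p t] /= cp; rewrite cK// valKd.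
- apply/subspace_continuousP => x; rewrite imN => -[[Wx x0] x1].
  apply: cvg_cylinder => /=.
    have oim : open (c @` chart_dom c) by rewrite imc setIT.
    have := ic; rewrite continuous_open_subspace// => ic'.
    apply: cvg_within_filter.
    have h : {for x.1, continuous (chart_inv c)} by apply: ic'; rewrite inE imc.
    by apply: continuous_comp; [exact: cvg_fst|exact: h].
  move=> U; rewrite insubd_unit_itv// => Ux.
  have h : nbhs x [set y : E * R | U y.2] by apply: (@cvg_snd _ _ (nbhs x.1) (nbhs x.2)).
  change (nbhs x [set y : E * R | ([set x : E * R | W x.1 /\ 0 < x.2] `&` half_space) y ->
    U (\val (insubd (unit_itv1 : unit_itv R) y.2))]).
  by apply: filterS h => y Uy [[_ y0] y1]; rewrite insubd_unit_itv.
Qed.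

(** A transition map of the product is the product of one of M by the identity, and
is extended across the boundary in the same way. *)
Lemma cylinder_transition_smooth c c' : is_chart setT c ->
  smooth_on (overlap c c') (transition c c') ->
  smooth_on (overlap (cylinder_chart c) (cylinder_chart c'))
    (transition (cylinder_chart c) (cylinder_chart c')).
Proof.
move=> cH sm _ [[p t] [/= cp c'p] <-].
have [|g [W [[oW W0] gC gE]]] := sm (c p); first by exists p.
have oW' : open (fst @^-1` W : set (E * R)).
  by apply: open_comp oW => x _; exact: cvg_fst.
exists (fun x : E * R => (g x.1, x.2)), (fst @^-1` W); split.
- by split.
- move=> k; apply: class_C_pair; first exact: oW'.
    by apply: (class_C_comp_linear (L := fst)) => [x||]; [exact: cvg_fst|exact: oW|exact: gC].
  by apply: (@class_C_linear _ _ _ _ _ snd) => x; exact: cvg_snd.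
- move=> y [Wp' [[p' t'] [/= cp' c'p'] yE]]; rewrite -yE in Wp' * => /=.
  have [_ _ _ cK _] := cH.
  rewrite /transition/= gE /transition/= ?valKd ?cK//.
  by split=> //; exists p'.
Qed.

Lemma cylinder_smooth_atlas : smooth_atlas half_space (cylinder_atlas A).
Proof.
have [ch co at_] := smA; split.
- by move=> _ [c Ac <-]; exact/cylinder_chart_is_chart/ch.
- move=> _ _ [c Ac <-] [c' Ac' <-]; have [s1 s2] := co _ _ Ac Ac'.
  by split; apply: cylinder_transition_smooth => //; exact: ch.
- by move=> [p t] /=; have [Ap cp] := at_ p; split=> //; exists (chart_at A p).
Qed.

End cylinder_manifold.

(** * Balls of charts *)

Section charts_and_topology.
Context {R : realType}.

(** Charts are homeomorphisms onto their images: their balls form a basis of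
neighbourhoods. *)
Lemma chart_ball_sub {E : normedModType R} {T : topologicalType} (H : set E)
    (c : chart T E) (q0 : T) (O : set T) :
  is_chart H c -> chart_dom c q0 -> nbhs q0 O ->
  exists2 r : R, 0 < r & forall q, chart_dom c q -> `|c q - c q0| < r -> O q.
Proof.
move=> [_ _ _ cK ic] cq0 Oq0; have im0 : (c @` chart_dom c) (c q0) by exists q0.
have /subspace_continuousP/(_ _ im0) h := ic.
have hO : nbhs (chart_inv c (c q0)) O by rewrite cK.
have /nbhs_ballP[r /= r0 rO] := h O hO.
exists r => // q cq qr; rewrite -(cK q cq); apply: (rO (c q)); last by exists q.
by rewrite -ball_normE /= distrC.
Qed.

Variables (m : nat) (M : topologicalType).
Notation E := 'rV[R]_m.
Implicit Types (c : chart M E) (p : M).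

Lemma chart_inv_near c p0 : is_chart setT c -> chart_dom c p0 -> exists2 r : R, 0 < r &
  forall x, `|x - c p0| < r -> [/\ chart_dom c (chart_inv c x), c (chart_inv c x) = x &
    {for x, continuous (chart_inv c)}].
Proof.
move=> [_ _ [W oW imc] cK ic] cp0; rewrite setIT in imc.
have Wp0 : W (c p0) by rewrite -imc; exists p0.
have /nbhs_ballP[r /= r0 rW] := open_nbhs_nbhs (conj oW Wp0).
exists r => // x xr.
have Wx : W x by apply: rW; rewrite -ball_normE /= distrC.
have : (c @` chart_dom c) x by rewrite imc.
move=> [p cp <-]; rewrite cK//; split=> //.
move: ic; rewrite imc continuous_open_subspace//; apply.
by rewrite inE -imc; exists p.
Qed.

(** Small closed balls of a chart are compact, hence closed in M, as M is separated. *)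
Lemma chart_closed_ball c p0 : hausdorff_space M -> is_chart setT c -> chart_dom c p0 ->
  exists2 r : R, 0 < r & forall r', r' < r ->
    closed [set p | chart_dom c p /\ `|c p - c p0| <= r'].
Proof.
move=> hM cH cp0; have [r r0 rP] := chart_inv_near cH cp0.
have [_ _ _ cK _] := cH.
exists r => // r' r'r; apply: compact_closed => //.
pose B := [set x : E | `|x - c p0| <= r'].
have Bim : [set p | chart_dom c p /\ `|c p - c p0| <= r'] = chart_inv c @` B.
  apply/seteqP; split=> [p [cp pr]|_ [x xr <-]]; first by exists (c p) => //; exact: cK.
  by have [h1 h2 _] := rP x (le_lt_trans xr r'r); split=> //; rewrite h2.
rewrite Bim; apply: continuous_compact.
  apply/subspace_continuousP => x Bx; apply: cvg_within_filter.
  by have [] := rP x (le_lt_trans Bx r'r).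
apply: bounded_closed_compact.
  exists (r' + `|c p0|); split; first exact: num_real.
  move=> k kr x Bx; have Bx' : `|x - c p0| <= r' := Bx.
  have h : `|x| <= `|x - c p0| + `|c p0| by rewrite -{1}(subrK (c p0) x) ler_normD.
  by rewrite /=; lra.
have cB (x : E) : (fun y : E => `|y - c p0|) @ x --> `|x - c p0|.
  have h : (fun y : E => y - c p0) @ x --> x - c p0.
    by apply: (@cvgB _ _ _ (nbhs x)); [exact: cvg_id|exact: cvg_cst].
  exact: cvg_norm h.
apply: (@closed_comp _ _ (fun x : E => `|x - c p0|) [set s | s <= r']) => [x _|]; first exact: cB.
exact: closed_le.
Qed.

Lemma euclidean_norm_ge (x : E * R) : `|x| <= euclidean_norm x.
Proof.
have s0 : 0 <= \sum_(i < m) x.1 ord0 i ^+ 2 by apply: sumr_ge0 => i _; exact: sqr_ge0.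
rewrite prod_normE ge_max; apply/andP; split.
  apply: row_norm_le => [|i]; first exact: sqrtr_ge0.
  rewrite -sqrtr_sqr ler_wsqrtr// (bigD1 i)//= -addrA lerDl addr_ge0 ?sqr_ge0//.
  by apply: sumr_ge0 => j _; exact: sqr_ge0.
by rewrite -sqrtr_sqr ler_wsqrtr// lerDr.
Qed.

Lemma euclidean_norm_le (x : E * R) : euclidean_norm x <= Num.sqrt m.+1%:R * `|x|.
Proof.
have sq (y : R) : `|y| <= `|x| -> y ^+ 2 <= `|x| ^+ 2.
  by move=> yx; rewrite -(real_normK (num_real y)) lerXn2r ?nnegrE.
rewrite -[X in _ * X]ger0_norm// -sqrtr_sqr -sqrtrM// ler_wsqrtr//.
rewrite -natr1 mulrDl mul1r lerD//; last by apply: sq; exact: pair_norm_le2.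
apply: (@le_trans _ _ (\sum_(i < m) `|x| ^+ 2)); last by rewrite sumr_const card_ord mulr_natl.
by apply: ler_sum => i _; apply: sq; rewrite (le_trans (row_coord_le _ _))// pair_norm_le1.
Qed.

End charts_and_topology.

(** * Estimates on the cylinder *)

Section cylinder_estimates.
Context {R : realType} {m : nat} {M : topologicalType}.
Notation E := 'rV[R]_m.
Notation N := (cylinder R M).
Variable A : atlas M E.
Hypothesis smA : smooth_atlas setT A.
Variable nrm : N -> E * R -> R.
Notation CA := (cylinder_atlas A).
Hypothesis pm : pseudo_metric half_space euclidean_norm CA nrm.
Hypothesis si : strongly_integrable half_space CA nrm.
Variables C1 C2 C3 lam : R.
Hypothesis C1_gt1 : 1 < C1.
Hypothesis ha : forall (p : M) (t : unit_itv R),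
    1 / (C1 * \val t) <= nrm (p, t) (0, 1) /\
    nrm (p, t) (0, 1) <= C1 * (1 / \val t).
Hypothesis C2_gt0 : 0 < C2.
Hypothesis hb : forall (p : M) (t : unit_itv R) (v : E),
    nrm (p, t) (v, 0) + nrm (p, t) (0, 1) <= C2 * nrm (p, t) (v, 1).
Hypothesis C3_gt0 : 0 < C3.
Hypothesis lam_gt0 : 0 < lam.
Hypothesis hc : forall (p : M) (s t : unit_itv R) (v : E), \val s <= \val t ->
    nrm (p, s) (v, 0) >= C3 * (\val t / \val s) `^ lam * nrm (p, t) (v, 0).
Implicit Types (c : chart M E) (p : M) (q : N) (sigma : R -> N) (a b t : R).
Notation mu := (@lebesgue_measure R).
Notation cmu := (@completed_lebesgue_measure R).
Notation AC := (abs_continuous_curve half_space CA).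
Notation speed := (speed CA nrm).
Notation len := (curve_length CA nrm).

Let smC : smooth_atlas half_space CA := cylinder_smooth_atlas smA.
Let C1_gt0 : 0 < C1 := lt_trans ltr01 C1_gt1.
Let fmu : Filter (nbhs (almost_everywhere mu)) := ae_lebesgue_filter.

(** Hypotheses (a) and (b) for the vector (v / w, 1), and homogeneity. *)
Lemma nrm_vertical_le q v w : `|w| <= C1 * C2 * \val q.2 * nrm q (v, w).
Proof.
case: q => p t /=; have t0 := unit_itv_gt0 t.
have [->|w0] := eqVneq w 0.
  by rewrite normr0 mulr_ge0//; [rewrite !mulr_ge0// ltW|exact: (pseudo_metric_ge0 pm)].
have -> : (v, w) = w *: (w^-1 *: v, 1).
  by congr (_, _); rewrite /= ?scalerA ?divff ?scale1r// [_ *: _]mulr1.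
rewrite (pseudo_metricZ pm) mulrCA ler_peMr// -lter_pdivrMl ?mulr_gt0//.
have [h1 _] := ha p t; have := hb p t (w^-1 *: v).
have n0 : 0 <= nrm (p, t) (w^-1 *: v, 0) := pseudo_metric_ge0 pm _ _.
rewrite mulr1; have -> : (C1 * C2 * \val t)^-1 = (1 / (C1 * \val t)) / C2.
  by rewrite mul1r -invfM; congr (_^-1); ring.
by move=> h2; rewrite ler_pdivrMr// [leRHS]mulrC (le_trans h1)// (le_trans _ h2)// lerDr.
Qed.

(** Hypothesis (b) for the vector (v / w, 1), and homogeneity; w = 0 is trivial. *)
Lemma nrm_horizontal_le q v w : nrm q (v, 0) <= (1 + C2) * nrm q (v, w).
Proof.
case: q => p t; have n0 x : 0 <= nrm (p, t) x := pseudo_metric_ge0 pm _ _.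
have [->|w0] := eqVneq w 0; first by rewrite mulrDl mul1r lerDl mulr_ge0// ltW.
have E1 : (v, w) = w *: (w^-1 *: v, 1).
  by congr (_, _); rewrite /= ?scalerA ?divff ?scale1r// [_ *: _]mulr1.
have E2 : (v, 0 : R) = w *: (w^-1 *: v, 0).
  by congr (_, _); rewrite /= ?scalerA ?divff ?scale1r// [_ *: _]mulr0.
rewrite E1 E2 !(pseudo_metricZ pm) mulrCA ler_wpM2l//.
have := hb p t (w^-1 *: v); have := n0 (0, 1); have := n0 (w^-1 *: v, 1); nra.
Qed.

(** The distinguished charts of the cylinder are products. *)
Lemma velocity_split sigma (t : R) :
  derivable (chart_at CA (sigma t) \o sigma) t 1 -> exists v w,
  [/\ velocity CA sigma t = (v, w),
     is_derive t (1 : R) (fun s => chart_at A (sigma t).1 (sigma s).1) v &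
     is_derive t (1 : R) (fun s => \val (sigma s).2 : R) w].
Proof.
move=> ds; have d := derivableP ds.
exists (velocity CA sigma t).1, (velocity CA sigma t).2; split.
- exact: surjective_pairing.
- have := is_derive_fst d; rewrite -derive1E; exact.
- have := is_derive_snd d; rewrite -derive1E; exact.
Qed.

Lemma within_comp (S : topologicalType) a b sigma (f : N -> S) :
  {within `[a, b], continuous sigma} -> continuous f ->
  {within `[a, b], continuous (f \o sigma)}.
Proof.
move=> cs cf; apply/subspace_continuousP => x xab.
have /subspace_continuousP/(_ x xab) h := cs.
exact: (cvg_comp _ _ h (cf (sigma x))).
Qed.

Lemma cylinder_val_continuous : continuous (fun q : N => \val q.2 : R).
Proof.
by move=> q; apply: continuous_comp; [exact: cylinder_snd_continuous|exact: unit_itv_val_continuous].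
Qed.

Lemma abs_continuous_val a b sigma : a <= b -> AC a b sigma ->
  abs_continuous a b (fun t => \val (sigma t).2 : R).
Proof.
move=> ab acs.
apply: (cousin (Q := fun x y => abs_continuous x y (fun t => \val (sigma t).2 : R)) ab).
  by move=> x y z _ xy yz _; exact: abs_continuous_cat.
move=> t a_t tb; have [Ac ct] := chart_atP smC (sigma t).
have [r r0 rP] := abs_continuous_curve_chart smC Ac acs a_t tb ct.
exists r => // u v au ut tv vb tu vt.
have [_ acc] := rP u v au (le_trans ut tv) vb tu vt.
apply: (abs_continuous_dominated ltr01) acc => x y _ _ _.
have h := pair_norm_le2 ((chart_at CA (sigma t) \o sigma) y - (chart_at CA (sigma t) \o sigma) x).
by rewrite mul1r; exact: h.
Qed.

Definition height q : R := ln (\val q.2).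

Lemma height_le0 q : height q <= 0.
Proof. by apply: ln_le0; exact: unit_itv_le1. Qed.

Lemma expR_height q : expR (height q) = \val q.2.
Proof. by rewrite lnK// posrE; exact: unit_itv_gt0. Qed.

Lemma ln_lipschitz (d x y : R) : 0 < d -> d <= x -> x <= y -> `|ln y - ln x| <= d^-1 * `|y - x|.
Proof.
move=> d0 dx xy; have x0 := lt_le_trans d0 dx; have y0 := lt_le_trans x0 xy.
rewrite !ger0_norm ?subr_ge0 ?ler_ln ?posrE//.
rewrite -ln_div ?posrE//; apply: (@le_trans _ _ (y / x - 1)).
  have := @le_ln1Dx R (y / x - 1); rewrite subrKC; apply.
  by rewrite ltrBrDr addNr divr_gt0.
have -> : y / x - 1 = x^-1 * (y - x) by rewrite mulrBr mulVf ?gt_eqF// mulrC.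
by rewrite ler_wpM2r ?subr_ge0// lef_pV2 ?posrE.
Qed.

(** By [nrm_vertical_le] the derivative of the height along a curve is at most
C1 * C2 times its speed. *)
Lemma height_le_length a b sigma : a <= b -> AC a b sigma ->
  `|height (sigma b) - height (sigma a)| <= C1 * C2 * len a b sigma.
Proof.
move=> ab acs; have K0 : 0 <= C1 * C2 by rewrite mulr_ge0// ltW.
have [iK <-] := completed_RintegralZ (C1 * C2) (si ab acs).
have acv := abs_continuous_val ab acs.
have cv : {within `[a, b], continuous (fun t => \val (sigma t).2 : R)}.
  exact: (within_comp acs.1 cylinder_val_continuous).
have [c0 _ minc] := EVT_min ab cv.
set d := \val (sigma c0).2 in minc; have d0 : 0 < d := unit_itv_gt0 _.
apply: (abs_continuous_le_integral (f := height \o sigma) ab _ _ iK).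
- have dV : 0 < d^-1 by rewrite invr_gt0.
  apply: (abs_continuous_dominated dV) acv => x y ax xy yb.
  have dx : d <= \val (sigma x).2 by apply: minc; rewrite in_itv/= ax (le_trans xy).
  have dy : d <= \val (sigma y).2 by apply: minc; rewrite in_itv/= yb (le_trans ax).
  have [le|/ltW le] := leP (\val (sigma x).2 : R) (\val (sigma y).2).
    exact: ln_lipschitz.
  by rewrite distrC [X in _ <= _ * X]distrC; exact: ln_lipschitz.
- by move=> t; rewrite mulr_ge0//; exact: (pseudo_metric_ge0 pm).
- apply: completed_ae; apply: (@filterS _ _ fmu _ _ _ (ae_derivable_chart_at smC ab acs)).
  move=> t h at_ tb _; have [v [w [vw _ dw]]] := velocity_split (h at_ tb).
  have s0 := unit_itv_gt0 (sigma t).2.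
  have dln := is_derive1_ln s0.
  have dh := is_derive1_comp dln dw.
  rewrite derive1E (@derive_val _ _ _ _ _ _ _ dh) /Defs.speed vw normrM.
  rewrite gtr0_norm ?invr_gt0// ler_pdivrMl//.
  by apply: (le_trans (nrm_vertical_le (sigma t) v w)); rewrite mulrCA mulrA.
Qed.

(** Vertical projection to the height tau; a positive height is replaced by 0. *)
Definition lift_to (tau : R) q : N := (q.1, insubd (unit_itv1 : unit_itv R) (expR tau)).

Lemma val_lift_to tau q : tau <= 0 -> \val (lift_to tau q).2 = expR tau.
Proof. by move=> t0; apply: insubd_unit_itv; [exact: expR_gt0|rewrite -expR0 ler_expR]. Qed.

Lemma height_lift_to tau q : tau <= 0 -> height (lift_to tau q) = tau.
Proof. by move=> t0; rewrite /height val_lift_to// expRK. Qed.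

Lemma lift_to_height q : lift_to (height q) q = q.
Proof. by case: q => p t; rewrite /lift_to expR_height valKd. Qed.

Lemma expR_lipschitz (x y : R) : x <= y -> y <= 0 -> `|expR y - expR x| <= `|y - x|.
Proof.
move=> xy y0; rewrite !ger0_norm ?subr_ge0 ?ler_expR//.
have -> : expR x = expR y * expR (x - y) by rewrite -expRD addrC subrK.
have := expR_ge1Dx (x - y); have : expR y <= 1 by rewrite -expR0 ler_expR.
have := expR_gt0 y; set u := expR y; set v := expR _; nra.
Qed.

(** Parametrized by the height, a vertical curve has the velocity t d/dt at the point
(p, t), whose norm is at most C1 by hypothesis (a). *)
Lemma vertical_curve q a b : a <= b -> b <= 0 ->
  AC a b (fun t => lift_to t q) /\ len a b (fun t => lift_to t q) <= C1 * (b - a).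
Proof.
move=> ab b0; pose s t := lift_to t q; have [Ap cp] := chart_atP smC q.
have acs : AC a b s.
  apply: (abs_continuous_curve_local smC).
    apply/subspace_continuousP => t; rewrite /= in_itv/= => /andP[a_t tb].
    apply: cvg_cylinder; first exact: cvg_cst.
    rewrite (val_lift_to _ (le_trans tb b0)).
    have h := @continuous_expR R t.
    move=> U Ut; have hU : \forall y \near t, U (expR y) := h _ Ut.
    change (nbhs t [set y | `[a, b]%classic y -> U (\val (s y).2)]).
    apply: filterS hU => y /= Uy; rewrite in_itv/= => /andP[ay yb].
    by rewrite val_lift_to// (le_trans yb).
  move=> t a_t tb; exists (chart_at CA q); split=> //; exists 1; first exact: ltr01.
  move=> u v au uv vb _ _; apply: (abs_continuous_lipschitz ltr01) => x y ux xy yv.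
  have y0 : y <= 0 by rewrite (le_trans yv)// (le_trans vb).
  rewrite mul1r prod_normE ge_max; apply/andP; split.
    by rewrite /= subrr normr0 subr_ge0.
  rewrite -[X in _ <= X]ger0_norm ?subr_ge0//.
  rewrite [X in `|X|](_ : _ = expR y - expR x); first exact: expR_lipschitz.
  by rewrite /= !val_lift_to// (le_trans xy).
split; first exact: acs.
apply: (curve_length_bounded pm si ab acs (ltW C1_gt0)).
apply: (@filterS _ _ fmu _ _ _ (ae_derivable_chart_at smC ab acs)).
move=> t h a_t tb; have [v [w [vw dv dw]]] := velocity_split (h a_t tb).
have v0 : v = 0.
  have dv' : is_derive t (1 : R) (cst (chart_at A q.1 q.1) : R -> E) v by exact: dv.
  by rewrite -(@derive_val _ _ _ _ _ _ _ dv') derive_cst.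
have w0 : w = expR t.
  rewrite -(@derive_val _ _ _ _ _ _ _ dw).
  have -> : 'D_1 (fun r => \val (s r).2 : R) t = 'D_1 expR t.
    apply: near_eq_derive; near=> r; rewrite /s val_lift_to//.
    have : r < b by near: r; exact: lt_nbhsl.
    by move=> /ltW/le_trans; apply.
  by rewrite derive_val.
have t0 : t <= 0 by rewrite (le_trans (ltW tb)).
rewrite /Defs.speed vw v0 w0.
have -> : ((0 : E), expR t) = expR t *: (0, 1).
  by congr (_, _); rewrite /= ?scaler0// [_ *: _]mulr1.
rewrite (pseudo_metricZ pm) ger0_norm ?expR_ge0//.
have [_] := ha (s t).1 (s t).2; rewrite -surjective_pairing val_lift_to// div1r => h1.
apply: (le_trans (ler_wpM2l (expR_ge0 t) h1)).
by rewrite mulrCA mulfV ?mulr1// gt_eqF// expR_gt0.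
Unshelve. all: by end_near. Qed.

(** Projecting a vector vertically from s to t kills its vertical component and keeps
its horizontal one, to which hypothesis (c) applies; S is an upper bound for s
that will be uniform along a curve. *)
Lemma horizontal_speed_le p (s t : unit_itv R) v w (S : R) : \val s <= S -> S <= \val t ->
  nrm (p, t) (v, 0) <= (1 + C2) / C3 * (S / \val t) `^ lam * nrm (p, s) (v, w).
Proof.
move=> sS St; have s0 := unit_itv_gt0 s; have t0 := unit_itv_gt0 t.
have S0 : 0 < S := lt_le_trans s0 sS.
have h1 := hc p v (le_trans sS St); have h2 := nrm_horizontal_le (p, s) v w.
have n0 x : 0 <= nrm (p, t) x := pseudo_metric_ge0 pm _ _.
have E1 : nrm (p, t) (v, 0) <= C3^-1 * (\val s / \val t) `^ lam * nrm (p, s) (v, 0).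
  have e : (\val s / \val t) `^ lam * (\val t / \val s) `^ lam = 1.
    rewrite -powRM ?divr_ge0// ?ltW//.
    rewrite mulf_div [X in _ / X]mulrC divff ?powR1//.
    by rewrite mulf_neq0// gt_eqF.
  have k0 : 0 <= C3^-1 * (\val s / \val t) `^ lam.
    by rewrite mulr_ge0 ?powR_ge0// invr_ge0 ltW.
  apply: le_trans (ler_wpM2l k0 h1).
  rewrite [leRHS](_ : _ = (C3^-1 * C3) * ((\val s / \val t) `^ lam * (\val t / \val s) `^ lam) *
    nrm (p, t) (v, 0)); last by ring.
  by rewrite e mulVf ?gt_eqF// !mul1r.
apply: (le_trans E1); rewrite [leRHS](_ : _ = (C3^-1 * (S / \val t) `^ lam) * ((1 + C2) * nrm (p, s) (v, w))); last by ring.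
apply: ler_pM => //.
- by rewrite mulr_ge0 ?invr_ge0 ?powR_ge0// ltW.
- exact: (pseudo_metric_ge0 pm).
- apply: ler_wpM2l; first by rewrite invr_ge0 ltW.
  apply: (ge0_ler_powR (ltW lam_gt0)); rewrite ?nnegrE ?divr_ge0 ?(ltW s0) ?(ltW t0) ?(ltW S0)//.
  by rewrite ler_pM2r ?invr_gt0.
Qed.

(** [horizontal_speed_le] at almost every time. *)
Lemma lifted_curve sigma a b tau (S : R) : a <= b -> tau <= 0 -> AC a b sigma ->
  (forall t, a <= t -> t <= b -> \val (sigma t).2 <= S) -> S <= expR tau ->
  AC a b (lift_to tau \o sigma) /\
  len a b (lift_to tau \o sigma) <= (1 + C2) / C3 * (S / expR tau) `^ lam * len a b sigma.
Proof.
move=> ab t0 acs sS St.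
have acl : AC a b (lift_to tau \o sigma).
  apply: (abs_continuous_curve_local smC).
    have cl : continuous (lift_to tau).
      move=> q; apply: cvg_cylinder; last exact: cvg_cst.
      exact: (@cylinder_fst_continuous R M q).
    exact: (within_comp acs.1 cl).
  move=> t a_t tb; have [Ac ct] := chart_atP smC (sigma t).
  have [r r0 rP] := abs_continuous_curve_chart smC Ac acs a_t tb ct.
  exists (chart_at CA (sigma t)); split=> //; exists r => // u v au uv vb tu vt.
  have [_ acc] := rP u v au uv vb tu vt.
  apply: (abs_continuous_dominated ltr01) acc => x y _ _ _; rewrite mul1r.
  have h := pair_norm_le1 ((chart_at CA (sigma t) \o sigma) y - (chart_at CA (sigma t) \o sigma) x).
  by apply: le_trans h; rewrite prod_normE ge_max lexx /= subrr normr0 normr_ge0.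
split; first exact: acl.
have k0 : 0 <= (1 + C2) / C3 * (S / expR tau) `^ lam.
  by rewrite mulr_ge0 ?powR_ge0// divr_ge0 ?addr_ge0 // ltW.
apply: (curve_length_le pm si ab acs acl) => //.
apply: (@filterS2 _ _ fmu _ _ _ _ (ae_derivable_chart_at smC ab acs) (ae_derivable_chart_at smC ab acl)).
move=> t h h' a_t tb; have [v [w [vw dv dw]]] := velocity_split (h a_t tb).
have [v' [w' [vw' dv' dw']]] := velocity_split (h' a_t tb).
have w0 : w' = 0 by rewrite -(@derive_val _ _ _ _ _ _ _ dw'); exact: derive_cst.
have vv : v' = v by rewrite -(@derive_val _ _ _ _ _ _ _ dv') (@derive_val _ _ _ _ _ _ _ dv).
rewrite /Defs.speed vw vw' w0 vv [sigma t in leRHS]surjective_pairing.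
rewrite -(val_lift_to (sigma t) t0) in St *.
by apply: horizontal_speed_le => //; apply: sS; exact: ltW.
Qed.

(** * Topology of the induced distance *)

Notation joined := (joined half_space CA nrm).
Notation dist := (induced_distance half_space CA nrm).

Lemma joined_vertical q s t : s <= t -> t <= 0 ->
  exists2 l, joined (lift_to s q) (lift_to t q) l & l <= C1 * (t - s).
Proof.
move=> st t0; have [acs ls] := vertical_curve q st t0.
by exists (len s t (fun r => lift_to r q)) => //; exists s, t, (fun r => lift_to r q).
Qed.

Lemma joined_vertical_abs q s t : s <= 0 -> t <= 0 ->
  exists2 l, joined (lift_to s q) (lift_to t q) l & l <= C1 * `|t - s|.
Proof.
move=> s0 t0; have [st|/ltW ts] := leP s t.
  by rewrite ger0_norm ?subr_ge0//; exact: joined_vertical.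
have [l jl ll] := joined_vertical q ts s0.
exists l; first exact: (joined_sym pm si jl).
by rewrite distrC ger0_norm ?subr_ge0.
Qed.

Lemma dist_vertical q s t : s <= 0 -> t <= 0 ->
  dist (lift_to s q) (lift_to t q) <= C1 * `|t - s|.
Proof.
move=> s0 t0; have [l jl ll] := joined_vertical_abs q s0 t0.
exact: le_trans (dist_le pm jl) ll.
Qed.

(** The curve is a segment in the chart around p0, with s constant.  There its
velocity is the constant vector (d, 0), and the norm is comparable to the
Euclidean one. *)
Lemma joined_horizontal p0 (s : unit_itv R) :
  exists2 K : R, 0 < K & exists2 r : R, 0 < r & forall p,
    chart_dom (chart_at A p0) p ->
    `|chart_at A p0 p - chart_at A p0 p0| < r -> exists2 l, joined (p0, s) (p, s) l &
      l <= K * `|chart_at A p0 p - chart_at A p0 p0|.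
Proof.
have [chA _ atA] := smA; have [Ac cp0] := atA p0; set c := chart_at A p0 in Ac cp0 *.
have cH := chA _ Ac; have [_ _ _ cK _] := cH.
have ACc : charts CA (cylinder_chart c) by exists c.
have CC := charts_coordinate smC ACc.
have [C C1' [V [[oV Vq0] Vdom nrmV]]] := pseudo_metric_chart pm CC (cp0 : chart_dom (cylinder_chart c) (p0, s)).
have C0 : 0 < C := lt_trans ltr01 C1'.
have [r0 r00 r0P] := chart_inv_near cH cp0.
have [r1 r10 r1P] := chart_ball_sub CC.1 (cp0 : chart_dom (cylinder_chart c) (p0, s)) (open_nbhs_nbhs (conj oV Vq0)).
exists (C * Num.sqrt m.+1%:R); first by rewrite mulr_gt0// sqrtr_gt0.
exists (Num.min r0 r1); first by rewrite lt_min r00.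
move=> p cp; rewrite lt_min => /andP[pr0 pr1].
set d := c p - c p0 in pr0 pr1 *.
pose x (t : R) : E := c p0 + t *: d.
pose sg (t : R) : N := (chart_inv c (x t), s).
have xr (t : R) k : 0 <= t -> t <= 1 -> `|d| < k -> `|x t - c p0| < k.
  move=> t0 t1; apply: le_lt_trans; rewrite /x addrC addKr normrZ ger0_norm//.
  by rewrite ler_piMl.
have sg_dom t : 0 <= t -> t <= 1 -> chart_dom c (sg t).1 /\ c (sg t).1 = x t.
  by move=> t0 t1; have [] := r0P (x t) (xr t r0 t0 t1 pr0).
have xl t t' : x t' - x t = (t' - t) *: d by rewrite /x opprD addrACA subrr add0r scalerBl.
have cx : continuous x.
  move=> t; apply: cvgD; first exact: cvg_cst.
  by apply: cvgZr_tmp; exact: cvg_id.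
have cc_sg t : 0 <= t -> t <= 1 -> cylinder_chart c (sg t) = (x t, \val s).
  by move=> t0 t1; have [_ h] := sg_dom t t0 t1; congr (_, _).
have acs : AC 0 1 sg.
  apply: (abs_continuous_curve_local smC).
    apply/subspace_continuousP => t; rewrite /= in_itv/= => /andP[t0 t1].
    apply: cvg_within_filter; apply: cvg_cylinder; last exact: cvg_cst.
    have [_ _ h] := r0P (x t) (xr t r0 t0 t1 pr0).
    exact: (cvg_comp _ _ (cx t) h).
  move=> t t0 t1; exists (cylinder_chart c); split=> //; first exact: (sg_dom t t0 t1).1.
  exists 1 => // u v u0 uv v1 _ _.
  apply: (@abs_continuous_lipschitz _ _ (`|d| + 1)); first by rewrite ltr_wpDl.
  move=> y y' uy yy yv.
  have y0 : 0 <= y by exact: le_trans uy.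
  have y'1 : y' <= 1 by exact: le_trans v1.
  have e1 : (cylinder_chart c \o sg) y' = (x y', \val s) := cc_sg y' (le_trans y0 yy) y'1.
  have e2 : (cylinder_chart c \o sg) y = (x y, \val s) := cc_sg y y0 (le_trans yy y'1).
  rewrite e1 e2 prod_normE ge_max /= subrr normr0 xl normrZ ger0_norm ?subr_ge0// mulrC.
  by rewrite ler_wpM2r ?subr_ge0 ?lerDl//= mulr_ge0 ?subr_ge0// addr_ge0.
have k0 : 0 <= C * Num.sqrt m.+1%:R * `|d| by rewrite !mulr_ge0 ?sqrtr_ge0// ltW.
exists (len 0 1 sg).
  exists 0, 1, sg; split; [exact: ler01|exact: acs| | |by []].
    by rewrite /sg /x scale0r addr0 cK.
  by rewrite /sg /x scale1r /d addrC subrK cK.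
have := curve_length_bounded pm si ler01 acs k0; rewrite subr0 mulr1; apply.
apply: (@filterS _ _ fmu _ _ _ (ae_derivable_chart_at smC ler01 acs)) => t h t0 t1.
have dom_t : chart_dom (cylinder_chart c) (sg t) := (sg_dom t (ltW t0) (ltW t1)).1.
have sc : {for t, continuous sg} by exact: (within_itv_continuous acs.1 t0 t1).
have D := dchart_velocity smC CC dom_t sc (h t0 t1).
have D' : is_derive t (1 : R) (cylinder_chart c \o sg) (d, 0).
  have D1 : is_derive t (1 : R) (fun r => (x r, \val s : R)) (d, 0).
    apply: is_derive_pair.
    have hd : is_diff t (cst (c p0) + ( *:%R^~ d)) (0 + ( *:%R^~ d)) by exact: is_diffD.
    have df : differentiable x t by exact: (@ex_diff _ _ _ _ _ _ _ hd).
    apply: DeriveDef; first exact: diff_derivable.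
    by rewrite deriveE// (@diff_val _ _ _ _ _ _ _ hd) add0r scale1r.
  apply: near_eq_is_derive D1.
  have : nbhs t `]0, 1[%classic.
    by apply: open_nbhs_nbhs; split; [exact: itv_open|rewrite /= in_itv/= t0 t1].
  by apply: filterS => y /=; rewrite in_itv/= => /andP[y0 y1]; symmetry; exact: cc_sg (ltW y0) (ltW y1).
have dE : dchart CA (cylinder_chart c) (sg t) (velocity CA sg t) = (d, 0).
  by rewrite -(@derive_val _ _ _ _ _ _ _ D) (@derive_val _ _ _ _ _ _ _ D').
have Vt : V (sg t).
  apply: r1P => //; rewrite cc_sg ?ltW// prod_normE gt_max /= subrr normr0 r10 andbT.
  by apply: xr => //; exact: ltW.
have [_] := nrmV (sg t) (velocity CA sg t) Vt; rewrite dE => /le_trans; apply.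
rewrite -mulrA ler_wpM2l//; first exact: ltW.
apply: (le_trans (euclidean_norm_le _)); rewrite prod_normE /= normr0.
by rewrite max_l.
Qed.

Lemma height_continuous : continuous height.
Proof.
move=> q; apply: (@continuous_comp _ _ _ (fun q : N => \val q.2 : R) (@ln R)).
  exact: cylinder_val_continuous.
by apply: continuous_ln; exact: unit_itv_gt0.
Qed.

(** From q0 to q one moves horizontally, and then vertically. *)
Lemma joined_near q0 (e : R) : 0 < e ->
  \forall q \near q0, exists2 l, joined q0 q l & l < e.
Proof.
move=> e0; case: q0 => p0 t0.
have [K K0 [r r0 rP]] := joined_horizontal p0 t0.
have [chA _ atA] := smA; have [Ac cp0] := atA p0; set c := chart_at A p0 in Ac cp0 rP *.
have cH := chA _ Ac.
have e1 : 0 < e / (2 * C1) by rewrite divr_gt0// mulr_gt0.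
have e2 : 0 < e / (2 * K) by rewrite divr_gt0// mulr_gt0.
(* the vertical part of the path costs less than e / 2, and so does the horizontal *)
have n1 : \forall q \near ((p0, t0) : N), `|height (p0, t0) - height q| < e / (2 * C1).
  by have := @height_continuous (p0, t0); move=> /cvgrPdist_lt; apply.
have n2 : \forall q \near ((p0, t0) : N), chart_dom c q.1.
  by apply: (@cylinder_fst_continuous R M (p0, t0)); exact: (chart_near cH cp0).
have n3 : \forall q \near ((p0, t0) : N), `|c p0 - c q.1| < Num.min r (e / (2 * K)).
  have h : (fun q : N => c q.1) @ ((p0, t0) : N) --> c p0.
    apply: (@cvg_comp _ _ _ (fun q : N => q.1) c _ (nbhs p0)).
      exact: (@cylinder_fst_continuous R M (p0, t0)).
    exact: (chart_continuous cH cp0).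
  by move: h => /cvgrPdist_lt; apply; rewrite lt_min r0.
apply: filterS3 n1 n2 n3 => q n1 n2; rewrite distrC lt_min => /andP[n3 n4].
have [l1 j1 ll1] := rP q.1 n2 n3.
have [l2 j2 ll2] := joined_vertical_abs q (height_le0 (p0, t0)) (height_le0 q).
have E1 : lift_to (height (p0, t0)) q = (q.1, t0).
  by rewrite /lift_to expR_height /= valKd.
rewrite E1 lift_to_height in j2.
exists (l1 + l2); first exact: (joined_trans pm si j1 j2).
rewrite [e]splitr ltr_leD//.
  apply: (le_lt_trans ll1); rewrite mulrC -ltr_pdivlMr//.
  by apply: (lt_le_trans n4); rewrite invfM mulrA.
apply: (le_trans ll2); rewrite distrC mulrC -ler_pdivlMr//.
by apply: (le_trans (ltW n1)); rewrite invfM mulrA.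
Qed.

Hypothesis M_connected : connected [set: M].

(** The set of the points of M x {1} that can be reached from a given one is open by
[joined_near], and so is its complement; any point is joined to M x {1} by a
vertical curve. *)
Lemma joined_connected (q1 q2 : N) : joined q1 q2 !=set0.
Proof.
pose top p : N := (p, unit_itv1 : unit_itv R).
have topE q0 : lift_to 0 q0 = top q0.1.
  by congr (_, _); apply: val_inj; rewrite insubd_unit_itv expR0.
suff H p1 p2 : joined (top p1) (top p2) !=set0.
  have [l1 j1 _] := joined_vertical_abs q1 (height_le0 q1) (lexx 0).
  have [l2 j2 _] := joined_vertical_abs q2 (lexx 0) (height_le0 q2).
  rewrite lift_to_height topE in j1; rewrite lift_to_height topE in j2.
  have [l jl] := H q1.1 q2.1.
  by exists (l1 + l + l2); apply: (joined_trans pm si _ j2); exact: (joined_trans pm si j1 jl).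
pose S := [set p | joined (top p1) (top p) !=set0].
have ctop : continuous top.
  by move=> x; apply: cvg_cylinder; [exact: cvg_id|exact: cvg_cst].
have near_top x : \forall y \near x, joined (top x) (top y) !=set0.
  have h : \forall y \near x, exists2 l, joined (top x) (top y) l & l < 1.
    exact: ctop x _ (joined_near (top x) ltr01).
  by apply: filterS h => y [l jl _]; exists l.
have oS : open S.
  rewrite openE => x [l jl]; rewrite /interior.
  apply: filterS (near_top x) => y [l' jl']; exists (l + l').
  exact: (joined_trans pm si jl jl').
have cS : closed S.
  rewrite -[S]setCK closedC openE => x nSx; rewrite /interior.
  apply: filterS (near_top x) => y [l' jl'] [l jl]; apply: nSx; exists (l + l').
  exact: (joined_trans pm si jl (joined_sym pm si jl')).
have ST : S = setT.
  apply: M_connected.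
  - by exists p1; exists 0; exact: (joined_refl pm si).
  - by exists S => //; rewrite setTI.
  - by exists S => //; rewrite setTI.
by have : S p2 by rewrite ST.
Qed.

Lemma dist_near q0 (e : R) : 0 < e -> \forall q \near q0, dist q0 q < e.
Proof.
move=> /(joined_near q0); apply: filterS => q [l jl]; apply: le_lt_trans.
exact: (dist_le pm jl).
Qed.

Lemma dist_continuous q0 : continuous (dist q0).
Proof.
move=> q; apply/cvgrPdist_lt => e e0; apply: filterS (dist_near q e0) => q' h.
have t1 := dist_triangular pm si joined_connected q q0 q'.
have t2 := dist_triangular pm si joined_connected q' q0 q.
rewrite (dist_symmetric pm si q' q) in t2.
by rewrite ltr_norml; apply/andP; split; lra.
Qed.

(** As long as a curve stays in a region where the norm is at least 1 / C times the
Euclidean norm of a chart, each coordinate moves by at most C times the length. *)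
Lemma chart_displacement (cc : chart N (E * R)) (V : set N) (C : R) a b sigma :
  coordinate_chart half_space CA cc -> V `<=` chart_dom cc -> 0 < C ->
  (forall q v, V q -> euclidean_norm (dchart CA cc q v) <= C * nrm q v) ->
  a <= b -> AC a b sigma -> (forall t, a <= t -> t <= b -> V (sigma t)) ->
  `|cc (sigma b) - cc (sigma a)| <= C * len a b sigma.
Proof.
move=> CC Vdom C0 nrmV ab acs Vs.
have acc : abs_continuous a b (cc \o sigma).
  apply: acs.2 => // t; rewrite in_itv/= => /andP[at_ tb]; apply: Vdom; exact: Vs.
have [iC CE] := completed_RintegralZ C (si ab acs).
have w0 t : 0 <= C * speed sigma t.
  by rewrite mulr_ge0 ?(ltW C0)//; exact: (pseudo_metric_ge0 pm).
(* f stands for one coordinate of cc along the curve *)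
have bound (f : R -> R) : abs_continuous a b f ->
    (forall t D, is_derive t (1 : R) (cc \o sigma) D ->
      exists2 d, is_derive t (1 : R) f d & `|d| <= `|D|) ->
    `|f b - f a| <= C * len a b sigma.
  move=> acf fD; rewrite /curve_length -CE.
  apply: (abs_continuous_le_integral ab acf w0 iC).
  apply: completed_ae; apply: (@filterS _ _ fmu _ _ _ (ae_derivable_chart_at smC ab acs)).
  move=> t h at_ tb _; have Vt : V (sigma t) by apply: Vs; exact: ltW.
  have sc : {for t, continuous sigma} by exact: (within_itv_continuous acs.1 at_ tb).
  have D := dchart_velocity smC CC (Vdom _ Vt) sc (h at_ tb).
  have [d dd dD] := fD _ _ D; rewrite derive1E (@derive_val _ _ _ _ _ _ _ dd).
  by apply: (le_trans dD); apply: (le_trans (euclidean_norm_ge _)); exact: nrmV.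
have L0 : 0 <= C * len a b sigma by rewrite mulr_ge0 ?(ltW C0)//; exact: (curve_length_ge0 pm).
rewrite prod_normE ge_max; apply/andP; split.
  apply: row_norm_le => // i.
  have := bound (fun t => (cc (sigma t)).1 0 i); rewrite !mxE; apply.
    apply: (abs_continuous_dominated ltr01) acc => x y _ _ _; rewrite mul1r.
    have h := pair_norm_le1 ((cc \o sigma) y - (cc \o sigma) x).
    by apply: le_trans h; apply: le_trans (row_coord_le _ i); rewrite !mxE.
  move=> t D dD; exists (D.1 0 i).
    exact: (is_derive_coord i (is_derive_fst dD)).
  by rewrite (le_trans (row_coord_le _ _))// pair_norm_le1.
have := bound (fun t => (cc (sigma t)).2); apply.
  apply: (abs_continuous_dominated ltr01) acc => x y _ _ _; rewrite mul1r.
  exact: (pair_norm_le2 ((cc \o sigma) y - (cc \o sigma) x)).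
move=> t D dD; exists D.2; first exact: is_derive_snd.
exact: pair_norm_le2.
Qed.

Hypothesis M_hausdorff : hausdorff_space M.

(** A short curve from q0 cannot leave a small chart ball: until its first exit time s
it stays in the half ball by [chart_displacement], and this half ball is closed
because M is separated. *)
Lemma dist_nbhs (q0 : N) (O : set N) : nbhs q0 O ->
  exists2 rho : R, 0 < rho & forall q, dist q0 q < rho -> O q.
Proof.
move=> Oq0; have [chA _ atA] := smA; have [Ac cp0] := atA q0.1.
set c := chart_at A q0.1 in Ac cp0; have cH := chA _ Ac.
pose cc := cylinder_chart c.
have CC : coordinate_chart half_space CA cc by apply: (charts_coordinate smC); exists c.
have ccH := CC.1; have cq0 : chart_dom cc q0 := cp0.
have [C C1' [V [[oV Vq0] Vdom nrmV]]] := pseudo_metric_chart pm CC cq0.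
have C0 : 0 < C := lt_trans ltr01 C1'.
have [r1 r10 r1P] := chart_ball_sub ccH cq0 (filterI Oq0 (open_nbhs_nbhs (conj oV Vq0))).
have [r2 r20 r2P] := chart_closed_ball M_hausdorff cH cp0.
pose r := Num.min r1 r2; have r0 : 0 < r by rewrite lt_min r10.
pose U := [set q | chart_dom cc q /\ `|cc q - cc q0| < r].
pose K := [set q | chart_dom cc q /\ `|cc q - cc q0| <= r / 2].
have rr1 : r <= r1 by rewrite ge_min lexx.
have U_O q : U q -> O q /\ V q.
  by move=> [cq qr]; apply: (r1P q cq); exact: lt_le_trans rr1.
have KU : K `<=` U by move=> q [cq qr]; split=> //; apply: (le_lt_trans qr); lra.
have Unear q : U q -> nbhs q U.
  move=> [cq qr]; apply: filterI; first exact: (chart_near ccH cq).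
  have h := chart_continuous ccH cq.
  have h' : (fun q' => `|cc q' - cc q0|) @ q --> `|cc q - cc q0|.
    by apply: cvg_norm; apply: (@cvgB _ _ _ (nbhs q)); [exact: h|exact: cvg_cst].
  exact: (cvgr_lt _ h' _ qr).
have cK : closed K.
  have -> : K = ((fun q : N => q.1) @^-1` [set p | chart_dom c p /\ `|c p - c q0.1| <= r / 2])
      `&` [set q : N | `|\val q.2 - \val q0.2 : R| <= r / 2].
    apply/seteqP; split=> [q [cq]|q [[cq h1] h2]].
      by rewrite prod_normE ge_max => /andP[h1 h2].
    by split=> //; rewrite prod_normE ge_max h1.
  apply: closedI.
    apply: closed_comp => [q _|]; first exact: cylinder_fst_continuous.
    by apply: r2P; rewrite (lt_le_trans (_ : r / 2 < r)) ?ge_min ?lexx ?orbT//; lra.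
  apply: (@closed_comp _ _ (fun q : N => `|\val q.2 - \val q0.2 : R|) [set s | s <= r / 2]) => [q _|].
    apply: cvg_norm; apply: (@cvgB _ _ _ (nbhs q)); last exact: cvg_cst.
    exact: cylinder_val_continuous.
  exact: closed_le.
exists (r / 2 / C); first by rewrite !divr_gt0.
move=> q dq; have e0 : 0 < r / 2 / C - dist q0 q by rewrite subr_gt0.
have [l [a [b [sg [ab acs sa sb ->]]]]] := dist_approx pm joined_connected q0 q e0.
rewrite addrC subrK => len_lt.
suff : U (sg b) by rewrite sb => /U_O[].
apply: contrapT => nUb.
(* the infimum s of Z is the first exit time *)
pose Z := [set s | a <= s <= b /\ ~ U (sg s)].
have Zb : Z b by split=> //; rewrite ab lexx.
have Za : lbound Z a by move=> s [/andP[]].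
have hZ : has_inf Z by split; [exists b|exists a].
pose s := inf Z.
have as_ : a <= s by apply: lb_le_inf => //; exists b.
have sb' : s <= b by apply: ge_inf => //; exists a.
have Us t : a <= t -> t < s -> U (sg t).
  move=> at_ ts; apply: contrapT => nU; have tb : t <= b := le_trans (ltW ts) sb'.
  have : s <= t by apply: ge_inf; [exists a|split=> //; rewrite at_ tb].
  by rewrite leNgt ts.
have Ks t : a <= t -> t < s -> K (sg t).
  move=> at_ ts; have [ct _] := Us t at_ ts; split=> //.
  have tb : t <= b by rewrite (le_trans (ltW ts)).
  have h := @chart_displacement cc V C a t sg CC Vdom C0.
  rewrite -sa; apply: (le_trans (h _ _ _ _)).
  - move=> q' v Vq'; have [h1 _] := nrmV q' v Vq'.
    by rewrite -ler_pdivrMl.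
  - exact: at_.
  - exact: abs_continuous_curveS tb acs.
  - by move=> x ax xt; have [] := U_O (sg x) (Us x ax (le_lt_trans xt ts)).
  have := curve_length_cat si at_ tb acs; have := curve_length_ge0 pm t b sg => g0 lE.
  have : len a t sg <= r / 2 / C by lra.
  by rewrite ler_pdivlMr// mulrC.
have KS : K (sg s).
  have [sE|sna] := eqVneq s a.
    by rewrite sE sa; split=> //; rewrite subrr normr0 divr_ge0 ?ltW.
  apply: contrapT => nK.
  have nK' : nbhs (sg s) (~` K) by apply: open_nbhs_nbhs; split=> //; exact: closed_openC.
  have [d d0 dP] := within_itv_near acs.1 as_ sb' nK'.
  have lt_as : a < s by rewrite lt_neqAle eq_sym sna.
  pose t := Num.max a (s - d / 2).
  have ta : a <= t by rewrite le_max lexx.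
  have ts : t < s by rewrite gt_max lt_as; lra.
  have : s - d < t by rewrite lt_max; apply/orP; right; lra.
  move=> td; apply: (dP t ta _ td); [by rewrite (le_trans (ltW ts))|by lra|exact: Ks].
have [d d0 dP] := within_itv_near acs.1 as_ sb' (Unear _ (KU _ KS)).
have [z Zz zs] := inf_adherent d0 hZ.
have sz : s <= z by apply: ge_inf => //; exists a.
have [/andP[az zb] nUz] := Zz; apply: nUz; apply: dP => //.
by lra.
Qed.

Lemma dist_eq0 q0 q : dist q0 q = 0 -> q0 = q.
Proof.
move=> d0; apply: contrapT => /eqP neq.
suff : exists2 O : set N, nbhs q0 O & ~ O q.
  by move=> [W hW nW]; have [rho rho0 h] := dist_nbhs hW; apply: nW; apply: h; rewrite d0.
have [pE|pne] := eqVneq q0.1 q.1.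
  have tne : (\val q0.2 : R) != \val q.2.
    apply: contra neq => /eqP tE; apply/eqP; case: q0 q pE tE {d0} => p t [p' t'] /= -> tE.
    by congr (_, _); exact: val_inj.
  exists [set q' : N | \val q'.2 != \val q.2 :> R]; last by rewrite /= eqxx.
  apply: (@cylinder_val_continuous q0 [set x : R | x != \val q.2]).
  by apply: open_nbhs_nbhs; split; [exact: open_neq|].
have [W [oW Wp nW]] := hausdorff_accessible M_hausdorff pne.
exists [set q' : N | W q'.1].
  apply: (@cylinder_fst_continuous R M q0 W); apply: open_nbhs_nbhs; split=> //.
  by rewrite inE in Wp.
by move: nW; rewrite inE.
Qed.

Lemma induced_is_distance : is_distance dist.
Proof.
split.
- exact: (dist_self pm si).
- exact: dist_eq0.
- exact: (dist_symmetric pm si).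
- by move=> y x z; exact: (dist_triangular pm si joined_connected).
Qed.

(** * Hyperbolicity of the cylinder *)

Hypothesis M_compact : compact [set: M].
Notation X := (metric_space induced_is_distance).

Lemma cylinder_to_metric_continuous : continuous ((fun q : N => q) : N -> X).
Proof.
move=> q U /nbhs_ballP[e /= e0 eU]; apply: filterS (dist_near q e0) => q' h.
by apply: eU; rewrite ballEmdist.
Qed.

(** [height_le_length] for all the curves from q to q'. *)
Lemma height_lipschitz (q q' : N) : `|height q - height q'| <= C1 * C2 * dist q q'.
Proof.
have K0 : 0 < C1 * C2 by rewrite mulr_gt0.
rewrite -ler_pdivrMl// distE; apply: lb_le_inf; first exact: joined_connected.
move=> l [a [b [s [ab acs <- <- ->]]]].
by rewrite ler_pdivrMl// distrC; exact: height_le_length.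
Qed.

Lemma compact_height_ge (e : R) : 0 < e -> compact [set q : N | e <= \val q.2].
Proof.
move=> e0; pose T1 := [set t : unit_itv R | e <= \val t].
have -> : [set q : N | e <= \val q.2] = setT `*` T1.
  by apply/seteqP; split=> q //= [].
apply: compact_setX; first exact: M_compact.
have -> : T1 = insubd (unit_itv1 : unit_itv R) @` `[e, 1].
  apply/seteqP; split=> [t et|_ [x xe <-]].
    by exists (\val t); [rewrite /= in_itv/= et unit_itv_le1|exact: valKd].
  move: xe; rewrite /= in_itv/= => /andP[ex x1].
  by rewrite /T1/= insubd_unit_itv// (lt_le_trans e0).
apply: continuous_compact; last exact: segment_compact.
apply/subspace_continuousP => x; rewrite /= in_itv/= => /andP[ex x1].
apply: cvg_unit_itv; rewrite insubd_unit_itv//; last exact: lt_le_trans ex.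
move=> U Ux; have Ux' : \forall y \near x, U y := Ux.
change (nbhs x [set y | `[e, 1]%classic y -> U (\val (insubd (unit_itv1 : unit_itv R) y))]).
apply: filterS Ux' => y Uy; rewrite /= in_itv/= => /andP[ey y1].
by rewrite insubd_unit_itv// (lt_le_trans e0).
Qed.

(** A ball of the distance is closed in the manifold, and is contained in some
M x [e, 1] since the height is Lipschitz. *)
Lemma induced_proper : proper_space X.
Proof.
move=> x r; pose B : set N := [set q | dist x q <= r].
have cB : closed B.
  apply: (@closed_comp _ _ (dist x) [set s | s <= r]) => [q _|]; last exact: closed_le.
  exact: dist_continuous.
pose e := expR (height x - C1 * C2 * r).
have Be : B `<=` [set q : N | e <= \val q.2].
  move=> q Bq /=; rewrite -expR_height ler_expR.
  have h := height_lipschitz x q; have := le_trans (ler_norm _) h.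
  have : C1 * C2 * dist x q <= C1 * C2 * r by rewrite ler_pM2l// mulr_gt0.
  lra.
have cptB : compact B.
  exact: (subclosed_compact cB (compact_height_ge (expR_gt0 _)) Be).
have := @continuous_compact _ _ ((fun q : N => q) : N -> X) B.
rewrite image_id; apply; last exact: cptB.
by apply: continuous_subspaceT; exact: cylinder_to_metric_continuous.
Qed.

Lemma induced_geodesic : geodesic_space X.
Proof.
apply: (proper_length_geodesic induced_proper) => x y r e r0 rd e0.
exact: (dist_intermediate pm si joined_connected dist_continuous r0 rd e0).
Qed.

(** The distance to a given point is continuous on the compact set M x {1}. *)
Lemma dist_top_bounded : exists T : R, forall q q' : N,
  dist (lift_to 0 q) (lift_to 0 q') <= T.
Proof.
have [q0|noq] := pselect (exists q0 : N, True); last first.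
  by exists 0 => q; exfalso; apply: noq; exists q.
move: q0 => [q0 _].
pose top (p : M) : N := lift_to 0 (p, q0.2).
have ctop : continuous top.
  by move=> p; apply: cvg_cylinder; [exact: cvg_id|exact: cvg_cst].
pose f (p : M) : R := dist (lift_to 0 q0) (top p).
have cf : continuous f.
  by move=> p; exact: (cvg_comp _ _ (ctop p) (@dist_continuous (lift_to 0 q0) (top p))).
have cptf : compact (f @` setT).
  by apply: continuous_compact M_compact; exact: continuous_subspaceT.
have [k [_ kP]] := compact_bounded cptf.
have bnd q : dist (lift_to 0 q0) (lift_to 0 q) <= `|k| + 1.
  have h := kP (`|k| + 1) (le_lt_trans (ler_norm k) _) (f q.1) (ex_intro2 _ _ q.1 I erefl).
  by apply: le_trans (ler_norm _) (h _); rewrite ltrDl.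
exists ((`|k| + 1) + (`|k| + 1)) => q q'.
apply: (le_trans (dist_triangular pm si joined_connected (lift_to 0 q0) _ _)).
by rewrite lerD// (dist_symmetric pm si).
Qed.

(** If t is at least 2 * C1 * C2 above x, then a curve of length at most 2 from x to y
stays below the height t and [lifted_curve] applies.  Otherwise x and y are at a
bounded distance of their projections. *)
Lemma lift_to_contract : exists2 D : R, 0 <= D & forall (x y : N) t,
  dist x y <= 1 -> height x <= t -> t <= 0 ->
  dist (lift_to t x) (lift_to t y) <= D * expR (- (lam * (t - height x))).
Proof.
pose K := C1 * C2; have K0 : 0 < K by rewrite mulr_gt0.
pose D1 := 2 * ((1 + C2) / C3) * expR (lam * (2 * K)).
(* 1 bounds the distance of x and y, and 5 C1 K the two vertical displacements,
   of heights 2 K and 3 K, in the case where t is near the height of x *)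
pose D2 := (1 + 5 * (C1 * K)) * expR (lam * (2 * K)).
have D10 : 0 <= D1.
  by rewrite /D1 !mulr_ge0 ?expR_ge0 ?invr_ge0 ?addr_ge0 ?ltW.
have D20 : 0 <= D2.
  by rewrite /D2 !mulr_ge0 ?expR_ge0 ?addr_ge0// !mulr_ge0 // ltW.
exists (D1 + D2) => [|x y t dxy xt t0]; first exact: addr_ge0.
have E0 : 0 <= expR (- (lam * (t - height x))) := expR_ge0 _.
have [far|near] := leP (height x + 2 * K) t; last first.
  have h1 := dist_vertical x (height_le0 x) t0.
  have h2 := dist_vertical y (height_le0 y) t0.
  rewrite !lift_to_height in h1 h2.
  have h3 := height_lipschitz x y.
  have h4 : `|height x - height y| <= K.
    by apply: le_trans h3 _; rewrite -/K ler_piMr// ltW.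
  have h5 : `|t - height x| <= 2 * K by rewrite ger0_norm ?subr_ge0//; lra.
  have h6 : `|t - height y| <= 3 * K.
    have := ler_normD (t - height x) (height x - height y); rewrite addrA subrK; lra.
  have tr1 := dist_triangular pm si joined_connected x (lift_to t x) (lift_to t y).
  have tr2 := dist_triangular pm si joined_connected y x (lift_to t y).
  rewrite (dist_symmetric pm si (lift_to t x) x) in tr1.
  have b1 : C1 * `|t - height x| <= C1 * (2 * K) by rewrite ler_pM2l.
  have b2 : C1 * `|t - height y| <= C1 * (3 * K) by rewrite ler_pM2l.
  have small : dist (lift_to t x) (lift_to t y) <= 1 + 5 * (C1 * K) by lra.
  have big : 1 + 5 * (C1 * K) <= D2 * expR (- (lam * (t - height x))).
    have B0 : 0 <= 1 + 5 * (C1 * K) by have := mulr_gt0 C1_gt0 K0; lra.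
    rewrite /D2 -mulrA -expRD; apply: (ler_peMr B0).
    by rewrite -[leLHS]expR0 ler_expR -mulrBr; apply: mulr_ge0; [exact: ltW|lra].
  rewrite mulrDl; have := mulr_ge0 D10 E0; lra.
have [l [a [b [s [ab acs sa sb lE]]]] l2] := dist_approx pm joined_connected x y ltr01.
have {}l2 : len a b s <= 2 by rewrite -lE; lra.
pose S := expR (height x + 2 * K).
have sS u : a <= u -> u <= b -> \val (s u).2 <= S.
  move=> au ub; rewrite -expR_height ler_expR.
  have hu := height_le_length au (abs_continuous_curveS (lexx a) ub acs).
  have := curve_length_cat si au ub acs; have := curve_length_ge0 pm u b s => g0 lc.
  have lu : len a u s <= 2 by lra.
  have := le_trans (ler_norm _) hu; rewrite sa -/K.
  have : K * len a u s <= K * 2 by rewrite ler_pM2l.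
  lra.
have St : S <= expR t by rewrite ler_expR.
have [acl ll] := lifted_curve ab t0 acs sS St.
have := dist_le pm (joined_curve nrm ab acl); rewrite /= sa sb => /le_trans; apply.
apply: (le_trans ll).
have -> : (S / expR t) `^ lam = expR (lam * (2 * K)) * expR (- (lam * (t - height x))).
  rewrite /S -expRB /powR gt_eqF ?expR_gt0// expRK -expRD; congr expR; ring.
rewrite [leRHS]mulrDl -[leLHS]addr0; apply: lerD; last exact: mulr_ge0.
set k := (1 + C2) / C3 * _; have k0 : 0 <= k.
  by rewrite /k !mulr_ge0 ?expR_ge0 ?invr_ge0 ?addr_ge0 ?ltW.
apply: (le_trans (ler_wpM2l k0 l2)); rewrite /k /D1 le_eqVlt; apply/orP; left; apply/eqP; ring.
Qed.

Lemma induced_hyperbolic : gromov_hyperbolic X.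
Proof.
have [D D0 contract] := lift_to_contract; have [T topP] := dist_top_bounded.
pose C := C1 * C2 + C1 + D + `|T|.
have K0 : 0 < C1 * C2 by rewrite mulr_gt0.
have T0 : 0 <= `|T| := normr_ge0 T.
have d0 (x y : N) : 0 <= dist x y := dist_ge0 pm x y.
have V : @vertical_contraction R X height lift_to C lam.
  split.
  - by rewrite /C; have := C1_gt0; lra.
  - exact: lam_gt0.
  - exact: height_le0.
  - move=> x y; apply: (le_trans (height_lipschitz x y)).
    by apply: ler_wpM2r; [exact: d0|rewrite /C; have := C1_gt0; lra].
  - by move=> x t; exact: height_lift_to.
  - by [].
  - exact: lift_to_height.
  - move=> x s t st t0.
    have := dist_vertical x (le_trans st t0) t0; rewrite ger0_norm ?subr_ge0// => h.
    apply: (le_trans h); apply: ler_wpM2r; first by rewrite subr_ge0.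
    by rewrite /C; lra.
  - move=> x y t xy xt t0; apply: (le_trans (contract x y t xy xt t0)).
    by apply: ler_wpM2r; [exact: expR_ge0|rewrite /C; have := C1_gt0; lra].
  - move=> x y; apply: (le_trans (topP x y)); have := ler_norm T.
    by rewrite /C; have := C1_gt0; lra.
split; [exact: induced_proper|exact: induced_geodesic|].
exact: (vertical_contraction_slim V induced_geodesic).
Qed.

End cylinder_estimates.

Theorem theorem1p1 (R : realType) (m : nat) (M : topologicalType)
  (A : atlas M 'rV[R]_m)
  (M_manifold : smooth_manifold setT A)
  (M_compact : compact [set: M])
  (M_connected : connected [set: M])
  (nrm : cylinder R M -> 'rV[R]_m * R -> R)
  (nrm_pseudo_metric :
    pseudo_metric half_space euclidean_norm (cylinder_atlas A) nrm)
  (nrm_strongly_integrable :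
    strongly_integrable half_space (cylinder_atlas A) nrm)
  (hyp_a : exists2 C1 : R, 1 < C1 & forall (p : M) (t : unit_itv R),
    1 / (C1 * \val t) <= nrm (p, t) (0, 1) /\
    nrm (p, t) (0, 1) <= C1 * (1 / \val t))
  (hyp_b : exists2 C2 : R, 0 < C2 &
    forall (p : M) (t : unit_itv R) (v : 'rV[R]_m),
    nrm (p, t) (v, 0) + nrm (p, t) (0, 1) <= C2 * nrm (p, t) (v, 1))
  (hyp_c : exists C3 lambda : R, [/\ 0 < C3, 0 < lambda &
    forall (p : M) (s t : unit_itv R) (v : 'rV[R]_m), \val s <= \val t ->
    nrm (p, s) (v, 0) >= C3 * (\val t / \val s) `^ lambda * nrm (p, t) (v, 0)]) :
  exists dP : is_distance
      (induced_distance half_space (cylinder_atlas A) nrm),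
    gromov_hyperbolic (metric_space dP).
Proof.
have [M_hausdorff _ smA] := M_manifold.
have [C1 C1_gt1 ha] := hyp_a; have [C2 C2_gt0 hb] := hyp_b.
have [C3 [lam [C3_gt0 lam_gt0 hc]]] := hyp_c.
exists (induced_is_distance smA nrm_pseudo_metric nrm_strongly_integrable
  C1_gt1 ha M_connected M_hausdorff).
exact: (induced_hyperbolic smA nrm_pseudo_metric nrm_strongly_integrable
  C1_gt1 ha C2_gt0 hb C3_gt0 lam_gt0 hc M_connected M_hausdorff M_compact).
Qed.
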